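(* Let $W\subset X$ be domains in $\mathbb{C}^n$. Suppose that one of the following two conditions holds. (i) There is a continuous section $X\to X_W^0$ of $\pi:X_W\to X$ extending the tautological section on $W$. (ii) The restriction of $\pi$ to some connected component of $X_W$ is a bijection onto $X$. Then, for every upper semicontinuous function $\phi:W\to[-\infty,\infty)$, $$S\phi = E_{\mathscr{A}_X^W}\phi \quad\text{on } X.$$
   Context: A domain is a connected, nonempty, open subset. $\mathbb{D}$ is the open unit disc in $\mathbb{C}$, $\mathbb{T}=\partial\mathbb{D}$, and $\lambda$ is the normalised arc length measure on $\mathbb{T}$. The constant function $-\infty$ is considered plurisubharmonic. $\mathscr{A}_X$ is the set of analytic discs in $X$, i.e. continuous maps $f:\overline{\mathbb{D}}\to X$ that are holomorphic on $\mathbb{D}$, with the topology of uniform convergence on $\overline{\mathbb{D}}$ (the compact-open topology); $f(0)$ is the centre of $f$. For an open subset $W\subset X$, $\mathscr{A}_X^W=\{f\in\mathscr{A}_X: f(\mathbb{T})\subset W\}$, with the subspace topology. For upper semicontinuous $\phi:W\to[-\infty,\infty)$, define $S\phi=\sup\{u: u \text{ plurisubharmonic on } X,\ u|_W\leq\phi\}$ (pointwise supremum) and $E_{\mathscr{A}_X^W}\phi(x)=\inf\{\int_{\mathbb{T}}\phi\circ f\,d\lambda: f\in\mathscr{A}_X^W, f(0)=x\}$ for $x\in X$. Two discs $f_0,f_1\in\mathscr{A}_X^W$ with $f_0(0)=f_1(0)$ are centre-homotopic if there is a continuous map $f:\overline{\mathbb{D}}\times[0,1]\to X$ with $f(\cdot,t)\in\mathscr{A}_X^W$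 and $f(0,t)=f_0(0)$ for all $t\in[0,1]$, and $f(\cdot,t)=f_t$ for $t=0,1$. The equivalence relation $\sim_c$ on $\mathscr{A}_X^W$ is defined by $f\sim_c g$ if $f$ and $g$ have the same centre and are centre-homotopic. $q:\mathscr{A}_X^W\to X_W=\mathscr{A}_X^W/\sim_c$ is the quotient map, and $X_W$ carries the quotient topology. The centre map $\mathscr{A}_X^W\to X$, $f\mapsto f(0)$, factors through $q$ by a continuous map $\pi:X_W\to X$. $X_W^0$ is the connected component of $X_W$ containing the equivalence classes of the constant discs in $W$. The tautological section on $W$ is the map $W\to X_W^0$ taking $w\in W$ to the equivalence class of the constant disc at $w$. *)

(* Defs.v *)
From HB Require Import structures.
From mathcomp Require Import all_boot all_order all_algebra.
From mathcomp Require Import generic_quotient complex.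
From mathcomp Require Import all_classical all_reals all_analysis.
From mathcomp Require Import lra.

Set Implicit Arguments.
Unset Strict Implicit.
Unset Printing Implicit Defensive.

Import Order.TTheory GRing.Theory Num.Theory numFieldNormedType.Exports.
Local Open Scope classical_set_scope.
Local Open Scope ring_scope.
Local Open Scope complex_scope.
Local Open Scope quotient_scope.

(* R[i] with the topology of its modulus; 'rV[R[i]]_n then gets the product
   topology and the complex normed-module structure from the library. *)
HB.instance Definition _ (R : realType) := NormedModule.copy R[i] R[i]^o.

Definition domain (T : topologicalType) (A : set T) : Prop :=
  [/\ open A, connected A & A !=set0].

(* Functions that matter only on A are total; their values off A are junk. *)
Definition usc_on (R : realType) (T : topologicalType) (A : set T)
    (f : T -> \bar R) : Prop :=
  forall x, A x ->
    (f x < +oo)%E /\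
    forall a : R, (f x < a%:E)%E -> \forall y \near within A (nbhs x), (f y < a%:E)%E.

Section CircleMean.
Context {R : realType}.

Definition expit (t : R) : R[i] := cos t +i* sin t.

(* The integral of g over the unit circle for normalised arc length. For the
   functions bounded above used here the positive part has finite integral, so
   the value is the usual one in [-oo, +oo). *)
Definition circle_mean (g : R[i] -> \bar R) : \bar R :=
  (((2 * pi)^-1)%:E *
   \int[lebesgue_measure]_(t in `[0%R, (2 * pi)%R]) g (expit t))%E.

(* The function identically -oo is allowed. *)
Definition subharmonic (A : set R[i]) (v : R[i] -> \bar R) : Prop :=
  usc_on A v /\
  forall (a : R[i]) (r : R), 0 < r ->
    (forall z : R[i], `|z| <= 1 -> A (a + r%:C * z)) ->
    (v a <= circle_mean (fun z => v (a + r%:C * z)%R))%E.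

Definition plurisubharmonic n (X : set 'rV[R[i]]_n)
    (u : 'rV[R[i]]_n -> \bar R) : Prop :=
  usc_on X u /\
  forall a b : 'rV[R[i]]_n,
    subharmonic [set z | X (a + z *: b)] (fun z => u (a + z *: b)).

End CircleMean.

Section Discs.
Context {R : realType}.

Definition closed_disc : set R[i] := [set z | `|z| <= 1].

Lemma closed_disc0 : closed_disc 0.
Proof. by rewrite /closed_disc/= normr0 ler01. Qed.

Definition disc0 : closed_disc := SigSub (mem_set closed_disc0).

Context {n : nat}.
Local Notation Cn := 'rV[R[i]]_n.
Implicit Types X W : set Cn.

(* f on the closed disc and 0 elsewhere; it represents f near points of the
   open disc, where [derivable _ z 1] is complex differentiability at z. *)
Definition disc_ext (f : closed_disc -> Cn) : R[i] -> Cn := 'valL_(0 : Cn) f.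

Definition analytic_discs X : set {uniform closed_disc -> Cn} :=
  [set f | [/\ continuous (f : closed_disc -> Cn),
               forall z : R[i], `|z| < 1 -> derivable (disc_ext f) z 1
             & forall z : closed_disc, X (f z)]].

Definition analytic_discs_in X W : set {uniform closed_disc -> Cn} :=
  analytic_discs X `&`
  [set f | forall z : closed_disc, `|val z| = 1 -> W (f z)].

(* The set [analytic_discs_in X W], coerced to a type, carries the subspace
   topology of uniform convergence. *)
Definition disc_space X W : topologicalType := analytic_discs_in X W.

Definition centre (f : closed_disc -> Cn) : Cn := f disc0.

Definition centre_homotopic X W (f0 f1 : disc_space X W) : Prop :=
  exists F : closed_disc * R -> Cn,
    [/\ {within [set: closed_disc] `*` `[0, 1], continuous F},
        forall t : R, 0 <= t <= 1 ->
          analytic_discs_in X W (fun z => F (z, t)) /\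
          F (disc0, t) = centre (val f0),
        forall z, F (z, 0) = val f0 z
      & forall z, F (z, 1) = val f1 z].

Definition centre_rel X W : rel (disc_space X W) := fun f g =>
  `[< centre (val f) = centre (val g) /\ centre_homotopic f g >].

Lemma within_comp (S T U : topologicalType) (A : set S) (B : set T)
    (g : S -> T) (f : T -> U) :
  continuous g -> (forall x, A x -> B (g x)) ->
  {within B, continuous f} -> {within A, continuous (f \o g)}.
Proof.
move=> cg AB /subspace_continuousP cf; apply/subspace_continuousP => x Ax.
apply: cvg_comp (cf _ (AB _ Ax)) => V /=; rewrite !withinE/= => -[V' nV' VV'].
have := cg x _ nV'; rewrite /nbhs/= => ngV'.
exists (g @^-1` V') => //; apply/seteqP; split=> y /= [] Vy Ay; split => //.
  have : (V `&` B) (g y) by split => //; exact: AB.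
  by rewrite VV' => -[].
have : (V' `&` B) (g y) by split => //; exact: AB.
by rewrite -VV' => -[].
Qed.

Lemma centre_homotopic_refl X W (f : disc_space X W) : centre_homotopic f f.
Proof.
exists (fun p => val f p.1); split => //; last first.
  by move=> t _; split => //; case: f => /= f /set_mem.
apply: continuous_subspaceT => p; have [[cf _ _] _] := set_mem (valP f).
by apply: (@continuous_comp _ _ _ fst (val f : closed_disc -> Cn));
  [exact: cvg_fst|exact: cf].
Qed.

Lemma reparam_continuous (a b : R) :
  continuous (fun p : closed_disc * R => (p.1, a * p.2 + b) : closed_disc * R).
Proof.
move=> p.
have h : a * q.2 + b @[q --> p] --> a * p.2 + b.
  by apply: cvgD; [apply: cvgM; [exact: cvg_cst|exact: cvg_snd]|exact: cvg_cst].
have h1 : q.1 @[q --> p] --> p.1 by exact: cvg_fst.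
exact: cvg_pair h1 h.
Qed.

Lemma within_reparam (a b : R) (A B : set (closed_disc * R))
    (F : closed_disc * R -> Cn) :
  (forall p, A p -> B (p.1, a * p.2 + b)) ->
  {within B, continuous F} ->
  {within A, continuous (fun p => F (p.1, a * p.2 + b))}.
Proof.
move=> AB cF.
exact: (@within_comp _ _ _ A B (fun p => (p.1, a * p.2 + b)) F
          (@reparam_continuous a b) AB cF).
Qed.

Lemma centre_homotopic_sym X W (f g : disc_space X W) :
  centre_homotopic f g -> centre_homotopic g f.
Proof.
move=> [F [cF dF F0 F1]]; exists (fun p => F (p.1, -1 * p.2 + 1)); split.
- apply: within_reparam cF => -[z t]/= [_]; rewrite !in_itv/= => /andP[t0 t1].
  by split => //=; rewrite mulN1r addrC subr_ge0 t1 lerBlDr lerDl.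
- move=> t /andP[t0 t1] /=; have [|dt ct] := dF (-1 * t + 1).
    by rewrite mulN1r addrC subr_ge0 t1 lerBlDr lerDl.
  split; [exact: dt|rewrite ct].
  have [|_ <-] := dF 1; first by rewrite ler01 lexx.
  by rewrite /centre F1.
- by move=> z /=; rewrite mulr0 add0r.
- by move=> z /=; rewrite mulN1r addNr.
Qed.

Lemma centre_homotopic_trans X W (f g h : disc_space X W) :
  centre_homotopic f g -> centre_homotopic g h -> centre_homotopic f h.
Proof.
move=> [F [cF dF F0 F1]] [G [cG dG G0 G1]].
have cfg : centre (val g) = centre (val f).
  by have [|_ <-] := dF 1; [rewrite ler01 lexx|rewrite /centre F1].
pose H (p : closed_disc * R) : Cn :=
  if p.2 <= 2^-1 then F (p.1, 2 * p.2 + 0) else G (p.1, 2 * p.2 + -1).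
have h01 : (0 : R) < 2^-1 by rewrite invr_gt0 ltr0n.
have h2 : (2 : R) * 2^-1 = 1 by rewrite divff// pnatr_eq0.
have cl (a b : R) : closed ([set: closed_disc] `*` `[a, b]).
  have -> : [set: closed_disc] `*` `[a, b] = snd @^-1` `[a, b].
    by apply/seteqP; split => [[z t] []|[z t]].
  apply: preimage_closed; first by move=> p _; exact: cvg_snd.
  exact: interval_closed.
exists H; split.
- have -> : [set: closed_disc] `*` `[0, 1] =
      ([set: closed_disc] `*` `[0, 2^-1]) `|`
      ([set: closed_disc] `*` `[2^-1, (1:R)]).
    apply/seteqP; split=> [[z t] /= [_]|[z t] /= [] [_]].
    + rewrite in_itv/= => /andP[t0 t1]; have [th|th] := leP t 2^-1.
        by left; split=> //; rewrite in_itv/= t0.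
      by right; split=> //; rewrite in_itv/= (ltW th).
    + rewrite in_itv/= => /andP[t0 t1]; split=> //; rewrite in_itv/= t0/=.
      by rewrite (le_trans t1)// invf_le1 ?ltr0n// ler1n.
    + rewrite in_itv/= => /andP[t0 t1]; split=> //; rewrite in_itv/= t1 andbT.
      exact: le_trans (ltW h01) t0.
  apply: withinU_continuous; [exact: cl|exact: cl| |].
  + apply: (@subspace_eq_continuous _ _ _
      (fun p : closed_disc * R => F (p.1, 2 * p.2 + 0))).
      move=> [z t] /set_mem [_] /=; rewrite in_itv/= => /andP[t0 t1].
      by rewrite /from_subspace /H/= t1.
    apply: within_reparam cF.
    move=> [z t]/= [_]; rewrite !in_itv/= => /andP[t0 t1]; split => //=.
    by apply/andP; split; lra.
  + apply: (@subspace_eq_continuous _ _ _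
      (fun p : closed_disc * R => G (p.1, 2 * p.2 + -1))).
      move=> [z t] /set_mem [_] /=; rewrite in_itv/= => /andP[t0 t1].
      rewrite /from_subspace /H/=; case: ifPn => // th.
      have -> : t = 2^-1 by apply/eqP; rewrite eq_le th t0.
      by rewrite h2 subrr addr0 G0 F1.
    apply: within_reparam cG.
    move=> [z t]/= [_]; rewrite !in_itv/= => /andP[t0 t1]; split => //=.
    by apply/andP; split; lra.
- move=> t /andP[t0 t1]; rewrite /H/=; have [th|th] := leP t 2^-1.
    by apply: dF; apply/andP; split; lra.
  by rewrite -cfg; apply: dG; apply/andP; split; lra.
- by move=> z; rewrite /H/= (ltW h01) mulr0 addr0 F0.
- move=> z; rewrite /H/= (_ : (1 <= 2^-1 :> R) = false); last first.
    by apply/negbTE; rewrite -ltNge; lra.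
  have -> : 2 * 1 + -1 = 1 :> R by lra.
  exact: G1.
Qed.

Lemma centre_rel_equiv X W : equiv_class_of (@centre_rel X W).
Proof.
split.
- by move=> f; apply/asboolP; split => //; exact: centre_homotopic_refl.
- by move=> f g; apply/asboolP/asboolP => -[e /centre_homotopic_sym].
- move=> g f h /asboolP[e1 h1] /asboolP[e2 h2]; apply/asboolP.
  by split; [rewrite e1|exact: centre_homotopic_trans h1 h2].
Qed.

Canonical centre_equiv X W := EquivRelPack (@centre_rel_equiv X W).

Definition disc_classes X W : topologicalType :=
  quotient_topology {eq_quot @centre_equiv X W}.

Definition disc_class X W (f : disc_space X W) : disc_classes X W :=
  \pi_(disc_classes X W) f.

(* The map induced by the centre map on the quotient, see [class_centreE]. *)
Definition class_centre X W (p : disc_classes X W) : Cn := centre (val (repr p)).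

Lemma class_centreE X W (f : disc_space X W) :
  class_centre (disc_class f) = centre (val f).
Proof.
rewrite /class_centre /disc_class; case: piP => g /eqquotP.
by move=> /asboolP[].
Qed.

Lemma disc_extE (f : closed_disc -> Cn) (z : closed_disc) :
  disc_ext f (val z) = f z.
Proof.
exact: (congr1 (fun h : closed_disc -> Cn => h z)
         (@valLK _ _ (0 : Cn) closed_disc f)).
Qed.

Lemma cst_disc_in X W (w : Cn) : W `<=` X -> W w ->
  analytic_discs_in X W (fun=> w).
Proof.
move=> sWX Ww; split; last by move=> z _; exact: Ww.
have cw : continuous (fun _ : closed_disc => w) by exact: cst_continuous.
split; [exact: cw| |by move=> z; exact: sWX].
move=> z z1; apply: (@near_eq_derivable _ _ _ (fun=> w)); last first.
  exact: derivable_cst.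
have e0 : 0 < 1 - `|z| by rewrite subr_gt0.
apply: filterS (nbhsx_ballx z _ e0) => y zy.
have y1 : closed_disc y.
  apply: ltW; rewrite -[y](subKr z) (le_lt_trans (ler_normB _ _))//.
  by rewrite -ltrBrDl.
by rewrite -[y]/(val (SigSub (mem_set y1) : closed_disc)) disc_extE.
Qed.

Section Tautological.
Context {X W : set Cn} (sWX : W `<=` X).

Definition cst_disc (w : W) : disc_space X W :=
  SigSub (mem_set (cst_disc_in sWX (set_mem (valP w)))).

Definition tautological_section (w : W) : disc_classes X W :=
  disc_class (cst_disc w).

(* The component containing the classes of the constant discs in W: for W
   connected all the sets in the union coincide, see [main_componentE]. *)
Definition main_component : set (disc_classes X W) :=
  \bigcup_(w : W) connected_component setT (tautological_section w).

Lemma tautological_section_continuous : continuous tautological_section.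
Proof.
have cval : continuous (val : W -> Cn) by exact: initial_continuous.
have cc : continuous (fun w : W =>
    (fun=> val w) : {uniform closed_disc -> Cn}).
  move=> w U /uniform_nbhs[E [entE EU]].
  have h := cval w _ (nbhs_entourage (val w) entE).
  apply: (@filterS _ (nbhs w) _ _ _ _ h) => v /xsectionP Ev; apply: EU => z _.
  exact: Ev.
have cd : continuous cst_disc by apply: continuous_comp_initial.
move=> w; apply: (@continuous_comp _ _ _ cst_disc); first exact: cd.
exact: pi_continuous.
Qed.

Lemma main_componentE (w : W) : connected W ->
  main_component = connected_component setT (tautological_section w).
Proof.
move=> cW; have cr : connected (range tautological_section).
  pose t := 'valL_(tautological_section w) tautological_section.
  have tE (v : W) : t (val v) = tautological_section v.
    exact: (congr1 (fun h : W -> disc_classes X W => h v)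
      (@valLK _ _ (tautological_section w) W tautological_section)).
  have -> : range tautological_section = t @` W.
    apply/seteqP; split=> [_ [v _ <-]|_ [v Wv <-]].
      by exists (val v); [exact: set_mem (valP v)|exact: tE].
    by exists (SigSub (mem_set Wv) : W) => //; rewrite -tE.
  apply: connected_continuous_connected => //.
  apply/subspace_sigL_continuousP; rewrite /t valLK.
  exact: tautological_section_continuous.
have sr (v u : W) : connected_component setT (tautological_section v)
    (tautological_section u).
  exists (range tautological_section); last by exists u.
  by split=> //; exists v.
apply/seteqP; split=> [p [v _]|p]; last by exists w.
by rewrite (same_connected_component (sr v w)).
Qed.

End Tautological.

Definition disc_envelope X W (phi : Cn -> \bar R) (x : Cn) : \bar R :=
  ereal_inf [set circle_mean (fun z => phi (disc_ext (val f) z)) |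
             f in [set f : disc_space X W | centre (val f) = x]].

Definition psh_envelope X W (phi : Cn -> \bar R) (x : Cn) : \bar R :=
  ereal_sup [set u x | u in
    [set u | plurisubharmonic X u /\ forall w, W w -> (u w <= phi w)%E]].

End Discs.

(* Main.v *)
(* Poletsky's method.  Suppose that a family B of discs in X with boundary in W
   contains exactly one homotopy class over each point of X and is stable under
   small translations.  Then v(x) = inf of the phi-means of the discs in B
   centred at x is upper semicontinuous on X.  For an analytic disc h in X,
   almost optimal discs of B centred at the points h(e^it) can be translated
   along short arcs of the boundary and, since discs with the same centre are
   homotopic, joined over tiny arcs of negligible cost; so they form a continuous
   family of discs over the whole circle, with F_t(0) = h(e^it).  Adding to h a
   finite sum k_j(z) (F_{t_j}(u z^N) - F_{t_j}(0)), with k_j a partition of unity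
   on the circle of the form z^-m S_j(z) and a suitable rotation u, gives a disc
   with the same centre as h and boundary in W whose phi-mean is at most the
   v-mean of h, up to epsilon; hence E phi(h(0)) <= mean of v over h.

   The same for W = X and all discs shows that Pv = E_X v is plurisubharmonic.
   If v <= phi on W, then Pv <= v <= phi on W, hence
   E phi <= Pv <= S phi <= E phi.

   In case (i), B consists of the discs whose class is on the section; it is
   stable under translations because homotopies can be perturbed, and it
   contains the constant discs in W.  In case (ii), B consists of the discs
   whose class is in the component.  The values at the boundary point 1 of the
   discs in B form an open and closed subset of W, thus all of W, and composing
   a disc with automorphisms of the unit disc moving 0 to 1 shows v <= phi on W. *)
From HB Require Import structures.
From mathcomp Require Import all_boot all_order all_algebra.
From mathcomp Require Import generic_quotient complex.
From mathcomp Require Import all_classical all_reals all_analysis.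
From mathcomp Require Import measurable_realfun ring lra zify.
Require Import Defs.

Set Implicit Arguments.
Unset Strict Implicit.
Unset Printing Implicit Defensive.

Import Order.TTheory GRing.Theory Num.Theory numFieldNormedType.Exports.
Local Open Scope classical_set_scope.
Local Open Scope ring_scope.
Local Open Scope complex_scope.

Local Notation Re := complex.Re.
Local Notation Im := complex.Im.

(** * The real-valued norm and the exponential *)

(** Upper semicontinuous integrands are handled through strict majorants [Re p] with [p] a
    polynomial. One exists as soon as the mean lies below a given bound, its own mean is [Re p.[0]],
    and a strict inequality over the compact circle survives small perturbations of the disc. Hence
    no measurable choice of almost optimal discs and no exchange of integrals occurs: the rotation
    [u] is found by averaging over finitely many roots of unity, which kills the nonconstant
    coefficients of the majorants. The factors [z^-m] have a pole at 0; it is cancelled by [u z^N]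
    with [N >= m + 2], and a large [N] also keeps the new disc inside [X]. A homotopy may carry
    large values of [phi]; running it over a tiny arc is charged to a nonnegative trigonometric
    polynomial that is large at one point but has small mean. The bound [S phi <= E phi] needs an
    argument too: the submean inequality is given along complex lines only, and discs are merely
    continuous up to the boundary. A perturbed maximum principle replaces smoothing, and its mean
    value property comes from Goursat's lemma in logarithmic polar coordinates. *)

Lemma cont_pair (T U V : topologicalType) (f : T -> U) (g : T -> V) (x : T) :
  {for x, continuous f} -> {for x, continuous g} ->
  {for x, continuous (fun t => (f t, g t))}.
Proof. by move=> cf cg; exact: (cvg_pair cf cg). Qed.

Lemma cont_comp (T U V : topologicalType) (f : T -> U) (g : U -> V) (x : T) :
  {for x, continuous f} -> {for f x, continuous g} ->
  {for x, continuous (fun t => g (f t))}.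
Proof. exact: continuous_comp. Qed.

Lemma cont_id (T : topologicalType) (x : T) : {for x, continuous (fun t : T => t)}.
Proof. exact: cvg_id. Qed.

Lemma cont_cst (T U : topologicalType) (u : U) (x : T) :
  {for x, continuous (fun=> u)}.
Proof. exact: cvg_cst. Qed.

Lemma cont_add (K : numFieldType) (V : normedModType K) (T : topologicalType)
    (f g : T -> V) (x : T) :
  {for x, continuous f} -> {for x, continuous g} ->
  {for x, continuous (fun t => f t + g t)}.
Proof. by move=> cf cg; exact: (cvgD cf cg). Qed.

Lemma cont_sub (K : numFieldType) (V : normedModType K) (T : topologicalType)
    (f g : T -> V) (x : T) :
  {for x, continuous f} -> {for x, continuous g} ->
  {for x, continuous (fun t => f t - g t)}.
Proof. by move=> cf cg; exact: (cvgB cf cg). Qed.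

Lemma cont_scale (K : numFieldType) (V : normedModType K) (T : topologicalType)
    (k : T -> K) (f : T -> V) (x : T) :
  {for x, continuous k} -> {for x, continuous f} ->
  {for x, continuous (fun t => k t *: f t)}.
Proof. by move=> ck cf; exact: (cvgZ ck cf). Qed.

Lemma cont_mul (K : numFieldType) (T : topologicalType) (f g : T -> K) (x : T) :
  {for x, continuous f} -> {for x, continuous g} ->
  {for x, continuous (fun t => f t * g t)}.
Proof. by move=> cf cg; exact: (cvgM cf cg). Qed.

Section RealNorm.
Context {R : realType}.

Lemma cont_realP (T : topologicalType) (x : T) (f : T -> R) :
  {for x, continuous f} <->
  (forall e : R, 0 < e -> \forall t \near x, `|f t - f x| < e).
Proof.
split=> [/cvgrPdist_lt h e e0|h]; last apply/cvgrPdist_lt => e e0.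
  by apply: filterS (h e e0) => t; rewrite distrC.
by apply: filterS (h e e0) => t; rewrite distrC.
Qed.

Lemma cont_real (T : topologicalType) (x : T) (f : T -> R) :
  (forall e : R, 0 < e -> \forall t \near x, `|f t - f x| < e) ->
  {for x, continuous f}.
Proof. by move/cont_realP. Qed.

Local Notation C := R[i].

(* The norms of the library take values in [R[i]]; [nm] is the same norm with
   real values. *)
Definition nm (V : normedModType C) (v : V) : R := Re `|v|.

Section Basic.
Context {V : normedModType C}.
Implicit Types v w : V.

Lemma nmE v : `|v| = (nm v)%:C.
Proof. by rewrite /nm RRe_real// ger0_real. Qed.

Lemma nm_ge0 v : 0 <= nm v.
Proof. by have := normr_ge0 v; rewrite nmE lecR. Qed.

Lemma nm0 : nm (0 : V) = 0.
Proof. by rewrite /nm normr0. Qed.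

Lemma nm_eq0 v : nm v = 0 -> v = 0.
Proof. by move=> v0; apply/eqP; rewrite -normr_eq0 nmE v0. Qed.

Lemma nmN v : nm (- v) = nm v.
Proof. by rewrite /nm normrN. Qed.

Lemma nmBC v w : nm (v - w) = nm (w - v).
Proof. by rewrite -nmN opprB. Qed.

Lemma nmD v w : nm (v + w) <= nm v + nm w.
Proof. by have := ler_normD v w; rewrite !nmE -rmorphD lecR. Qed.

Lemma nm_triangle v w u : nm (v - u) <= nm (v - w) + nm (w - u).
Proof. by apply: le_trans (nmD _ _); rewrite addrA subrK. Qed.

Lemma nmZ (k : C) v : nm (k *: v) = nm k * nm v.
Proof.
by apply: (@complexI R); rewrite rmorphM -nmE normrZ !nmE.
Qed.

Lemma nm_sum (I : Type) (r : seq I) (P : pred I) (F : I -> V) :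
  nm (\sum_(i <- r | P i) F i) <= \sum_(i <- r | P i) nm (F i).
Proof.
apply: (big_ind2 (fun (x : V) y => nm x <= y)); first by rewrite nm0.
  by move=> x1 y1 x2 y2 h1 h2; exact: le_trans (nmD _ _) (lerD h1 h2).
by [].
Qed.

Lemma near_nm v (e : R) : 0 < e -> \forall w \near v, nm (w - v) < e.
Proof.
move=> e0; have e1 : 0 < e%:C by rewrite ltcR.
apply: filterS (nbhsx_ballx v _ e1) => w.
by rewrite -ball_normE /= distrC nmE ltcR.
Qed.

Lemma nbhs_nmP v (A : set V) : nbhs v A ->
  exists2 e : R, 0 < e & forall w, nm (w - v) < e -> A w.
Proof.
move=> /nbhs_ballP[e /= e0 h].
have [r re] : exists r, e = r%:C by exists (Re e); rewrite RRe_real// gtr0_real.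
move: e0 h; rewrite re ltcR => e0 h; exists r => // w wv; apply: h.
by rewrite -ball_normE /= distrC nmE ltcR.
Qed.

Lemma cvg_nmP (T : Type) (F : set_system T) (f : T -> V) v : Filter F ->
  (f @ F --> v) <-> (forall e : R, 0 < e -> \forall t \near F, nm (f t - v) < e).
Proof.
move=> FF; split=> [h e e0|h A /nbhs_nmP[e e0 eA]].
  exact: (h _ (near_nm v e0)).
by apply: filterS (h e e0) => t; exact: eA.
Qed.

Lemma cont_nmP (T : topologicalType) (x : T) (f : T -> V) :
  {for x, continuous f} <->
  (forall e : R, 0 < e -> \forall t \near x, nm (f t - f x) < e).
Proof. exact: (@cvg_nmP T (nbhs x)). Qed.

Lemma nm_continuous : continuous (@nm V).
Proof.
move=> v; apply: cont_real => e e0; apply: filterS (near_nm v e0) => w wv.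
have h1 := nm_triangle w v 0; have h2 := nm_triangle v w 0.
rewrite !subr0 in h1 h2; rewrite (nmBC v w) in h2.
by rewrite ltr_norml; apply/andP; split; lra.
Qed.

End Basic.

Implicit Types z w : C.

Lemma nmM z w : nm (z * w) = nm z * nm w.
Proof. exact: (@nmZ C z w). Qed.

Lemma nm1 : nm (1 : C) = 1.
Proof. by rewrite /nm normr1. Qed.

Lemma nmX z k : nm (z ^+ k) = nm z ^+ k.
Proof. by elim: k => [|k IH]; rewrite ?expr0 ?nm1// !exprS nmM IH. Qed.

Lemma nmV z : nm z^-1 = (nm z)^-1.
Proof.
have [->|z0] := eqVneq z 0; first by rewrite invr0 nm0 invr0.
have n0 : nm z != 0 by apply: contra z0 => /eqP/nm_eq0 ->.
by apply: (mulfI n0); rewrite -nmM !divff// nm1.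
Qed.

Lemma nm_real (r : R) : nm r%:C = `|r|.
Proof. by rewrite /nm normc_def/= expr0n/= addr0 sqrtr_sqr. Qed.

Lemma nm2E z : nm z ^+ 2 = Re z ^+ 2 + Im z ^+ 2.
Proof.
rewrite /nm normc_def sqr_sqrtr// addr_ge0 ?sqr_ge0//.
Qed.

Lemma le_nm1 z : (`|z| <= 1) = (nm z <= 1).
Proof. by rewrite nmE -(rmorph1 (real_complex R)) lecR. Qed.

Lemma lt_nm1 z : (`|z| < 1) = (nm z < 1).
Proof. by rewrite nmE -(rmorph1 (real_complex R)) ltcR. Qed.

Lemma eq_nm1 z : (`|z| = 1) <-> (nm z = 1).
Proof. by rewrite nmE; split => [/complexI|->]. Qed.

Lemma normRe_le_nm z : `|Re z| <= nm z.
Proof.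
by rewrite -(ger0_norm (nm_ge0 z)) -ler_sqr ?nnegrE// !real_normK ?num_real// nm2E lerDl sqr_ge0.
Qed.

Lemma normIm_le_nm z : `|Im z| <= nm z.
Proof.
by rewrite -(ger0_norm (nm_ge0 z)) -ler_sqr ?nnegrE// !real_normK ?num_real// nm2E lerDr sqr_ge0.
Qed.

Lemma nm_le_ReIm z : nm z <= `|Re z| + `|Im z|.
Proof.
rewrite -[leLHS](ger0_norm (nm_ge0 z)) -[leRHS]ger0_norm ?addr_ge0//.
rewrite -ler_sqr ?nnegrE// !real_normK ?num_real// nm2E sqrrD !real_normK ?num_real//.
by rewrite lerD2r lerDl mulrn_wge0// mulr_ge0.
Qed.

Lemma Re_continuous : continuous (@Re R : C -> R).
Proof.
move=> z; apply: cont_real => e e0; apply: filterS (near_nm z e0) => w.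
by apply: le_lt_trans; rewrite -raddfB normRe_le_nm.
Qed.

Lemma Im_continuous : continuous (@Im R : C -> R).
Proof.
move=> z; apply: cont_real => e e0; apply: filterS (near_nm z e0) => w.
by apply: le_lt_trans; rewrite -raddfB normIm_le_nm.
Qed.

Lemma Complex_continuous (T : topologicalType) (a b : T -> R) (x : T) :
  {for x, continuous a} -> {for x, continuous b} ->
  {for x, continuous (fun t => a t +i* b t : C)}.
Proof.
move=> ca cb; apply/cont_nmP => e e0.
have e2 : 0 < e / 2 by lra.
move/cont_realP : ca => /(_ _ e2) ha; move/cont_realP : cb => /(_ _ e2) hb.
near=> t; apply: le_lt_trans (nm_le_ReIm _) _.
have h1 : `|a t - a x| < e / 2 by near: t.
have h2 : `|b t - b x| < e / 2 by near: t.
by rewrite /=; lra.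
Unshelve. all: end_near. Qed.

Lemma complexC_continuous : continuous (fun r : R => r%:C : C).
Proof. by move=> r; apply: Complex_continuous => //; exact: cst_continuous. Qed.

Lemma expit_continuous : continuous (@expit R : R -> C).
Proof.
move=> r; apply: Complex_continuous; [exact: continuous_cos|exact: continuous_sin].
Qed.

Lemma nm_expit t : nm (expit t : C) = 1.
Proof.
have : nm (expit t : C) ^+ 2 = 1 by rewrite nm2E /= cos2Dsin2.
by move/eqP; rewrite sqrp_eq1 ?nm_ge0// => /eqP.
Qed.

Lemma expitD s t : expit (s + t) = expit s * expit t :> C.
Proof.
by rewrite /expit cosD sinD; apply/eqP; rewrite eq_complex /= eqxx/= addrC.
Qed.

Lemma expit0 : expit 0 = 1 :> C.
Proof. by rewrite /expit cos0 sin0. Qed.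

Lemma expitM t k : expit (t *+ k) = expit t ^+ k :> C.
Proof. by elim: k => [|k IH]; rewrite ?mulr0n ?expit0// mulrS exprS expitD IH. Qed.

Lemma expit2pi : expit (2 * pi) = 1 :> C.
Proof. by rewrite mulr_natl /expit cos2pi sin2pi. Qed.

Lemma expit_neq0 t : expit t != 0 :> C.
Proof. by apply/negP => /eqP e; have := nm_expit t; rewrite e nm0 => /eqP; rewrite eq_sym oner_eq0. Qed.

Lemma expit_surj z : nm z = 1 -> exists2 t : R, 0 <= t <= 2 * pi & z = expit t.
Proof.
case: z => a b zn; have ab : a ^+ 2 + b ^+ 2 = 1 by rewrite -[LHS](nm2E (a +i* b)) zn expr1n.
have a1 : -1 <= a <= 1 by apply/andP; split; nra.
have pi0 := pi_gt0 R.
have s2 : Num.sqrt (1 - a ^+ 2) = `|b|.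
  by rewrite (_ : 1 - a ^+ 2 = b ^+ 2) ?sqrtr_sqr//; lra.
have c0 := acos_ge0 a1; have c1 := acos_lepi a1.
have ca : cos (acos a) = a by rewrite acosK// in_itv.
have [b0|b0] := leP 0 b.
  exists (acos a); first by apply/andP; split; lra.
  by rewrite /expit ca sin_acos// s2 ger0_norm.
exists (2 * pi - acos a); first by apply/andP; split; lra.
rewrite /expit addrC mulr_natl cosD2pi sinD2pi cosN sinN ca sin_acos// s2.
by rewrite ltr0_norm// opprK.
Qed.

Lemma expit_eq1 t : 0 <= t < 2 * pi -> expit t = 1 :> C -> t = 0.
Proof.
move=> /andP[t0 t2] [c1 s0]; have pi0 := pi_gt0 R.
have [tp|tp] := leP t pi.
  apply: (@cos_inj R); rewrite ?in_itv/= ?t0 ?tp ?lexx ?(ltW pi0)//.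
  by rewrite cos0.
have : 2 * pi - t = 0.
  apply: (@cos_inj R); rewrite ?in_itv/= ?lexx ?(ltW pi0)//.
    by apply/andP; split; lra.
  by rewrite cos0 addrC mulr_natl cosD2pi cosN.
by move=> h; lra.
Qed.

End RealNorm.

(** * Goursat's lemma *)

Section Bisection.
Context {R : realType}.
Variables (a b smax : R) (I : R -> R -> R -> R).
Hypotheses (a0 : 0 < a) (b0 : 0 < b).
Hypothesis Iadd : forall s t l, 0 < l ->
  I s t l = I s t (l / 2) + I (s + l / 2 * a) t (l / 2) +
    I s (t + l / 2 * b) (l / 2) + I (s + l / 2 * a) (t + l / 2 * b) (l / 2).
Hypothesis Iloc : forall x y e, x <= smax -> 0 < e ->
  exists2 d, 0 < d & forall s t l, 0 < l < d -> s <= x <= s + l * a ->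
    t <= y <= t + l * b -> `|I s t l| <= e * l ^+ 2.

(** [I s t l] stands for the integral around the rectangle with corner [(s, t)] and sides [l a],
    [l b]. A quarter on which [|I|] is at least [c l'^2] is selected; if the first three fail,
    additivity forces the last. *)
Let step c (p : R * R * R) : R * R * R :=
  let: (s, t, l) := p in let l' := l / 2 in
  if c * l' ^+ 2 <= `|I s t l'| then (s, t, l') else
  if c * l' ^+ 2 <= `|I (s + l' * a) t l'| then (s + l' * a, t, l') else
  if c * l' ^+ 2 <= `|I s (t + l' * b) l'| then (s, t + l' * b, l') else
  (s + l' * a, t + l' * b, l').

Let stepP c s t l : 0 < l -> c * l ^+ 2 <= `|I s t l| ->
  exists s' t', [/\ step c (s, t, l) = (s', t', l / 2),
    c * (l / 2) ^+ 2 <= `|I s' t' (l / 2)|,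
    s <= s' /\ s' + l / 2 * a <= s + l * a &
    t <= t' /\ t' + l / 2 * b <= t + l * b].
Proof.
move=> l0 h; rewrite /step.
have la : 0 < l / 2 * a by rewrite mulr_gt0//; lra.
have lb : 0 < l / 2 * b by rewrite mulr_gt0//; lra.
have ea : l * a = l / 2 * a + l / 2 * a by field.
have eb : l * b = l / 2 * b + l / 2 * b by field.
case: ifPn => [h1|h1]; first by exists s, t; split => //; split; lra.
case: ifPn => [h2|h2]; first by exists (s + l / 2 * a), t; split => //; split; lra.
case: ifPn => [h3|h3]; first by exists s, (t + l / 2 * b); split => //; split; lra.
exists (s + l / 2 * a), (t + l / 2 * b); split; [by []| |by split; lra|by split; lra].
rewrite leNgt; apply/negP => h4; move: h; rewrite leNgt => /negP; apply.
move: h1 h2 h3; rewrite -!ltNge => h1 h2 h3.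
have e4 : c * l ^+ 2 = c * (l / 2) ^+ 2 *+ 4 by field.
rewrite e4 (Iadd s t l0).
apply: (le_lt_trans (ler_normD _ _)).
have n1 := ler_normD (I s t (l / 2)) (I (s + l / 2 * a) t (l / 2)).
have n2 := ler_normD (I s t (l / 2) + I (s + l / 2 * a) t (l / 2))
  (I s (t + l / 2 * b) (l / 2)).
lra.
Qed.

(** The ratio [c] of [|I|] to [l^2] never drops along the successive quarters. These shrink to a
    point of the half plane [x <= smax], where [Iloc] with [e = c / 2] contradicts the lower
    bound. *)
Lemma bisection_eq0 s0 t0 l0 : 0 < l0 -> s0 + l0 * a <= smax -> I s0 t0 l0 = 0.
Proof.
move=> l00 sm; apply: contrapT => /eqP I0.
pose c := `|I s0 t0 l0| / l0 ^+ 2.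
have c0 : 0 < c by rewrite divr_gt0 ?normr_gt0// exprn_gt0.
pose u n := iter n (step c) (s0, t0, l0).
pose x n := (u n).1.1; pose y n := (u n).1.2; pose l n : R := l0 / 2 ^+ n.
have l_gt0 n : 0 < l n by rewrite divr_gt0// exprn_gt0.
have lS n : l n.+1 = l n / 2 by rewrite /l exprS; field; apply: expf_neq0; lra.
have uE n : u n = (x n, y n, l n) /\ c * l n ^+ 2 <= `|I (x n) (y n) (l n)|.
  elim: n => [|n [IH1 IH2]].
    rewrite /x /y /l /= expr0 divr1; split => //.
    by rewrite /c divfK// expf_neq0// gt_eqF.
  have [s' [t' [e1 e2 _ _]]] := stepP (l_gt0 n) IH2.
  by rewrite /x /y /= -/(u n) IH1 e1 lS.
have xy n : (x n <= x n.+1 /\ x n.+1 + l n.+1 * a <= x n + l n * a) /\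
   (y n <= y n.+1 /\ y n.+1 + l n.+1 * b <= y n + l n * b).
  have [h1 h2] := uE n.
  have [s' [t' [e1 e2 e3 e4]]] := stepP (l_gt0 n) h2.
  by rewrite /x /y lS /= -/(u n) h1 e1.
have limit (z : nat -> R) (k : R) : 0 < k ->
    (forall n, z n <= z n.+1 /\ z n.+1 + l n.+1 * k <= z n + l n * k) ->
    exists Z, forall n, z n <= Z <= z n + l n * k.
  move=> k0 hz.
  have lk n : 0 < l n * k by rewrite mulr_gt0.
  have m1 n m : z n <= z (n + m)%N.
    by elim: m => [|m IH]; rewrite ?addn0// addnS (le_trans IH)//; case: (hz (n + m)%N).
  have m2 n m : z (n + m)%N + l (n + m)%N * k <= z n + l n * k.
    by elim: m => [|m IH]; rewrite ?addn0// addnS (le_trans _ IH)//; case: (hz (n + m)%N).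
  have m3 n m : z m <= z n + l n * k.
    have [nm|mn] := leP n m.
      by have := m2 n (m - n)%N; rewrite subnKC//; have := lk m; lra.
    by have := m1 m (n - m)%N; rewrite subnKC ?(ltnW mn)//; have := lk n; lra.
  exists (sup (range z)) => n; apply/andP; split.
    apply: ub_le_sup; last by exists n.
    by exists (z 0%N + l 0%N * k) => _ [m _ <-].
  by apply: ge_sup; [exists (z 0%N), 0%N|move=> _ [m _ <-]].
have [X hX] := limit x a a0 (fun n => (xy n).1).
have [Y hY] := limit y b b0 (fun n => (xy n).2).
have Xm : X <= smax.
  have := hX 0%N; rewrite /x /l /= expr0 divr1 => /andP[_ h]; exact: le_trans sm.
have c2 : 0 < c / 2 by lra.
have [d d0 hd] := Iloc Y Xm c2.
have [n nd] : exists n, l n < d.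
  have [n hn] : exists n : nat, l0 / d < n%:R.
    by exists (Num.truncn (l0 / d)).+1; exact: truncnS_gt.
  exists n; rewrite /l ltr_pdivrMr ?exprn_gt0//.
  move: hn; rewrite ltr_pdivrMr// => hn; apply: (lt_trans hn).
  rewrite mulrC ltr_pM2l// -natrX ltr_nat; exact: ltn_expl.
have := hd (x n) (y n) (l n); rewrite l_gt0 nd => /(_ erefl (hX n) (hY n)).
have [_ h] := uE n; move=> h'.
have l2 : 0 < l n ^+ 2 by rewrite exprn_gt0.
have := le_trans h h'; nra.
Qed.

End Bisection.

Section RealIntegral.
Context {R : realType}.
Implicit Types (f g : R -> R) (a b c k e : R).
Local Notation mu := (@lebesgue_measure R).

Definition itg a b f : R := Rintegral mu `[a, b] f.

Lemma itv_integrable a b f : continuous f -> mu.-integrable `[a, b] (EFin \o f).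
Proof.
move=> cf; apply: continuous_compact_integrable; first exact: segment_compact.
exact: continuous_subspaceT.
Qed.

Lemma itg_cst a b k : a <= b -> itg a b (fun=> k) = k * (b - a).
Proof.
move=> ab; rewrite /itg Rintegral_cst//= lebesgue_measure_itv/= lte_fin.
by move: ab; rewrite le_eqVlt => /predU1P[->|->]; rewrite ?ltxx ?subrr ?mulr0.
Qed.

Lemma itgB a b f g : continuous f -> continuous g ->
  itg a b (fun x => f x - g x) = itg a b f - itg a b g.
Proof. by move=> cf cg; rewrite /itg RintegralB//; exact: itv_integrable. Qed.

Lemma itg_split a b c f : continuous f -> a <= b -> b <= c ->
  itg a c f = itg a b f + itg b c f.
Proof.
move=> cf ab bc; rewrite /itg.
have h := @Rintegral_itvB R f (BLeft a) (BRight c) b (itv_integrable a c cf).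
rewrite !bnd_simp in h; have {h} := h ab bc.
rewrite Rintegral_itv_obnd_cbnd; first by move=> <-; rewrite addrC subrK.
apply: integrableS (itv_integrable b c cf) => //.
by apply: subset_itvr; rewrite bnd_simp.
Qed.

Lemma le_itg a b f g : continuous f -> continuous g ->
  (forall x, a <= x <= b -> f x <= g x) -> itg a b f <= itg a b g.
Proof.
move=> cf cg h; by apply: le_Rintegral => //; exact: itv_integrable.
Qed.

Lemma itg_bound a b f k e : a <= b -> continuous f ->
  (forall x, a <= x <= b -> `|f x - k| <= e) ->
  `|itg a b f - k * (b - a)| <= e * (b - a).
Proof.
move=> ab cf h.
have cc r : continuous (fun _ : R => r : R) by exact: cst_continuous.
have h1 : itg a b f <= (k + e) * (b - a).
  rewrite -itg_cst//; apply: le_itg => // x /h.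
  by rewrite ler_norml => /andP[_ ?]; lra.
have h2 : (k - e) * (b - a) <= itg a b f.
  rewrite -itg_cst//; apply: le_itg => // x /h.
  by rewrite ler_norml => /andP[? _]; lra.
by rewrite ler_norml; apply/andP; split; lra.
Qed.

End RealIntegral.

Section Closed.
Context {R : realType}.
Variables (P Q : R -> R -> R) (smax : R).
Hypothesis cP : continuous (fun p : R * R => P p.1 p.2).
Hypothesis cQ : continuous (fun p : R * R => Q p.1 p.2).
Hypothesis dPQ : forall x y, x <= smax -> exists p q r : R, forall e, 0 < e ->
  exists2 d, 0 < d & forall x' y', `|x' - x| < d -> `|y' - y| < d ->
   `|P x' y' - P x y - p * (x' - x) - q * (y' - y)| <= e * (`|x' - x| + `|y' - y|) /\
   `|Q x' y' - Q x y - q * (x' - x) - r * (y' - y)| <= e * (`|x' - x| + `|y' - y|).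

Let slice1 (F : R -> R -> R) y : continuous (fun p : R * R => F p.1 p.2) ->
  continuous (F^~ y).
Proof.
move=> cF x; apply: (@continuous_comp _ _ _ (fun x => (x, y)) (fun p : R * R => F p.1 p.2)).
  by apply: cont_pair; [exact: cont_id|exact: cont_cst].
exact: cF.
Qed.

Let slice2 (F : R -> R -> R) x : continuous (fun p : R * R => F p.1 p.2) ->
  continuous (F x).
Proof.
move=> cF y; apply: (@continuous_comp _ _ _ (fun y => (x, y)) (fun p : R * R => F p.1 p.2)).
  by apply: cont_pair; [exact: cont_cst|exact: cont_id].
exact: cF.
Qed.

(* The integral of the closed form [P ds + Q dt] along the boundary of a
   rectangle; closedness is only required pointwise, as in Goursat's lemma. *)
Lemma rectangle_itg s1 s2 t1 t2 : s1 < s2 -> t1 < t2 -> s2 <= smax ->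
  itg s1 s2 (P^~ t1) - itg s1 s2 (P^~ t2) + (itg t1 t2 (Q s2) - itg t1 t2 (Q s1)) = 0.
Proof.
move=> s12 t12 sm.
pose a := s2 - s1; pose b := t2 - t1.
pose I s t l := itg s (s + l * a) (P^~ t) - itg s (s + l * a) (P^~ (t + l * b)) +
  (itg t (t + l * b) (Q (s + l * a)) - itg t (t + l * b) (Q s)).
have a0 : 0 < a by rewrite /a; lra.
have b0 : 0 < b by rewrite /b; lra.
suff : I s1 t1 1 = 0 by rewrite /I !mul1r /a /b (addrC s1) subrK (addrC t1) subrK.
apply: (@bisection_eq0 R a b smax); rewrite ?ltr01//; last by rewrite mul1r /a; lra.
- move=> s t l l0; rewrite /I.
  have la : 0 < l / 2 * a by rewrite mulr_gt0//; lra.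
  have lb : 0 < l / 2 * b by rewrite mulr_gt0//; lra.
  have -> : s + l * a = s + l / 2 * a + l / 2 * a by field.
  have -> : t + l * b = t + l / 2 * b + l / 2 * b by field.
  rewrite !(@itg_split _ s (s + l / 2 * a) (s + l / 2 * a + l / 2 * a)); first last.
    1-6: by (exact: slice1) || lra.
  rewrite !(@itg_split _ t (t + l / 2 * b) (t + l / 2 * b + l / 2 * b)); first last.
    1-6: by (exact: slice2) || lra.
  ring.
- move=> x y e xm e0.
  have ab0 : 0 < a + b by lra.
  (* Each pair of opposite sides leaves an error of at most [2 e' l (a + b)] times its length, so
     [2 e' l^2 (a + b)^2] in all, which is within [e l^2]. *)
  pose e' := e / (4 * (a + b) ^+ 2).
  have e'0 : 0 < e' by rewrite divr_gt0// mulr_gt0 ?exprn_gt0.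
  have [p [q [r /(_ _ e'0)[d d0 hd]]]] := dPQ y xm.
  exists (d / (a + b)); first by rewrite divr_gt0.
  move=> s t l /andP[l0 ld] /andP[sx xs] /andP[ty yt].
  have {}ld : l * (a + b) < d by rewrite -ltr_pdivlMr.
  have la : 0 < l * a by rewrite mulr_gt0.
  have lb : 0 < l * b by rewrite mulr_gt0.
  have nx x' : s <= x' <= s + l * a -> `|x' - x| <= l * a.
    by move=> /andP[? ?]; rewrite ler_norml; apply/andP; split; lra.
  have ny y' : t <= y' <= t + l * b -> `|y' - y| <= l * b.
    by move=> /andP[? ?]; rewrite ler_norml; apply/andP; split; lra.
  have E x' y' : s <= x' <= s + l * a -> t <= y' <= t + l * b ->
     `|P x' y' - P x y - p * (x' - x) - q * (y' - y)| <= e' * (l * (a + b)) /\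
     `|Q x' y' - Q x y - q * (x' - x) - r * (y' - y)| <= e' * (l * (a + b)).
    move=> /nx hx /ny hy.
    have [||h1 h2] := hd x' y'; [lra|lra|].
    have k : e' * (`|x' - x| + `|y' - y|) <= e' * (l * (a + b)).
      by rewrite ler_pM2l//; lra.
    by split; [exact: le_trans h1 k|exact: le_trans h2 k].
  have ts : t <= t <= t + l * b by lra.
  have te : t <= t + l * b <= t + l * b by lra.
  have ss : s <= s <= s + l * a by lra.
  have se : s <= s + l * a <= s + l * a by lra.
  (* The linear terms contribute [- q (l b) (l a)] here and [q (l a) (l b)] in [B2]. They cancel
     because the same [q] is the second coefficient of [P] and the first one of [Q]; this is where
     closedness enters. *)
  have B1 : `|itg s (s + l * a) (fun x => P x t - P x (t + l * b)) - (- q * (l * b)) * (s + l * a - s)| <=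
      2 * e' * (l * (a + b)) * (s + l * a - s).
    apply: itg_bound; first lra.
      by move=> z; apply: cvgB; [exact: (@slice1 P t cP z)|exact: (@slice1 P _ cP z)].
    move=> x' hx'; have [h1 _] := E x' t hx' ts; have [h2 _] := E x' _ hx' te.
    move: h1 h2; rewrite !ler_norml => /andP[? ?] /andP[? ?]; apply/andP; split; lra.
  have B2 : `|itg t (t + l * b) (fun y => Q (s + l * a) y - Q s y) - (q * (l * a)) * (t + l * b - t)| <=
      2 * e' * (l * (a + b)) * (t + l * b - t).
    apply: itg_bound; first lra.
      by move=> z; apply: cvgB; [exact: (@slice2 Q _ cQ z)|exact: (@slice2 Q _ cQ z)].
    move=> y' hy'; have [_ h1] := E s y' ss hy'; have [_ h2] := E _ y' se hy'.
    move: h1 h2; rewrite !ler_norml => /andP[? ?] /andP[? ?]; apply/andP; split; lra.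
  rewrite /I -!itgB; [|exact: slice2|exact: slice2|exact: slice1|exact: slice1].
  have -> : e * l ^+ 2 = 2 * (2 * e' * (l * (a + b)) * (l * (a + b))).
    by rewrite /e'; field; lra.
  have pos : 0 < 2 * e' * (l * (a + b)) by apply: mulr_gt0; [apply: mulr_gt0|exact: mulr_gt0].
  move: B1 B2; rewrite !ler_norml => /andP[? ?] /andP[? ?]; apply/andP; split; nra.
Qed.

End Closed.

(** * The mean value property *)

Section FirstOrder.
Context {R : realType}.
Local Notation C := R[i].

Lemma real_derive_eps (f : R -> R) (x df : R) : is_derive x (1 : R) f df ->
  forall e : R, 0 < e -> exists2 d : R, 0 < d &
    forall h : R, `|h| < d -> `|f (x + h) - f x - df * h| <= e * `|h|.
Proof.
move=> [dfx <-] e e0; move/cvgrPdist_lt : dfx => /(_ e e0).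
move=> /nbhs_ballP[d /= d0 hd]; exists d => // h hh.
have [->|h0] := eqVneq h 0; first by rewrite addr0 subrr mulr0 subr0 normr0 mulr0.
have := hd h; rewrite -ball_normE /= sub0r normrN => /(_ hh h0).
have hn : 0 < `|h| by rewrite normr_gt0.
rewrite -(ltr_pM2r hn) -normrM => /ltW; rewrite -normrN; congr (`|_| <= _).
by rewrite [h *: _]mulr1 (addrC h x) [_ *: _]mulrC /derive; set D := lim _; field.
Qed.

Lemma derivable_eps (V : normedModType C) (f : C -> V) (z : C) : derivable f z 1 ->
  exists L, forall e : R, 0 < e -> exists2 d : R, 0 < d &
    forall w, nm (w - z) < d -> nm (f w - f z - (w - z) *: L) <= e * nm (w - z).
Proof.
move=> dfx; exists ('D_1 f z) => e e0; have := near_nm ('D_1 f z) e0 => /dfx.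
rewrite !near_simpl => /nbhs_nmP[d d0 hd]; exists d => // w wz.
have [->|w0] := eqVneq w z; first by rewrite !subrr scale0r subrr !nm0 mulr0.
have h0 : w - z != 0 by rewrite subr_eq0.
have := hd (w - z); rewrite subr0 => /(_ wz h0).
have hn : 0 < nm (w - z).
  by rewrite lt_neqAle nm_ge0 andbT eq_sym; apply: contra h0 => /eqP/nm_eq0 ->.
rewrite -(ltr_pM2r hn) mulrC -nmZ => /ltW /=; congr (nm _ <= _).
rewrite (_ : (w - z) *: (1 : C) + z = w); last by rewrite [_ *: _]mulr1 subrK.
by rewrite scalerBr scalerA divff// scale1r.
Qed.

(** First-order expansion at 0 of the complex exponential in the form [e^u (cos v + i sin v)],
    assembled from the derivatives of the three real functions. *)
Lemma expit_expR_eps (e : R) : 0 < e -> exists2 d : R, 0 < d &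
  forall u v, `|u| < d -> `|v| < d ->
    nm ((expR u)%:C * expit v - 1 - (u +i* v) : C) <= e * (`|u| + `|v|).
Proof.
move=> e0; pose k := Num.min (e / 8) (1 / 2).
have k0 : 0 < k by rewrite /k lt_min; apply/andP; split; lra.
have [k1 k2] : k <= e / 8 /\ k <= 1 / 2 by split; rewrite /k ge_min lexx ?orbT.
clearbody k.
have [d1 d10 h1] := real_derive_eps (@is_derive_expR R 0) k0.
have [d2 d20 h2] := real_derive_eps (@is_derive_cos R 0) k0.
have [d3 d30 h3] := real_derive_eps (@is_derive_sin R 0) k0.
exists (Num.min (Num.min d1 k) (Num.min d2 d3)).
  by rewrite !lt_min d10 d20 d30 k0.
move=> u v; rewrite !lt_min => /andP[/andP[u1 uk] _] /andP[_ /andP[v2 v3]].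
have := h1 u u1; have := h2 v v2; have := h3 v v3.
rewrite !add0r expR0 cos0 sin0 oppr0 mul0r !subr0 addr0 !mul1r.
move=> hs hc he; apply: le_trans (nm_le_ReIm _) _; rewrite /=.
have -> : expR u * cos v - 0 * sin v - 1 - u =
   (expR u - 1 - u) * cos v + (1 + u) * (cos v - 1) by ring.
have -> : expR u * sin v + 0 * cos v - 0 - v =
   (expR u - 1 - u) * sin v + (1 + u) * (sin v - v) + u * v by ring.
have c1 := cos_max v; have s1 := sin_max v.
have n1 : `|(expR u - 1 - u) * cos v| <= k * `|u|.
  by rewrite normrM -[leRHS]mulr1 ler_pM.
have n2 : `|(expR u - 1 - u) * sin v| <= k * `|u|.
  by rewrite normrM -[leRHS]mulr1 ler_pM.
have u2 : `|1 + u| <= 2.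
  by apply: le_trans (ler_normD _ _) _; rewrite normr1; lra.
have n3 : `|(1 + u) * (cos v - 1)| <= 2 * (k * `|v|) by rewrite normrM ler_pM.
have n4 : `|(1 + u) * (sin v - v)| <= 2 * (k * `|v|) by rewrite normrM ler_pM.
have n5 : `|u * v| <= k * `|v| by rewrite normrM ler_wpM2r// ltW.
have U0 := normr_ge0 u; have V0 := normr_ge0 v.
have kU : k * `|u| <= e / 8 * `|u| by rewrite ler_wpM2r.
have kV : k * `|v| <= e / 8 * `|v| by rewrite ler_wpM2r.
have m1 := ler_normD ((expR u - 1 - u) * cos v) ((1 + u) * (cos v - 1)).
have m2 := ler_normD ((expR u - 1 - u) * sin v + (1 + u) * (sin v - v)) (u * v).
have m3 := ler_normD ((expR u - 1 - u) * sin v) ((1 + u) * (sin v - v)).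
set A := `|u| in U0 kU n1 n2 *; set B := `|v| in V0 kV n3 n4 n5 *.
have eA : 0 <= e * A by rewrite mulr_ge0// ltW.
have eB : 0 <= e * B by rewrite mulr_ge0// ltW.
lra.
Qed.

End FirstOrder.

Section MeanValue.
Context {R : realType}.
Local Notation C := R[i].

Definition real_mean (F : C -> R) : R :=
  (2 * pi)^-1 * itg 0 (2 * pi) (fun t => F (expit t)).

Lemma circle_mean_real (F : C -> R) : continuous (fun t => F (expit t)) ->
  circle_mean (fun z => (F z)%:E) = (real_mean F)%:E.
Proof.
move=> cF; rewrite /circle_mean /real_mean EFinM; congr (_ * _)%E.
rewrite /itg /Rintegral fineK//.
have := integrable_fin_num _ (itv_integrable 0 (2 * pi) cF).
by apply; exact: measurable_itv.
Qed.

(** In the coordinates [zeta = a + r e^(s + i t)] the form [f d zeta / (zeta - a)] is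
    [f (ds + i dt)], with imaginary part [Im f ds + Re f dt], closed for [s <= 0]. On the rectangle
    of width [-s] and height [2 pi] the sides [t = 0] and [t = 2 pi] cancel by periodicity, so the
    integral of [Re f] is the same on all the circles of radius [r e^s]. Letting [s] go to minus
    infinity gives the value at [a]. *)
Lemma holomorphic_mean (f : C -> C) (a : C) (r r' : R) : 0 < r -> r < r' ->
  continuous f -> (forall z, nm (z - a) < r' -> derivable f z 1) ->
  real_mean (fun z => Re (f (a + r%:C * z))) = Re (f a).
Proof.
move=> r0 rr' cf df.
pose E (s t : R) : C := (r * expR s)%:C * expit t.
have nmE s t : nm (E s t) = r * expR s.
  by rewrite nmM nm_expit mulr1 nm_real ger0_norm// mulr_ge0 ?expR_ge0// ltW.
have cE : continuous (fun p : R * R => E p.1 p.2).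
  move=> p; apply: (@cvgM C).
    apply: (@cont_comp _ _ _ (fun p : R * R => r * expR p.1) (fun r : R => r%:C : C)).
      apply: cvgM; first exact: cvg_cst.
      apply: (@cont_comp _ _ _ (fst : R * R -> R) (@expR R)); first exact: cvg_fst.
      exact: continuous_expR.
    exact: complexC_continuous.
  apply: (@cont_comp _ _ _ (snd : R * R -> R) (@expit R)); first exact: cvg_snd.
  exact: expit_continuous.
pose g (s t : R) : C := f (a + E s t).
have cg : continuous (fun p : R * R => g p.1 p.2).
  move=> p; apply: (@cont_comp _ _ _ (fun p : R * R => a + E p.1 p.2) f).
    by apply: cvgD; [exact: cvg_cst|exact: cE].
  exact: cf.
have gE s t s' t' : E s' t' - E s t = E s t * ((expR (s' - s))%:C * expit (t' - t) - 1).
  rewrite mulrBr mulr1; congr (_ - _).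
  have e1 : expR s' = expR (s' - s) * expR s by rewrite -expRD subrK.
  have e2 : expit t' = expit (t' - t) * expit t :> C by rewrite -expitD subrK.
  rewrite /E e1 e2 !rmorphM /=; ring.
pose P s t := Im (g s t); pose Q s t := Re (g s t).
have cP : continuous (fun p : R * R => P p.1 p.2).
  move=> p; apply: (@cont_comp _ _ _ (fun p : R * R => g p.1 p.2) (@Im R)).
    exact: cg.
  exact: Im_continuous.
have cQ : continuous (fun p : R * R => Q p.1 p.2).
  move=> p; apply: (@cont_comp _ _ _ (fun p : R * R => g p.1 p.2) (@Re R)).
    exact: cg.
  exact: Re_continuous.
have imE (B : C) (u v : R) : Im (B * (u +i* v)) = Im B * u + Re B * v.
  by case: B => p q /=; ring.
have reE (B : C) (u v : R) : Re (B * (u +i* v)) = Re B * u + - Im B * v.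
  by case: B => p q /=; ring.
have dPQ x y : x <= 0 -> exists p q r : R, forall e, 0 < e ->
  exists2 d, 0 < d & forall x' y', `|x' - x| < d -> `|y' - y| < d ->
   `|P x' y' - P x y - p * (x' - x) - q * (y' - y)| <= e * (`|x' - x| + `|y' - y|) /\
   `|Q x' y' - Q x y - q * (x' - x) - r * (y' - y)| <= e * (`|x' - x| + `|y' - y|).
  move=> x0.
  have ex : expR x <= 1 by rewrite -expR0 ler_expR.
  have En : nm (E x y) <= r by rewrite nmE -[leRHS]mulr1 ler_pM2l.
  have [|L hL] := derivable_eps (df (a + E x y) _).
    by rewrite addrC addKr; exact: le_lt_trans rr'.
  (* [A] is the derivative with respect to [s + i t]. The Cauchy-Riemann equations read
     [d Im g = Im A ds + Re A dt] and [d Re g = Re A ds - Im A dt], so the coefficient [Re A] is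
     shared. *)
  pose A := E x y * L; exists (Im A), (Re A), (- Im A) => e e0.
  pose k := e / (2 * (r + nm A + 1)).
  have D0 : 0 < r + nm A + 1 by have := nm_ge0 A; lra.
  have k0 : 0 < k by rewrite divr_gt0// mulr_gt0.
  have k'0 : 0 < Num.min k 1 by rewrite lt_min k0 ltr01.
  have [d1 d10 h1] := expit_expR_eps k'0.
  pose k2 := e / (4 * r).
  have k20 : 0 < k2 by rewrite divr_gt0// mulr_gt0.
  have [d2 d20 h2] := hL _ k20.
  exists (Num.min d1 (d2 / (4 * r))); first by rewrite lt_min d10 divr_gt0// mulr_gt0.
  move=> x' y'; rewrite !lt_min => /andP[x1 x2] /andP[y1 y2].
  have {h1} := h1 _ _ x1 y1.
  set u := x' - x; set v := y' - y; set T := _ * _ - 1 - _ => hT.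
  have u0 := normr_ge0 u; have v0 := normr_ge0 v.
  have T1 : nm T <= `|u| + `|v|.
    apply: le_trans hT _; rewrite -[leRHS]mul1r ler_wpM2r ?addr_ge0//.
    by rewrite ge_min lexx orbT.
  have T2 : nm T <= k * (`|u| + `|v|).
    by apply: le_trans hT _; rewrite ler_wpM2r ?addr_ge0// ge_min lexx.
  have EE : a + E x' y' - (a + E x y) = E x y * (T + (u +i* v)).
    by rewrite opprD addrACA subrr add0r gE /T subrK.
  have uv : nm (u +i* v : C) <= `|u| + `|v| by exact: nm_le_ReIm.
  have nE : nm (a + E x' y' - (a + E x y)) <= 2 * r * (`|u| + `|v|).
    rewrite EE nmM; have := nmD T (u +i* v) => hD.
    have hS : nm (T + (u +i* v)) <= 2 * (`|u| + `|v|) by lra.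
    have := ler_pM (nm_ge0 _) (nm_ge0 _) En hS; lra.
  have nE2 : nm (a + E x' y' - (a + E x y)) < d2.
    apply: le_lt_trans nE _.
    have : `|u| + `|v| < d2 / (2 * r).
      have -> : d2 / (2 * r) = d2 / (4 * r) + d2 / (4 * r) by field; lra.
      by apply: ltrD.
    by rewrite ltr_pdivlMr ?mulr_gt0// mulrC.
  have {h2} := h2 _ nE2; rewrite -/(g x' y') -/(g x y) EE.
  set Z := g x' y' - g x y - _ => hZ.
  have key : nm (g x' y' - g x y - A * (u +i* v)) <= e * (`|u| + `|v|).
    have -> : g x' y' - g x y - A * (u +i* v) = Z + A * T.
      by rewrite /Z /A /GRing.scale /=; ring.
    have z1 : nm Z <= e / 2 * (`|u| + `|v|).
      apply: le_trans hZ _; rewrite -EE.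
      have : k2 * nm (a + E x' y' - (a + E x y)) <= k2 * (2 * r * (`|u| + `|v|)).
        by rewrite ler_pM2l.
      move/le_trans; apply; rewrite /k2 (_ : _ * _ = e / 2 * (`|u| + `|v|))//.
      by field; lra.
    have z2 : nm (A * T) <= e / 2 * (`|u| + `|v|).
      rewrite nmM.
      have a1 : nm A <= r + nm A + 1 by lra.
      have := ler_pM (nm_ge0 _) (nm_ge0 _) a1 T2 => /le_trans; apply.
      have -> : (r + nm A + 1) * (k * (`|u| + `|v|)) = e / 2 * (`|u| + `|v|).
        by rewrite /k; field; lra.
      exact: lexx.
    have := nmD Z (A * T); lra.
  split.
    have := normIm_le_nm (g x' y' - g x y - A * (u +i* v)).
    by rewrite !raddfB/= imE opprD addrA => /le_trans; apply.
  have := normRe_le_nm (g x' y' - g x y - A * (u +i* v)).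
  by rewrite !raddfB/= reE opprD addrA => /le_trans; apply.
have pi0 := pi_gt0 R; have pi2 : 0 < 2 * pi :> R by lra.
have const s : s < 0 -> itg 0 (2 * pi) (Q 0) = itg 0 (2 * pi) (Q s).
  move=> s0; have := rectangle_itg cP cQ dPQ s0 pi2 (lexx 0).
  have -> : P^~ (2 * pi) = P^~ 0.
    by apply/funext => x; rewrite /P /g /E expit2pi expit0.
  by rewrite subrr add0r => /subr0_eq.
have -> : real_mean (fun z => Re (f (a + r%:C * z))) = (2 * pi)^-1 * itg 0 (2 * pi) (Q 0).
  by rewrite /real_mean /Q /g /E expR0 mulr1.
apply: (mulfI (lt0r_neq0 pi2)); rewrite mulrA divff ?lt0r_neq0// mul1r.
apply/eqP; rewrite -subr_eq0 -normr_le0; apply/ler_addgt0Pl => e e0; rewrite addr0.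
have e1 : 0 < e / (2 * pi) by rewrite divr_gt0.
have /cont_nmP/(_ _ e1) /nbhs_nmP[d d0 hd] := cf a.
(* Then [r e^s <= d / 2], so the small circle lies in the ball where [f] is close to [f a]; the cap
   at [-1] ensures [s < 0]. *)
pose s := Num.min (-1) (ln (d / (2 * r))).
have s0 : s < 0 by rewrite /s gt_min ltrN10.
rewrite (const s s0) (_ : 2 * pi * Re (f a) = Re (f a) * (2 * pi - 0)); last by ring.
have -> : e = e / (2 * pi) * (2 * pi - 0) by field; lra.
apply: itg_bound; first exact: ltW.
  move=> t; apply: (@cont_comp _ _ _ (fun t => (s, t)) (fun p : R * R => Q p.1 p.2)).
    by apply: cont_pair; [exact: cont_cst|exact: cont_id].
  exact: cQ.
move=> t _; apply: le_trans (ltW (hd (a + E s t) _)).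
  by rewrite /Q -raddfB normRe_le_nm.
rewrite addrC addKr nmE.
have : expR s <= d / (2 * r).
  have dr : 0 < d / (2 * r) by rewrite divr_gt0// mulr_gt0.
  by rewrite -[leRHS](lnK dr) ler_expR /s ge_min lexx orbT.
by rewrite ler_pdivlMr ?mulr_gt0//; lra.
Qed.

End MeanValue.

(** * Compactness and kernels on the circle *)

Section Compactness.
Context {R : realType}.
Local Notation C := R[i].

(** A property that holds near each point of the graph of [a] over a compact set holds on a tube of
    uniform radius: near-covering is applied with the filter of small positive radii. With [a] a
    disc or a homotopy and [P] an open condition, this is how discs are perturbed without leaving
    [X] or [W]. *)
Lemma tube (Y : topologicalType) (V : normedModType C) (K : set Y) (a : Y -> V)
    (P : Y -> V -> Prop) : compact K ->
  (forall y, K y -> {for y, continuous a}) ->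
  (forall y, K y -> \forall y' \near y & x \near a y, P y' x) ->
  exists2 eta : R, 0 < eta & forall y x, K y -> nm (x - a y) < eta -> P y x.
Proof.
move=> cK ca hP; move/compact_near_coveringP : cK => cK.
have := cK R (0 : R)^'+ (fun eta y => forall x, nm (x - a y) < eta -> P y x) _ _.
case.
  move=> y Ky; have [[U A] [/= Uy /nbhs_nmP[e e0 eA]] UA] := hP y Ky.
  have e2 : 0 < e / 2 by lra.
  have /cont_nmP/(_ _ e2) ay := ca y Ky.
  exists ([set y' | U y' /\ nm (a y' - a y) < e / 2], [set t : R | t < e / 2]) => /=.
    split; first exact: filterI Uy ay.
    exact: nbhs_right_lt.
  move=> [y' t] [/= [Uy' ay'] te] x xa; apply: (UA (y', x)); split => //=.
  by apply: eA; have := nm_triangle x (a y') (a y); lra.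
move=> t /= t0 ht.
have t20 : 0 < t / 2 by lra.
exists (t / 2) => // y x Ky; apply: (ht (t / 2)) => //.
by rewrite /= sub0r normrN gtr0_norm//; lra.
Qed.

Lemma closed_nm_le (V : normedModType C) (r : R) : closed [set v : V | nm v <= r].
Proof.
apply: (@closed_comp _ _ (@nm R V) [set x | x <= r]).
  by move=> v _; exact: nm_continuous.
exact: closed_le.
Qed.

Lemma compact_nm_le (r : R) : compact [set z : C | nm z <= r].
Proof.
have cq : compact ((fun p : R * R => p.1 +i* p.2 : C) @` (`[- r, r] `*` `[- r, r])).
  apply: continuous_compact; last by apply: compact_setX; exact: segment_compact.
  apply: continuous_subspaceT => p.
  by apply: Complex_continuous; [exact: cvg_fst|exact: cvg_snd].
have cl : closed [set z : C | nm z <= r] by exact: closed_nm_le.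
apply: (subclosed_compact cl cq) => -[x y] /= h.
exists (x, y) => //; split; rewrite /= in_itv/= -ler_norml.
  exact: le_trans (normRe_le_nm (x +i* y)) h.
exact: le_trans (normIm_le_nm (x +i* y)) h.
Qed.

Lemma compact_circle : compact [set z : C | nm z = 1].
Proof.
apply: (subclosed_compact _ (@compact_nm_le 1)); last by move=> z /= ->.
apply: (@closed_comp _ _ (@nm R C) [set x | x = 1]).
  by move=> v _; exact: nm_continuous.
exact: closed_eq.
Qed.

Lemma nm_entry n (v : 'rV[C]_n) i : nm (v 0 i) <= nm v.
Proof.
rewrite -lecR -!nmE [leRHS]/Num.Def.normr /= mx_normE.
have h : `|v 0 i|%:nng <= \big[Num.max/0%:nng]_(ij : 'I_1 * 'I_n) `|v ij.1 ij.2|%:nng.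
  by apply/bigmax_geP; right; exists (0, i).
by move: h; rewrite -num_le.
Qed.

Lemma nm_entry_attained n (v : 'rV[C]_n) : nm v != 0 -> exists i, nm v = nm (v 0 i).
Proof.
move=> v0; have h : mx_norm v != 0.
  apply: contra v0 => /eqP h; rewrite /nm (_ : `|v| = mx_norm v)//.
  by rewrite h.
have [[i j] /= ij] := mx_norm_neq0 h; exists j.
by rewrite /nm (_ : `|v| = mx_norm v)// ij ord1.
Qed.

Lemma compact_nm_le_row n (r : R) : compact [set v : 'rV[C]_n | nm v <= r].
Proof.
have cq := @rV_compact C n (fun=> [set z : C | nm z <= r]) (fun=> @compact_nm_le r).
have cl : closed [set v : 'rV[C]_n | nm v <= r] by exact: closed_nm_le.
by apply: (subclosed_compact cl cq) => v /= h i; exact: le_trans (nm_entry v i) h.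
Qed.

End Compactness.

(** * Averages over the roots of unity *)

Section RootsOfUnity.
Context {R : realType}.
Local Notation C := R[i].

Definition unit_root (M j : nat) : C := expit (2 * pi * j%:R / M%:R).

Lemma unit_rootE M j : unit_root M j = unit_root M 1 ^+ j.
Proof. by rewrite /unit_root -expitM; congr expit; rewrite mulr1 -mulr_natr; ring. Qed.

Lemma nm_unit_root M j : nm (unit_root M j) = 1. Proof. exact: nm_expit. Qed.

Lemma unit_rootX M : (0 < M)%N -> unit_root M 1 ^+ M = 1.
Proof.
by move=> M0; rewrite -unit_rootE /unit_root mulfK ?expit2pi// pnatr_eq0 -lt0n.
Qed.

Lemma unit_root_sum M i : (0 < i < M)%N -> \sum_(j < M) unit_root M 1 ^+ i ^+ j = 0.
Proof.
move=> /andP[i0 iM]; have M0 : (0 < M)%N := ltn_trans i0 iM.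
have Mr : (0 : R) < M%:R by rewrite ltr0n.
have w1 : unit_root M 1 ^+ i != 1.
  apply/negP => /eqP; rewrite -unit_rootE => /expit_eq1 h.
  have pi2 : 0 < 2 * pi :> R by have := pi_gt0 R; lra.
  have ir : (0 : R) < i%:R by rewrite ltr0n.
  have := h _; rewrite divr_ge0 ?(ltW Mr)//; last by rewrite mulr_ge0// ltW.
  rewrite ltr_pdivrMr// ltr_pM2l// ltr_nat iM => /(_ erefl) /eqP.
  by rewrite !mulf_eq0 invr_eq0 !gt_eqF ?pi_gt0.
have := subrX1 (unit_root M 1 ^+ i) M.
rewrite exprAC unit_rootX// expr1n subrr.
by move/esym/eqP; rewrite mulf_eq0 subr_eq0 (negPf w1) => /eqP.
Qed.

(* Averaging over the rotations by roots of unity kills all the coefficients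
   but the constant one. *)
Lemma rotation_sum (p : {poly C}) (z : C) M : (size p <= M)%N ->
  \sum_(j < M) p.[z * unit_root M j] = M%:R * p.[0].
Proof.
move=> sp; rewrite horner_coef0.
under eq_bigr do rewrite (horner_coef_wide _ sp).
rewrite exchange_big /=; case: M sp => [|M] sp.
  by rewrite big_ord0 mul0r.
rewrite big_ord_recl [X in _ + X]big1 ?addr0.
  by under eq_bigr do rewrite expr0 mulr1; rewrite sumr_const card_ord mulr_natl.
move=> i _; under eq_bigr do rewrite unit_rootE exprMn -exprM mulnC exprM mulrA.
by rewrite -mulr_sumr unit_root_sum ?mulr0//= ltnS ltn_ord.
Qed.

Lemma rotation_sum_Re (p : {poly C}) (z : C) M : (size p <= M)%N ->
  \sum_(j < M) Re p.[z * unit_root M j] = M%:R * Re p.[0].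
Proof.
move=> sp; rewrite -raddf_sum rotation_sum// -(rmorph_nat (real_complex R)).
by case: (p.[0]) => x y /=; ring.
Qed.

End RootsOfUnity.

(** * An approximate identity of trigonometric polynomials *)

Section Kernel.
Context {R : realType}.
Local Notation C := R[i].

Lemma binom_step m :
  'C(2 * m.+1, m.+1)%:R * m.+1%:R = 2 * (2 * m + 1)%:R * 'C(2 * m, m)%:R :> R.
Proof.
have e : ('C(2 * m.+1, m.+1) * m.+1 = 2 * (2 * m + 1) * 'C(2 * m, m))%N.
  have h1 := mul_bin_diag (2 * m).+2 m; have h2 := mul_bin_diag (2 * m).+1 m.
  have h3 : ('C((2 * m).+1, m) = 'C((2 * m).+1, m.+1))%N.
    by rewrite -(@bin_sub (2 * m).+1 m); [congr 'C(_, _); lia|lia].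
  rewrite mulnC (_ : (2 * m.+1 = (2 * m).+2)%N); last by lia.
  rewrite -h1 /= h3 (_ : ((2 * m).+2 = 2 * m.+1)%N); last by lia.
  by rewrite -mulnA -h2 /= mulnA addn1.
by rewrite -!natrM e.
Qed.

(** Induction on the ratio [4 (2m + 1) / (2m + 2)] of consecutive central binomial coefficients,
    which is at least the ratio [4 (2m + 1) / (2m + 3)] of the lower bounds. *)
Lemma binom_ge m : (4 ^+ m : R) <= (2 * m + 1)%:R * 'C(2 * m, m)%:R.
Proof.
elim: m => [|m IH]; first by rewrite expr0 muln0 bin0 mulr1.
have e' := binom_step m.
rewrite exprS; apply: (@le_trans _ _ (4 * ((2 * m + 1)%:R * 'C(2 * m, m)%:R))).
  by rewrite ler_pM2l.
have -> : 4 * ((2 * m + 1)%:R * 'C(2 * m, m)%:R) = 2 * ('C(2 * m.+1, m.+1)%:R * m.+1%:R) :> R.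
  by rewrite e'; ring.
rewrite mulrCA mulrC ler_wpM2r//.
by rewrite -natrM ler_nat; lia.
Qed.

(** For [r = q^2] and [q = 1 / (1 + x)], Bernoulli's inequality bounds [m x q^m] by 1, so
    [(2m + 1) q^m] is bounded, and the other factor [q^m] tends to 0. *)
Lemma exists_lin_geom (r e : R) : 0 <= r < 1 -> 0 < e ->
  exists m : nat, (2 * m + 1)%:R * r ^+ m <= e.
Proof.
move=> /andP[r0 r1] e0.
pose q := Num.sqrt r.
have q0 : 0 <= q by rewrite sqrtr_ge0.
have q2 : q ^+ 2 = r by rewrite sqr_sqrtr.
have q1 : q < 1 by rewrite ltNge; apply/negP => h; nra.
have [qz|qn] := eqVneq q 0.
  by exists 1%N; rewrite -q2 qz expr1 expr2 !mulr0 ltW.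
have {qn}q0 : 0 < q by rewrite lt_neqAle eq_sym qn.
have [x qx x0] : exists2 x, q * (1 + x) = 1 & 0 < x.
  exists (q^-1 - 1); last by rewrite subr_gt0 invf_gt1.
  by rewrite addrC subrK divff// gt_eqF.
have bern m : 1 + m%:R * x <= (1 + x) ^+ m.
  elim: m => [|m IH]; first by rewrite mul0r addr0 expr0.
  have x1 : 0 < 1 + x by lra.
  rewrite exprS; apply: (@le_trans _ _ ((1 + x) * (1 + m%:R * x))).
    have mx : 0 <= m%:R * (x * x) by rewrite mulr_ge0 ?ler0n// mulr_ge0// ltW.
    rewrite -natr1; lra.
  by rewrite ler_pM2l.
have qm m : 0 < q ^+ m by rewrite exprn_gt0.
have h m : (1 + m%:R * x) * q ^+ m <= 1.
  apply: (@le_trans _ _ ((1 + x) ^+ m * q ^+ m)); first by rewrite ler_pM2r.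
  by rewrite -exprMn mulrC qx expr1n.
have B0 : 0 < 1 + 2 / x by rewrite addr_gt0// divr_gt0.
have h1 m : (2 * m + 1)%:R * q ^+ m <= 1 + 2 / x.
  have -> : (2 * m + 1)%:R = 2 * m%:R + 1 :> R by rewrite natrD natrM.
  have a1 : m%:R * q ^+ m <= x^-1.
    by rewrite -div1r ler_pdivlMr//; have := h m; have := qm m; lra.
  have a2 : q ^+ m <= 1 by rewrite exprn_ile1// ltW.
  lra.
have [n hn] : exists n : nat, (1 + 2 / x) / e / x < n%:R.
  by exists (Num.truncn ((1 + 2 / x) / e / x)).+1; exact: truncnS_gt.
move: hn; rewrite ltr_pdivrMr// ltr_pdivrMr// => hn.
have rq : r ^+ n = q ^+ n * q ^+ n by rewrite -q2 -exprM mulnC exprM expr2.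
exists n; rewrite rq mulrA.
apply: (@le_trans _ _ ((1 + 2 / x) * q ^+ n)); first by rewrite ler_pM2r// h1.
apply: (@le_trans _ _ (n%:R * x * e * q ^+ n)); first by rewrite ler_pM2r// ltW.
have := h n; have := qm n; have e1 : n%:R * x * e * q ^+ n = e * (n%:R * x * q ^+ n) by ring.
move=> q1' hh; rewrite e1 -[leRHS]mulr1 ler_pM2l//; lra.
Qed.

(** Truncated subtraction makes the exponent [|k - m|]. On the circle [kern m] is the Laurent
    polynomial [u^-m (1 + u)^(2m) / 'C(2m, m)]; since [Re u^-j = Re u^j] there, negative exponents
    may be reflected, and the kernel becomes the real part of a polynomial with constant coefficient
    1. *)
Definition kern_poly m : {poly C} :=
  \sum_(k < (2 * m).+1) ('C(2 * m, k)%:R / 'C(2 * m, m)%:R) *: 'X^((k - m) + (m - k)).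

(** The de la Vallee Poussin kernel: on the circle [|1 + u|] is [2 |cos (t / 2)|], so the mass
    concentrates at [u = 1], and the divisor normalises the mean to 1. *)
Definition kern m (u : C) : R := nm (1 + u) ^+ (2 * m) / 'C(2 * m, m)%:R.

Lemma bin_gt0R m : 0 < 'C(2 * m, m)%:R :> R.
Proof. by rewrite ltr0n bin_gt0; lia. Qed.

Lemma kern_ge0 m u : 0 <= kern m u.
Proof. by rewrite divr_ge0 ?exprn_ge0 ?nm_ge0 ?ler0n. Qed.

Lemma conjc_inv (u : C) : nm u = 1 -> u^-1 = conjc u.
Proof.
move=> u1; have u0 : u != 0 by apply/negP => /eqP h; move: u1; rewrite h nm0 => /eqP; rewrite eq_sym oner_eq0.
apply: (mulfI u0); rewrite divff// -sqr_normc nmE u1 -rmorphXn expr1n//.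
Qed.

Lemma kernE m u : nm u = 1 ->
  (kern m u)%:C = u^-1 ^+ m * (1 + u) ^+ (2 * m) / 'C(2 * m, m)%:R.
Proof.
move=> u1; rewrite /kern rmorphM/= fmorphV/= rmorph_nat; congr (_ / _).
have u0 : u != 0 by apply/negP => /eqP h; move: u1; rewrite h nm0 => /eqP; rewrite eq_sym oner_eq0.
rewrite rmorphXn/= -nmE !exprM -exprMn; congr (_ ^+ _).
have e : conjc (1 + u) = u^-1 * (1 + u).
  rewrite mulrDr mulr1 mulVf// conjc_inv// addrC.
  by case: (u) => a b; congr (_ +i* _) => /=; ring.
by rewrite sqr_normc e; ring.
Qed.

Lemma kern_polyE m u : nm u = 1 -> Re (kern_poly m).[u] = kern m u.
Proof.
move=> u1; have := kernE m u1 => /(congr1 (@Re R)) /= ->.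
have u0 : u != 0 by apply/negP => /eqP h; move: u1; rewrite h nm0 => /eqP; rewrite eq_sym oner_eq0.
rewrite exprDn mulr_sumr mulr_suml /kern_poly horner_sum !raddf_sum/=.
apply: eq_bigr => -[k /= kl] _; rewrite hornerZ hornerXn expr1n mul1r.
have -> : u^-1 ^+ m * (u ^+ k *+ 'C(2 * m, k)) / 'C(2 * m, m)%:R =
   ('C(2 * m, k)%:R / 'C(2 * m, m)%:R)%:C * (u^-1 ^+ m * u ^+ k).
  by rewrite rmorphM/= fmorphV/= !rmorph_nat -mulr_natr; ring.
have -> : 'C(2 * m, k)%:R / 'C(2 * m, m)%:R = ('C(2 * m, k)%:R / 'C(2 * m, m)%:R : R)%:C :> C.
  by rewrite rmorphM/= fmorphV/= !rmorph_nat.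
have reM (r : R) (w : C) : Re (r%:C * w) = r * Re w by case: w => a b /=; ring.
rewrite !reM; congr (_ * _).
have [mk|km] := leqP m k.
  have -> : (m - k = 0)%N by lia.
  rewrite addn0 -{2}(subnK mk) exprD mulrCA exprVn mulVf ?mulr1// expf_neq0//.
have -> : (k - m = 0)%N by lia.
have -> : u^-1 ^+ m = u^-1 ^+ (m - k) * u^-1 ^+ k by rewrite -exprD subnK// ltnW.
rewrite add0n -mulrA -exprMn mulVf// expr1n mulr1.
by rewrite conjc_inv// -rmorphXn; case: (u ^+ _).
Qed.

Lemma kern_poly0 m : (kern_poly m).[0] = 1.
Proof.
have mm : (m < (2 * m).+1)%N by lia.
rewrite /kern_poly horner_sum (bigD1 (Ordinal mm))//= big1 ?addr0.
  rewrite hornerZ hornerXn subnn expr0 mulr1 divff// pnatr_eq0.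
  by rewrite -lt0n bin_gt0; lia.
move=> -[k kl] /= /eqP km; rewrite hornerZ hornerXn expr0n.
have -> : ((k - m + (m - k))%N == 0%N) = false; last by rewrite mulr0.
by apply/negP => /eqP h; apply: km; apply/val_inj => /=; lia.
Qed.

Lemma size_kern_poly m : (size (kern_poly m) <= m.+1)%N.
Proof.
apply: (leq_trans (size_sum _ _ _)); apply/bigmax_leqP => -[k kl] _ /=.
by apply: (leq_trans (size_scale_leq _ _)); rewrite size_polyXn; lia.
Qed.

(** By the parallelogram law [|1 + u|^2 = 4 - |1 - u|^2] on the circle; [binom_ge] absorbs the
    factor [4^m] at the price of [2m + 1]. *)
Lemma kern_far m (u : C) (d : R) : nm u = 1 -> 0 <= d -> d <= nm (1 - u) ->
  kern m u <= (2 * m + 1)%:R * (1 - d ^+ 2 / 4) ^+ m.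
Proof.
move=> u1 d0 du; rewrite /kern ler_pdivrMr ?bin_gt0R//.
have e : nm (1 + u) ^+ 2 = 4 - nm (1 - u) ^+ 2.
  have := nm2E u; rewrite u1 !nm2E !raddfD/= !raddfN/=; nra.
have d2 : d ^+ 2 <= nm (1 - u) ^+ 2 by rewrite ler_sqr ?nnegrE ?nm_ge0.
have e2 : nm (1 + u) ^+ 2 <= 4 * (1 - d ^+ 2 / 4) by rewrite e; lra.
have p0 : 0 <= 1 - d ^+ 2 / 4 by have := sqr_ge0 (nm (1 + u)); lra.
rewrite exprM; apply: (@le_trans _ _ ((4 * (1 - d ^+ 2 / 4)) ^+ m)).
  by rewrite lerXn2r// nnegrE ?sqr_ge0// mulr_ge0.
rewrite exprMn [leRHS]mulrAC ler_wpM2r ?exprn_ge0//; exact: binom_ge.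
Qed.

(* A partition of unity on the circle concentrated near roots of unity; the two
   polynomial forms of [k j] serve to attach it to real and to holomorphic data. *)
Lemma trig_partition (d e : R) : 0 < d -> 0 < e ->
  exists (M m : nat) (tau : 'I_M -> R) (k : 'I_M -> C -> R) (S P : 'I_M -> {poly C}),
  [/\ forall j, 0 <= tau j <= 2 * pi,
      forall j z, nm z = 1 ->
        [/\ 0 <= k j z, k j z = Re (P j).[z] & (k j z)%:C = z^-1 ^+ m * (S j).[z]],
      forall z, nm z = 1 -> \sum_j k j z = 1 &
      forall z, nm z = 1 -> \sum_(j | d <= nm (z - expit (tau j))) k j z <= e].
Proof.
move=> d0 e0.
(* The cap at 1 keeps [1 - d'^2 / 4] in [[0, 1)] however large [d] is. *)
pose d' := Num.min d 1.
have d'0 : 0 < d' by rewrite lt_min d0 ltr01.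
have d'1 : d' <= 1 by rewrite ge_min lexx orbT.
have d'd : d' <= d by rewrite ge_min lexx.
have [||m hm] := @exists_lin_geom (1 - d' ^+ 2 / 4) e; [|by []|].
  by clearbody d'; apply/andP; split; nra.
(* [kern_poly m] has degree at most [m], so averaging over [m + 1] rotations already returns its
   constant coefficient 1; the rotated kernels then add up to exactly [M]. *)
pose M := m.+1; pose w (j : 'I_M) : C := unit_root M j.
have nw j : nm (w j) = 1 by exact: nm_unit_root.
have nV j : nm (w j)^-1 = 1 by rewrite nmV nw invr1.
have M0 : (0 : R) < M%:R by rewrite ltr0n.
have nu (j : 'I_M) (z : C) : nm z = 1 -> nm (z * (w j)^-1) = 1 by move=> z1; rewrite nmM nV z1 mulr1.
(* On the circle [kern m (z / w)] equals [z^-m] times [w^m (1 + z / w)^(2m) / 'C(2m, m)], which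
   gives [S]; [P] is the rotated [kern_poly]. Everything is divided by [M]. *)
exists M, m, (fun j : 'I_M => 2 * pi * j%:R / M%:R),
  (fun (j : 'I_M) z => kern m (z * (w j)^-1) / M%:R),
  (fun j : 'I_M => (M%:R^-1 / 'C(2 * m, m)%:R * w j ^+ m) *: (1 + (w j)^-1 *: 'X) ^+ (2 * m)),
  (fun j : 'I_M => M%:R^-1 *: (kern_poly m \Po ((w j)^-1 *: 'X))).
have pi0 := pi_gt0 R.
split.
- move=> j; have jM : (j%:R : R) <= M%:R by rewrite ler_nat ltnW.
  rewrite divr_ge0 ?mulr_ge0 ?ler0n ?(ltW pi0)//= ler_pdivrMr// ler_pM2l//; lra.
- move=> j z z1; have z0 : z != 0.
    by apply/negP => /eqP h; move: z1; rewrite h nm0 => /eqP; rewrite eq_sym oner_eq0.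
  split; first by rewrite divr_ge0 ?kern_ge0// ltW.
    rewrite hornerZ horner_comp hornerZ hornerX -(kern_polyE _ (nu j z z1)) mulrC (mulrC _ z).
    have -> : (M%:R : C)^-1 = (M%:R^-1 : R)%:C by rewrite fmorphV rmorph_nat.
    by case: (_.[_]) => a b /=; ring.
  rewrite rmorphM/= fmorphV/= rmorph_nat kernE ?nu// hornerZ horner_exp hornerD -polyC1 hornerC hornerZ hornerX.
  rewrite invfM invrK exprMn (mulrC z); ring.
- move=> z z1; rewrite -mulr_suml.
  suff -> : \sum_(j < M) kern m (z * (w j)^-1) = M%:R by rewrite divff ?gt_eqF.
  under eq_bigr do rewrite -kern_polyE ?nu//.
  rewrite -raddf_sum.
  have -> : \sum_(j < M) (kern_poly m).[z * (w j)^-1] = \sum_(j < M) (kern_poly m).[z * unit_root M j].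
    (* Inversion permutes the roots of unity; the remainder modulo [M] only matters for [j = 0]. *)
    pose rv (j : 'I_M) : 'I_M := inord ((M - j) %% M).
    have rvE (j : 'I_M) : nat_of_ord (rv j) = ((M - j) %% M)%N by rewrite inordK// ltn_mod.
    have wM : unit_root M 1 ^+ M = 1 :> C by exact: unit_rootX.
    rewrite (reindex_inj (h := rv)); last first.
      move=> i j /(congr1 (@nat_of_ord _)); rewrite !rvE => h; apply/val_inj => /=.
      have := ltn_ord i; have := ltn_ord j; move: h.
      have [->|i0] := posnP i; have [->|j0] := posnP j => //.
      + by rewrite subn0 modnn modn_small; lia.
      + by rewrite subn0 modnn modn_small; lia.
      + by rewrite !modn_small; lia.
    apply: eq_bigr => j _; congr (_.[_ * _]); apply: (mulfI (x := w (rv j))).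
      by rewrite expit_neq0.
    rewrite divff ?expit_neq0// /w (unit_rootE M j) (unit_rootE M (rv j)).
    have -> : unit_root M 1 ^+ rv j = unit_root M 1 ^+ (M - j) :> C.
      by rewrite rvE {2}(divn_eq (M - j) M) exprD mulnC exprM wM expr1n mul1r.
    by rewrite -exprD subnK ?wM// ltnW.
  rewrite rotation_sum ?size_kern_poly// kern_poly0 mulr1.
  by rewrite -[in LHS](rmorph_nat (real_complex R)).
- move=> z z1; apply: (@le_trans _ _ (\sum_(j < M) e / M%:R)); last first.
    by rewrite sumr_const card_ord -(mulr_natr (e / M%:R)) divfK// gt_eqF.
  rewrite [leRHS](bigID (fun j : 'I_M => d <= nm (z - expit (2 * pi * j%:R / M%:R))))/=.
  rewrite ler_wpDr ?sumr_ge0// => [j _|]; first by rewrite divr_ge0// ltW.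
  apply: ler_sum => j dj; rewrite ler_pM2r ?invr_gt0//; apply: le_trans hm.
  apply: kern_far; [exact: nu|exact: ltW|apply: (le_trans d'd); apply: le_trans dj _].
  rewrite -/(unit_root M j) -/(w j) nmBC.
  have -> : w j - z = w j * (1 - z * (w j)^-1).
    by rewrite mulrBr mulr1 mulrCA divff ?mulr1// expit_neq0.
  by rewrite nmM nw mul1r.
Qed.

End Kernel.

(** * Means of upper semicontinuous functions *)

Section CircleMean.
Context {R : realType}.
Local Notation C := R[i].
Local Notation mu := (@lebesgue_measure R).
Implicit Types (g : C -> \bar R) (G : C -> R).

Definition circle : set C := [set z | nm z = 1].

Local Notation D := [set` `[0%R, (2 * pi)%R]].

Lemma twopi_gt0 : 0 < 2 * pi :> R. Proof. by have := pi_gt0 R; lra. Qed.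

Lemma mu_period : mu (D : set R) = (2 * pi)%:E.
Proof. by rewrite lebesgue_measure_itv/= lte_fin twopi_gt0 oppr0 adde0. Qed.

Lemma circle_expit t : circle (expit t). Proof. exact: nm_expit. Qed.

Lemma usc_circle_near g t (a : R) : usc_on circle g -> (g (expit t) < a%:E)%E ->
  \forall s \near t, (g (expit s) < a%:E)%E.
Proof.
move=> ug ga; have [_ /(_ _ ga) h] := ug _ (circle_expit t).
have h' : \forall s \near t, circle (expit s) -> (g (expit s) < a%:E)%E.
  exact: (@expit_continuous R t _ h).
by apply: filterS h' => s; apply; exact: circle_expit.
Qed.

Lemma usc_circle_measurable g : usc_on circle g ->
  measurable_fun (D : set R) ((fun t : R => g (expit t)) : R -> \bar R).
Proof.
move=> ug; apply: (@measurable_funS _ _ _ _ setT) => //.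
have h : lower_semicontinuous (fun t => - g (expit t))%E.
  move=> t a; rewrite lteNr -EFinN => ga.
  exists [set s | (g (expit s) < (- a)%:E)%E]; first exact: usc_circle_near.
  by move=> s /=; rewrite lteNr -EFinN.
have := lower_semicontinuous_measurable h.
move/(measurableT_comp (@oppe_measurable R setT)).
by apply: eq_measurable_fun => t _ /=; rewrite oppeK.
Qed.

Lemma usc_bounded (T : topologicalType) (K : set T) (g : T -> \bar R) :
  compact K -> usc_on K g ->
  exists2 M : R, 0 <= M & forall z, K z -> (g z < M%:E)%E.
Proof.
move=> /compact_near_coveringP/near_covering_withinP cK ug.
have := cK R +oo (fun (M : R) z => (g z < M%:E)%E) _ _; case.
  move=> z Kz; have [gz ugz] := ug z Kz.
  have [a ga] : exists a : R, (g z < a%:E)%E.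
    move: gz; case: (g z) => [r _| //|_]; last by exists 0; exact: ltNyr.
    by exists (r + 1); rewrite lte_fin ltrDl.
  exists ([set z' | K z' -> (g z' < a%:E)%E], [set M | a <= M]) => /=.
    split; first exact: ugz ga.
    exact/nbhs_pinfty_ge/num_real.
  move=> [z' M] [/= h aM] Kz'; apply: lt_le_trans (h Kz') _.
  by rewrite lee_fin.
move=> M [_ hM]; exists (Num.max 0 (M + 1)); first by rewrite le_max lexx.
by move=> z; apply: hM; rewrite lt_max ltrDl ltr01 orbT.
Qed.

Lemma continuous_usc (T : topologicalType) (K : set T) (G : T -> R) :
  (forall z, K z -> {for z, continuous G}) -> usc_on K (fun z => (G z)%:E).
Proof.
move=> cG z Kz; split; first exact: ltry.
move=> a; rewrite lte_fin => Ga; have e0 : 0 < a - G z by rewrite subr_gt0.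
have /cont_realP/(_ _ e0) := cG z Kz; apply: filterS => y.
by rewrite ltr_norml lte_fin => /andP[_ h] _; lra.
Qed.

Lemma subcst_ge0 (M : R) (x : \bar R) : (x <= M%:E -> 0 <= M%:E - x)%E.
Proof.
by case: x => [r| |] //=; rewrite -?EFinB ?lee_fin ?subr_ge0// => _; exact: leey.
Qed.

Lemma sum_subcst (I : Type) (s : seq I) (M : R) (x : I -> \bar R) :
  (forall i, x i < +oo)%E ->
  ((\sum_(i <- s) x i < +oo) /\
  (\sum_(i <- s) (M%:E - x i) = ((size s)%:R * M)%:E - \sum_(i <- s) x i))%E.
Proof.
move=> xoo; elim: s => [|i s [IH1 IH2]].
  by rewrite !big_nil /= mul0r sube0; split => //; exact: ltry.
rewrite !big_cons IH2 /=; move: (xoo i) IH1.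
case: (x i) => [r| |] //; case: (\sum_(j <- s) x j)%E => [t| |] //= _ _; split => //; try exact: ltry.
by rewrite -?EFinB -?EFinD -?EFinB; congr (_%:E); rewrite -natr1; ring.
Qed.

Lemma maxe_le2 (a b c d : \bar R) : (a <= c -> b <= d -> maxe a b <= maxe c d)%E.
Proof. by move=> ac bd; rewrite ge_max !le_max ac bd orbT. Qed.

Lemma circle_mean_le g1 g2 : usc_on circle g1 -> usc_on circle g2 ->
  (forall z, circle z -> g1 z <= g2 z)%E -> (circle_mean g1 <= circle_mean g2)%E.
Proof.
move=> u1 u2 g12; rewrite /circle_mean lee_pmul2l ?lte_fin ?invr_gt0 ?twopi_gt0//.
have m1 := usc_circle_measurable u1; have m2 := usc_circle_measurable u2.
rewrite integralE [leRHS]integralE; apply: leeB.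
  apply: ge0_le_integral => //; first exact: measurable_funepos.
    exact: measurable_funepos.
  move=> t _; rewrite !funeposE; apply: maxe_le2 => //; exact/g12/circle_expit.
apply: ge0_le_integral => //; first exact: measurable_funeneg.
  exact: measurable_funeneg.
move=> t _; rewrite !funenegE; apply: maxe_le2 => //.
by rewrite leeN2; exact/g12/circle_expit.
Qed.

(** As [g] may have integral [-oo], the identity [(M - f) + f^+ = M + f^-] between nonnegative
    functions is integrated instead. The integral of [f^+] is finite because [f <= M], so it can be
    subtracted. *)
Lemma integral_sub_cst g (M : R) : 0 <= M -> usc_on circle g ->
  (forall z, circle z -> g z < M%:E)%E ->
  (\int[mu]_(t in D) (M%:E - g (expit t)) =
   (2 * pi * M)%:E - \int[mu]_(t in D) g (expit t))%E.
Proof.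
move=> M0 ug gM; have mg := usc_circle_measurable ug.
pose f t := g (expit t).
have fM t : (f t <= M%:E)%E by exact/ltW/gM/circle_expit.
have mM : measurable_fun (D : set R) (cst M%:E : R -> \bar R) by exact: measurable_cst.
have mp := measurable_funepos mg; have mn := measurable_funeneg mg.
have IM : (\int[mu]_(t in D) M%:E = (2 * pi * M)%:E)%E.
  by rewrite integral_cst//= mu_period -EFinM mulrC.
have Pfin : (\int[mu]_(t in D) f^\+ t)%E \is a fin_num.
  rewrite ge0_fin_numE; last exact: integral_ge0.
  apply: (@le_lt_trans _ _ (\int[mu]_(t in D) M%:E)%E); last by rewrite IM ltry.
  apply: ge0_le_integral => // t _; rewrite funeposE ge_max fM lee_fin M0//.
have e : (\int[mu]_(t in D) (M%:E - f t) + \int[mu]_(t in D) f^\+ t =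
  (2 * pi * M)%:E + \int[mu]_(t in D) f^\- t)%E.
  rewrite -IM -!ge0_integralD//.
  - apply: eq_integral => t _; rewrite funeposE funenegE.
    case: (f t) (fM t) => [r| |] //=; rewrite ?lee_fin => rM.
      rewrite -!EFin_max -?EFinB -!EFinD; congr (_%:E).
      by rewrite /Num.max; case: ltP => ?; case: ltP => ?; lra.
    by rewrite maxye maxNye adde0.
  - by move=> t _; exact/subcst_ge0/fM.
  - exact: emeasurable_funB.
rewrite [in RHS]integralE -/f.
move: Pfin e; set p := (\int[mu]_(t in D) f^\+ t)%E; set N := (\int[mu]_(t in D) f^\- t)%E.
have N0 : (0 <= N)%E by exact: integral_ge0.
case: p => [r _| |] //; move=> e.
have -> : (\int[mu]_(t in D) (M%:E - f t) = (2 * pi * M)%:E + N - r%:E)%E.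
  by rewrite -e addeK.
case: N N0 {e} => [s| |] //= _.
by rewrite -?EFinB -?EFinD -?EFinB -?EFinD; congr (_%:E); ring.
Qed.

Lemma circle_mean_lt g (a : R) :
  (circle_mean g < a%:E)%E = (\int[mu]_(t in D) g (expit t) < (2 * pi * a)%:E)%E.
Proof. by rewrite /circle_mean lte_pdivrMl ?twopi_gt0// EFinM. Qed.

Lemma integral_sub_gt g (M a : R) : 0 <= M -> usc_on circle g ->
  (forall z, circle z -> g z < M%:E)%E ->
  (circle_mean g < a%:E)%E =
  ((2 * pi * (M - a))%:E < \int[mu]_(t in D) (M%:E - g (expit t)))%E.
Proof.
move=> M0 ug gM; rewrite circle_mean_lt integral_sub_cst//.
case: (\int[mu]_(t in D) _)%E => [r| |] //=.
- by rewrite -EFinB !lte_fin; apply/idP/idP => h; lra.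
- by rewrite ltNyr ltry.
Qed.

(* The Lipschitz regularisation of [g] truncated below at [- k]. *)
Definition sup_conv g (k : nat) (z : C) : R :=
  sup [set fine (maxe (g w) (- k%:R)%:E) - k%:R * nm (z - w) | w in circle].

Section SupConv.
Variables (g : C -> \bar R) (M : R).
Hypotheses (M0 : 0 <= M) (ug : usc_on circle g)
  (gM : forall z, circle z -> (g z < M%:E)%E).

Let h (k : nat) z : R := fine (maxe (g z) (- k%:R)%:E).

Let hE k z : circle z -> (h k z)%:E = maxe (g z) (- k%:R)%:E.
Proof.
move=> Tz; rewrite /h fineK//; move: (gM Tz); case: (g z) => [r| |]//= _.
  by rewrite -EFin_max.
by rewrite maxNye.
Qed.

Let hM k z : circle z -> h k z <= M.
Proof.
move=> Tz; rewrite -lee_fin hE// ge_max (ltW (gM Tz)) lee_fin.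
by rewrite (le_trans _ M0)// oppr_le0.
Qed.

Lemma sup_conv_ge k z w : circle w -> h k w - k%:R * nm (z - w) <= sup_conv g k z.
Proof.
move=> Tw; apply: ub_le_sup; last by exists w.
exists M => _ [w' Tw' <-]; apply: (@le_trans _ _ (h k w')); last exact: hM.
by rewrite lerBlDr lerDl mulr_ge0 ?nm_ge0.
Qed.

Lemma sup_conv_le k z (B : R) :
  (forall w, circle w -> h k w - k%:R * nm (z - w) <= B) -> sup_conv g k z <= B.
Proof.
move=> hB; apply: ge_sup; last by move=> _ [w Tw <-]; exact: hB.
by exists (h k (expit 0) - k%:R * nm (z - expit 0)), (expit 0) => //; exact: circle_expit.
Qed.

Lemma sup_conv_ub k z : circle z -> (g z <= (sup_conv g k z)%:E)%E.
Proof.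
move=> Tz; apply: (@le_trans _ _ (h k z)%:E); first by rewrite hE// le_max lexx.
by rewrite lee_fin; have := @sup_conv_ge k z z Tz; rewrite subrr nm0 mulr0 subr0.
Qed.

Lemma sup_conv_bound k z : sup_conv g k z <= M.
Proof.
apply: sup_conv_le => w Tw; apply: (@le_trans _ _ (h k w)); last exact: hM.
by rewrite lerBlDr lerDl mulr_ge0 ?nm_ge0.
Qed.

Lemma sup_conv_lip k z z' : sup_conv g k z <= sup_conv g k z' + k%:R * nm (z - z').
Proof.
apply: sup_conv_le => w Tw; have h1 := @sup_conv_ge k z' w Tw.
have h2 : nm (z' - w) <= nm (z - z') + nm (z - w).
  by rewrite (nmBC z z'); exact: nm_triangle.
have : k%:R * nm (z' - w) <= k%:R * (nm (z - z') + nm (z - w)) by rewrite ler_wpM2l.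
rewrite mulrDr; lra.
Qed.

Lemma sup_conv_continuous k : continuous (sup_conv g k).
Proof.
move=> z; apply: cont_real => e e0.
have k0 : 0 < (k.+1%:R : R) by rewrite ltr0n.
have e1 : 0 < e / k.+1%:R by rewrite divr_gt0.
apply: filterS (near_nm z e1) => w wz.
have h1 := sup_conv_lip k w z; have h2 := sup_conv_lip k z w.
rewrite (nmBC z w) in h2.
have : k%:R * nm (w - z) < e.
  apply: (@le_lt_trans _ _ (k.+1%:R * nm (w - z))).
    by rewrite ler_wpM2r ?nm_ge0// ler_nat.
  by rewrite mulrC -ltr_pdivlMr.
by move=> h3; rewrite ltr_norml; apply/andP; split; lra.
Qed.

Lemma sup_conv_dec k l z : (k <= l)%N -> sup_conv g l z <= sup_conv g k z.
Proof.
move=> kl; have klr : (k%:R : R) <= l%:R by rewrite ler_nat.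
apply: sup_conv_le => w Tw; apply: le_trans (sup_conv_ge k z Tw).
have : h l w <= h k w.
  by rewrite -lee_fin !hE//; apply: maxe_le2 => //; rewrite lee_fin lerN2.
have : k%:R * nm (z - w) <= l%:R * nm (z - w) by rewrite ler_wpM2r ?nm_ge0.
by move=> *; lra.
Qed.

(** Within distance [d] of [z] the values of [g] are below [a], and so is the truncation level once
    [k > |a|]. Farther away the penalty [k d] exceeds [M - a]. *)
Lemma sup_conv_lim z (a : R) : circle z -> (g z < a%:E)%E ->
  exists k, sup_conv g k z <= a.
Proof.
move=> Tz ga; have [_ /(_ a ga) /nbhs_nmP[d d0 hd]] := ug Tz.
have [k hk] : exists k : nat, Num.max `|a| ((M - a) / d) < k%:R.
  by exists (Num.truncn (Num.max `|a| ((M - a) / d))).+1; exact: truncnS_gt.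
move: hk; rewrite gt_max => /andP[k1 k2]; rewrite ltr_pdivrMr// in k2.
exists k; apply: sup_conv_le => w Tw; have [wz|wz] := ltP (nm (w - z)) d.
  have : h k w <= a.
    rewrite -lee_fin hE// ge_max (ltW (hd _ wz Tw)) lee_fin.
    by move: k1; rewrite ltr_norml => /andP[? _]; lra.
  have : 0 <= k%:R * nm (z - w) by rewrite mulr_ge0 ?nm_ge0.
  by rewrite -/(h k w); lra.
have : k%:R * d <= k%:R * nm (z - w) by rewrite ler_wpM2l// nmBC.
have := hM k Tw; lra.
Qed.

(** Monotone convergence for the nonnegative functions [M + 1 - sup_conv g k], which increase to
    [M + 1 - g]. The shift is by [M + 1] because [sup_conv] is only known to be at most [M], whereas
    [integral_sub_gt] asks for a strict bound. *)
Lemma sup_conv_mean (a : R) : (circle_mean g < a%:E)%E ->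
  exists k, real_mean (sup_conv g k) < a.
Proof.
have Mlt : M < M + 1 by rewrite ltrDl.
have M10 : 0 <= M + 1 by rewrite addr_ge0.
have gM1 z : circle z -> (g z < (M + 1)%:E)%E.
  by move=> Tz; apply: lt_trans (gM Tz) _; rewrite lte_fin.
rewrite (@integral_sub_gt g (M + 1))// => ga.
pose f k t := ((M + 1)%:E - (sup_conv g k (expit t))%:E)%E.
have usc k : usc_on circle (fun z => (sup_conv g k z)%:E).
  by apply: continuous_usc => z _; exact: sup_conv_continuous.
have fub k z : circle z -> ((sup_conv g k z)%:E < (M + 1)%:E)%E.
  by move=> _; rewrite lte_fin (le_lt_trans (sup_conv_bound k z)).
have mf k : measurable_fun D (f k).
  apply: emeasurable_funB; first exact: measurable_cst.
  exact: (usc_circle_measurable (usc k)).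
have f0 k t : D t -> (0 <= f k t)%E.
  by move=> _; rewrite /f -EFinB lee_fin; have := sup_conv_bound k (expit t); lra.
have nd t : D t -> {homo f^~ t : n m / (n <= m)%N >-> (n <= m)%E}.
  move=> _ n m nm'; rewrite /f -!EFinB lee_fin.
  by have := @sup_conv_dec n m (expit t) nm'; lra.
have limE t : D t -> limn (f^~ t) = ((M + 1)%:E - g (expit t))%E.
  move=> Dt; apply/cvg_lim => //.
  have := ereal_nondecreasing_cvgn (nd t Dt).
  suff -> : ereal_sup (range (f^~ t)) = ((M + 1)%:E - g (expit t))%E by [].
  apply/eqP; rewrite eq_le; apply/andP; split.
    apply: ge_ereal_sup => _ [k _ <-]; rewrite /f; apply: leeB => //.
    exact/sup_conv_ub/circle_expit.
  have key b : (g (expit t) < b%:E)%E ->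
      ((M + 1 - b)%:E <= ereal_sup (range (f^~ t)))%E.
    move=> /(sup_conv_lim (circle_expit t))[k hk].
    apply: (@le_trans _ _ (f k t)); last by apply: ereal_sup_ubound; exists k.
    by rewrite /f -EFinB lee_fin; lra.
  move: key (gM (circle_expit t)); case: (g (expit t)) => [r| |] //= key _.
    apply/lee_addgt0Pr => e e0; rewrite -EFinB -leeBlDr// -EFinB.
    have -> : M + 1 - r - e = M + 1 - (r + e) by ring.
    by apply: key; rewrite lte_fin ltrDl.
  rewrite leye_eq; apply/eqP/eqyP => A A0.
  have -> : A = M + 1 - (M + 1 - A) by ring.
  by apply: key; exact: ltNyr.
have cv : ((\int[mu]_(t in D) f k t)%E @[k --> \oo] -->
    (\int[mu]_(t in D) ((M + 1)%:E - g (expit t)))%E).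
  have -> : (\int[mu]_(t in D) ((M + 1)%:E - g (expit t)) =
      \int[mu]_(t in D) limn (f^~ t))%E.
    by apply: eq_integral => t /set_mem Dt; rewrite limE.
  exact: cvg_monotone_convergence.
have [k hk] : exists k, ((2 * pi * (M + 1 - a))%:E < \int[mu]_(t in D) f k t)%E.
  apply: contrapT => /forallNP hN; move: ga; rewrite ltNge => /negP; apply.
  rewrite -(cvg_lim _ cv)//; apply: lime_le; first by apply/cvg_ex; eexists; exact: cv.
  by near=> k; rewrite leNgt; apply/negP; exact: hN.
exists k; have := @integral_sub_gt _ (M + 1) a M10 (usc k) (fub k).
rewrite hk circle_mean_real ?lte_fin// => t.
by apply: (@cont_comp _ _ _ (@expit R)); [exact: expit_continuous|exact: sup_conv_continuous].
Unshelve. all: end_near. Qed.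

End SupConv.

(* Trigonometric polynomials are handled as the real parts [Re p.[z]]. *)
Lemma derivable_poly (p : {poly C}) (z : C) : derivable (horner p) z 1.
Proof.
elim/poly_ind: p => [|p r ih].
  have -> : horner (0 : {poly C}) = cst 0 by apply/funext => y; rewrite horner0.
  exact: derivable_cst.
have -> : horner (p * 'X + r%:P) = (fun y => p.[y] * y + r).
  by apply/funext => y; rewrite !hornerE.
apply: derivableD; last exact: derivable_cst.
by apply: (@derivableM C C); [exact: ih|exact: derivable_id].
Qed.

Lemma continuous_poly (p : {poly C}) : continuous (horner p).
Proof.
by move=> z; apply/differentiable_continuous/derivable1_diffP/derivable_poly.
Qed.

Lemma continuous_Re_poly (p : {poly C}) : continuous (fun z => Re p.[z]).
Proof.
move=> z; apply: (@cont_comp _ _ _ (horner p) (@Re R)).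
  exact: continuous_poly.
exact: Re_continuous.
Qed.

Lemma usc_Re_poly (p : {poly C}) : usc_on circle (fun z => (Re p.[z])%:E).
Proof. by apply: continuous_usc => z _; exact: continuous_Re_poly. Qed.

Lemma real_mean_poly (p : {poly C}) : real_mean (fun z => Re p.[z]) = Re p.[0].
Proof.
have := @holomorphic_mean R (horner p) 0 1 2 ltr01 _ (@continuous_poly p) _.
rewrite ltrDl ltr01 => /(_ erefl (fun z _ => @derivable_poly p z)) <-.
by congr (_ * _); congr itg; apply/funext => t; rewrite mul1r add0r.
Qed.

Lemma circle_mean_poly (p : {poly C}) :
  circle_mean (fun z => (Re p.[z])%:E) = (Re p.[0])%:E.
Proof.
rewrite circle_mean_real ?real_mean_poly// => t.
by apply: (@cont_comp _ _ _ (@expit R) (fun z => Re p.[z]));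
  [exact: expit_continuous|exact: continuous_Re_poly].
Qed.

Lemma le_real_mean F G : continuous F -> continuous G ->
  (forall z, circle z -> F z <= G z) -> real_mean F <= real_mean G.
Proof.
move=> cF cG FG; rewrite /real_mean ler_pM2l ?invr_gt0 ?twopi_gt0//.
apply: le_itg => [t|t|t _]; last exact/FG/circle_expit.
- by apply: (@cont_comp _ _ _ (@expit R)); [exact: expit_continuous|exact: cF].
- by apply: (@cont_comp _ _ _ (@expit R)); [exact: expit_continuous|exact: cG].
Qed.

Lemma real_meanD_cst F (a : R) : continuous F ->
  real_mean (fun z => F z + a) = real_mean F + a.
Proof.
move=> cF; have c0 : continuous (fun t => F (expit t)).
  by move=> t; apply: (@cont_comp _ _ _ (@expit R)); [exact: expit_continuous|exact: cF].
have pi2 := twopi_gt0; rewrite /real_mean.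
have -> : itg 0 (2 * pi) (fun t => F (expit t) + a) =
    itg 0 (2 * pi) (fun t => F (expit t) - (fun=> - a) t).
  by congr itg; apply/funext => t; rewrite opprK.
rewrite itgB//; last exact: cst_continuous.
rewrite itg_cst ?(ltW pi2)// subr0.
by rewrite mulrBr mulNr mulrN mulrCA mulVf ?gt_eqF// mulr1 opprK.
Qed.

(** The convex combination of the differences [G j - v] splits into near indices, of total weight at
    most 1, and far indices, of total weight at most [e]. *)
Lemma partition_approx (V : normedModType C) (M : nat) (k : 'I_M -> R)
    (far : pred 'I_M) (G : 'I_M -> V) (v : V) (a b e : R) :
  (forall j, 0 <= k j) -> \sum_j k j = 1 -> \sum_(j | far j) k j <= e ->
  0 <= a -> 0 <= b ->
  (forall j, ~~ far j -> nm (G j - v) <= a) -> (forall j, nm (G j - v) <= b) ->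
  nm (\sum_j (k j)%:C *: G j - v) <= a + b * e.
Proof.
move=> k0 k1 ke a0 b0 ha hb.
have -> : \sum_j (k j)%:C *: G j - v = \sum_j (k j)%:C *: (G j - v).
  under [RHS]eq_bigr do rewrite scalerBr.
  rewrite sumrB -scaler_suml; congr (_ - _).
  by rewrite -(raddf_sum (real_complex R)) k1 scale1r.
apply: (le_trans (nm_sum _ _ _)).
have E j : nm ((k j)%:C *: (G j - v)) = k j * nm (G j - v).
  by rewrite nmZ nm_real ger0_norm.
under eq_bigr do rewrite E.
rewrite (bigID far)/= addrC; apply: lerD.
  apply: (@le_trans _ _ (\sum_(j | ~~ far j) k j * a)).
    by apply: ler_sum => j fj; rewrite ler_wpM2l// ha.
  rewrite -mulr_suml -[leRHS]mul1r ler_wpM2r//.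
  by rewrite -k1 [leRHS](bigID far)/= lerDr sumr_ge0.
apply: (@le_trans _ _ (\sum_(j | far j) k j * b)).
  by apply: ler_sum => j fj; rewrite ler_wpM2l.
by rewrite -mulr_suml mulrC ler_wpM2l.
Qed.

(** Weierstrass approximation: the values of [G] at the nodes [expit (tau j)] are interpolated with
    the weights of [trig_partition], which on the circle are real parts of polynomials. *)
Lemma trig_approx G (e : R) : continuous G -> 0 < e ->
  exists p : {poly C}, forall z, circle z -> `|Re p.[z] - G z| <= e.
Proof.
move=> cG e0; have e2 : 0 < e / 2 by lra.
have uG : usc_on circle (fun z => `|G z|%:E).
  apply: continuous_usc => z _; apply: (@cont_comp _ _ _ G (@Num.norm R R)).
    exact: cG.
  exact: norm_continuous.
have [B B0 hB] := usc_bounded (@compact_circle R) uG.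
have [|d d0 hd] := @tube R C C circle id (fun z w => circle w -> `|G w - G z| < e / 2)
  (@compact_circle R) (fun z _ => @cont_id _ z).
  move=> z _; have e4 : 0 < e / 4 by lra.
  have /cont_realP/(_ _ e4) h := cG z.
  exists ([set w | `|G w - G z| < e / 4], [set w | `|G w - G z| < e / 4]) => //=.
  move=> [w w'] /= [h1 h2] _; have := ler_distD (G z) (G w') (G w).
  by rewrite (distrC (G z)); lra.
(* With [|G| <= B] the far nodes cost at most [2 B] times this weight, hence at most [e / 2]. *)
have D0 : 0 < e / (4 * (B + 1)) by rewrite divr_gt0// mulr_gt0//; lra.
have [M [m [tau [k [S [P [htau hk k1 kfar]]]]]]] := trig_partition d0 D0.
exists (\sum_j (G (expit (tau j)))%:C *: P j) => z Tz.
have cz : circle z by [].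
pose far (j : 'I_M) := d <= nm (z - expit (tau j)).
have hBr w : circle w -> `|G w| <= B by move=> /hB; rewrite lte_fin => /ltW.
have h : nm (\sum_j (k j z)%:C *: ((G (expit (tau j)))%:C : C) - (G z)%:C) <=
    e / 2 + 2 * B * (e / (4 * (B + 1))).
  apply: (@partition_approx C M (k^~ z) far) => [j|||||j fj|j].
  - by have [] := hk j z Tz.
  - exact: k1.
  - exact: kfar.
  - exact: ltW.
  - by rewrite mulr_ge0.
  - rewrite -rmorphB nm_real; apply/ltW/hd => //; last exact: circle_expit.
    by rewrite nmBC ltNge.
  - rewrite -rmorphB nm_real; apply: le_trans (ler_normB _ _) _.
    by have := hBr _ cz; have := hBr _ (circle_expit (tau j)); lra.
have h2 : 2 * B * (e / (4 * (B + 1))) <= e / 2.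
  have -> : 2 * B * (e / (4 * (B + 1))) = e / 2 * (B / (B + 1)) by field; lra.
  by rewrite ler_piMr ?(ltW e2)// ler_pdivrMr; lra.
apply: (@le_trans _ _ (e / 2 + 2 * B * (e / (4 * (B + 1))))); last by lra.
apply: le_trans h; apply: le_trans (normRe_le_nm _); rewrite raddfB /=.
rewrite horner_sum !raddf_sum le_eqVlt; apply/orP; left; apply/eqP; congr (`|_ - _|).
apply: eq_bigr => j _; rewrite hornerZ; have [_ -> _] := hk j z Tz.
by case: (P j).[z] => x y /=; ring.
Qed.

(** Replaces a bound on a mean by an open condition: a strict polynomial majorant, whose mean is its
    value at 0. [sup_conv] supplies a continuous majorant, and [trig_approx] makes it a
    polynomial. *)
Lemma usc_poly_approx g (a : R) : usc_on circle g -> (circle_mean g < a%:E)%E ->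
  exists p : {poly C}, (forall z, circle z -> g z < (Re p.[z])%:E)%E /\ Re p.[0] < a.
Proof.
move=> ug ga; have [M M0 gM] := usc_bounded (@compact_circle R) ug.
have [k hk] := sup_conv_mean M0 ug gM ga.
set G := sup_conv g k in hk; have cG : continuous G by exact: (sup_conv_continuous M0 gM).
(* An approximation within [e] raised by [2 e] lies between [G + e] and [G + 3 e]: strictly above
   [g], with mean still below [a]. *)
pose e := (a - real_mean G) / 4; have e0 : 0 < e by rewrite /e; lra.
have [p hp] := trig_approx cG e0; exists (p + ((2 * e)%:C)%:P); split.
  move=> z Tz; rewrite hornerD hornerC raddfD/=.
  apply: (@le_lt_trans _ _ (G z)%:E); first exact: (sup_conv_ub M0 gM).
  by rewrite lte_fin; have := hp z Tz; rewrite ler_norml => /andP[? _]; lra.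
rewrite -real_mean_poly.
apply: (@le_lt_trans _ _ (real_mean G + 3 * e)); last by rewrite /e; lra.
rewrite -real_meanD_cst//; apply: le_real_mean.
- exact: continuous_Re_poly.
- by move=> z; apply: cont_add; [exact: cG|exact: cont_cst].
move=> z Tz; rewrite hornerD hornerC raddfD/=.
by have := hp z Tz; rewrite ler_norml => /andP[_ ?]; lra.
Qed.

Lemma circle_mean_le_poly g (p : {poly C}) : usc_on circle g ->
  (forall z, circle z -> g z <= (Re p.[z])%:E)%E -> (circle_mean g <= (Re p.[0])%:E)%E.
Proof.
move=> ug gp; rewrite -circle_mean_poly; apply: circle_mean_le => //.
exact: usc_Re_poly.
Qed.

(** If all the means were at least [a], the integrals of the nonnegative [M - g l] would sum to at
    most [L] times that of [M - a]. But their pointwise sum is at least [L (M - Re p)], of mean [L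
    (M - Re p.[0])], which is larger. *)
Lemma circle_mean_average (L : nat) (g : 'I_L -> C -> \bar R) (p : {poly C}) (a : R) :
  (0 < L)%N -> (forall l, usc_on circle (g l)) ->
  (forall z, circle z -> \sum_l g l z <= (L%:R * Re p.[z])%:E)%E ->
  Re p.[0] < a -> exists l, (circle_mean (g l) < a%:E)%E.
Proof.
move=> L0 ug gp pa; apply: contrapT => /forallNP hN.
have [Mp Mp0 hMp] := usc_bounded (@compact_circle R) (usc_Re_poly p).
have [M [M0 gM pM]] : exists M : R, [/\ 0 <= M,
    forall l z, circle z -> (g l z < M%:E)%E & forall z, circle z -> Re p.[z] <= M].
  have /choice[Ml hMl] : forall l, exists M : R, 0 <= M /\ forall z, circle z -> (g l z < M%:E)%E.
    by move=> l; have [M ? ?] := usc_bounded (@compact_circle R) (ug l); exists M.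
  have S0 : 0 <= \sum_l Ml l by apply: sumr_ge0 => l _; case: (hMl l).
  exists (\sum_l Ml l + Mp); split; first exact: addr_ge0.
    move=> l z Tz; apply: lt_le_trans (proj2 (hMl l) z Tz) _.
    rewrite lee_fin -[leLHS]addr0 lerD// (bigD1 l)//= lerDl sumr_ge0// => i _.
    by case: (hMl i).
  move=> z Tz; have := hMp z Tz; rewrite lte_fin => h; rewrite -[leLHS]add0r.
  by apply: lerD => //; exact: ltW.
have Lr : (0 : R) < L%:R by rewrite ltr0n.
have pi2 := twopi_gt0.
have h1 l : (\int[mu]_(t in D) (M%:E - g l (expit t)) <= (2 * pi * (M - a))%:E)%E.
  by rewrite leNgt -(@integral_sub_gt (g l) M a M0 (ug l) (gM l)); exact/negP.
have m1 l : measurable_fun (D : set R) ((fun t => M%:E - g l (expit t))%E : R -> \bar R).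
  apply: emeasurable_funB; first exact: measurable_cst.
  exact: (usc_circle_measurable (ug l)).
have n1 l t : D t -> (0 <= M%:E - g l (expit t))%E.
  by move=> _; apply/subcst_ge0/ltW/gM/circle_expit.
have S1 : (\int[mu]_(t in D) (\sum_(l <- index_enum 'I_L) (M%:E - g l (expit t))) <=
   (L%:R * (2 * pi * (M - a)))%:E)%E.
  rewrite ge0_integral_sum//.
  apply: (@le_trans _ _ (\sum_(l <- index_enum 'I_L) (2 * pi * (M - a))%:E)%E).
    by apply: lee_sum => l _; exact: h1.
  by rewrite sumEFin lee_fin sumr_const card_ord -[leLHS]mulr_natl lexx.
pose p' : {poly C} := (L%:R * M)%:C%:P - L%:R *: p.
have p'E z : Re p'.[z] = L%:R * M - L%:R * Re p.[z].
  rewrite /p' hornerD hornerN hornerC hornerZ raddfB /=; congr (_ - _).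
  by rewrite -(rmorph_nat (real_complex R)); case: (p.[z]) => u v /=; rewrite mul0r subr0.
have S2 t : ((Re p'.[expit t])%:E <=
    \sum_(l <- index_enum 'I_L) (M%:E - g l (expit t)))%E.
  have goo l : (g l (expit t) < +oo)%E.
    by apply: lt_trans (gM l _ (circle_expit t)) _; exact: ltry.
  have [_ ->] := sum_subcst (index_enum 'I_L) M goo.
  rewrite p'E EFinB; apply: leeB; last exact/gp/circle_expit.
  by rewrite -sum1_size big_const_ord iter_addn mul1n addn0.
have := circle_mean_poly p'; rewrite /circle_mean => /eqP.
rewrite eq_le => /andP[_]; rewrite leNgt => /negP; apply.
rewrite lte_pdivrMl// -EFinM; apply: (@le_lt_trans _ _ (L%:R * (2 * pi * (M - a)))%:E).
  apply: le_trans S1; apply: ge0_le_integral => //.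
  - move=> t _; rewrite lee_fin p'E subr_ge0 ler_pM2l//; exact/pM/circle_expit.
  - exact: (usc_circle_measurable (usc_Re_poly p')).
  - by apply: emeasurable_sum => l; exact: m1.
rewrite lte_fin p'E.
have -> : L%:R * (2 * pi * (M - a)) = 2 * pi * (L%:R * M - L%:R * a) by ring.
by rewrite ltr_pM2l// ltrD2l ltrN2 ltr_pM2l.
Qed.

End CircleMean.

(** * Plurisubharmonic functions on analytic discs *)

Section Semicontinuity.
Context {R : realType}.
Local Notation C := R[i].

Lemma ereal_between (x : \bar R) (b : R) : (x < b%:E)%E ->
  exists2 a : R, (x < a%:E)%E & a < b.
Proof.
case: x => [r| |] //.
  by rewrite lte_fin => rb; exists ((r + b) / 2); rewrite ?lte_fin; lra.
by move=> _; exists (b - 1); [exact: ltNyr|lra].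
Qed.

Lemma near_diag (T U : topologicalType) (P : T -> U -> Prop) (a : T -> U) (y : T) :
  {for y, continuous a} -> (\forall y' \near y & x \near a y, P y' x) ->
  \forall y' \near y, P y' (a y').
Proof.
move=> ca [[A B] [/= yA aB] AB].
have h : \forall y' \near y, B (a y') by exact: ca.
by apply: filterS (filterI yA h) => y' [Ay' By']; exact: (AB (y', a y')).
Qed.

Lemma usc_lt_near (T : topologicalType) (V : normedModType C) (X : set V)
    (u : V -> \bar R) (q : T -> R) x y :
  open X -> usc_on X u -> X x -> {for y, continuous q} -> (u x < (q y)%:E)%E ->
  \forall y' \near y & x' \near x, X x' /\ (u x' < (q y')%:E)%E.
Proof.
move=> oX uu Xx cq /ereal_between[b xb bq].
have [_ /(_ b xb) h] := uu x Xx.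
have e0 : 0 < q y - b by rewrite subr_gt0.
have /cont_realP/(_ _ e0) hq := cq.
have hX : \forall x' \near x, X x' by exact: open_nbhs_nbhs.
exists ([set y' | `|q y' - q y| < q y - b], [set x' | X x' /\ (X x' -> (u x' < b%:E)%E)]) => /=.
  by split => //; exact: filterI hX h.
move=> [y' x'] /= [hy [Xx' /(_ Xx') hx]]; split => //; apply: lt_trans hx _.
by move: hy; rewrite lte_fin ltr_norml => /andP[? _]; lra.
Qed.

(** If the supremum [S] were not attained, every point would have a neighbourhood with values below
    some [t < S]; compactness makes [t] uniform, through the filter of left neighbourhoods of [S],
    and contradicts the choice of [S]. *)
Lemma usc_max (T : topologicalType) (K : set T) (g : T -> \bar R) :
  compact K -> K !=set0 -> usc_on K g ->
  exists2 x, K x & forall y, K y -> (g y <= g x)%E.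
Proof.
move=> cK [x0 Kx0] ug; have [M M0 gM] := usc_bounded cK ug.
apply: contrapT => hN.
have hN' x : K x -> exists2 y, K y & (g x < g y)%E.
  move=> Kx; apply: contrapT => h; apply: hN; exists x => // y Ky.
  by rewrite leNgt; apply/negP => xy; apply: h; exists y.
pose S := ereal_sup (g @` K).
have Slt x : K x -> (g x < S)%E.
  by move=> Kx; have [y Ky xy] := hN' x Kx; apply: lt_le_trans xy _; apply: ereal_sup_ubound; exists y.
have SM : (S <= M%:E)%E by apply: ge_ereal_sup => _ [x Kx <-]; exact/ltW/gM.
have [s Ss] : exists s : R, S = s%:E.
  move: (SM) (Slt x0 Kx0); case: (S) => [s _ _| |]; [by exists s|by rewrite leye_eq|].
  by move=> _; rewrite ltNge leNye.
move/compact_near_coveringP/near_covering_withinP : cK => cK.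
have := cK R s^'- (fun t x => (g x < t%:E)%E) _ _; case.
  move=> x Kx; have := Slt x Kx; rewrite Ss => /ereal_between[a xa as'].
  have [_ /(_ a xa) h] := ug x Kx.
  exists ([set x' | K x' -> (g x' < a%:E)%E], [set t | a < t]) => /=.
    by split => //; exact: nbhs_left_gt.
  move=> [x' t] /= [h1 at'] Kx'; apply: lt_trans (h1 Kx') _; by rewrite lte_fin.
move=> e /= e0 he; pose t := s - e / 2.
have ts : t < s by rewrite /t; lra.
have tb : ball s e t by rewrite -ball_normE /= /t opprB addrCA subrr addr0 gtr0_norm; lra.
have := he t tb ts => ht.
have : (S <= t%:E)%E by apply: ge_ereal_sup => _ [x Kx <-]; exact/ltW/ht.
by rewrite Ss lee_fin; lra.
Qed.

End Semicontinuity.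

Section Derivability.
Context {R : realType}.
Local Notation C := R[i].
Lemma eps_derivable (V : normedModType C) (f : C -> V) (z : C) (L : V) :
  (forall e : R, 0 < e -> exists2 d : R, 0 < d &
    forall w, nm (w - z) < d -> nm (f w - f z - (w - z) *: L) <= e * nm (w - z)) ->
  derivable f z 1.
Proof.
move=> h; apply/cvg_ex; exists L; apply/cvg_nmP => e e0.
have e2 : 0 < e / 2 by lra.
have [d d0 hd] := h _ e2.
have : \forall t \near (0 : C), nm t < d.
  by apply: filterS (near_nm (0 : C) d0) => t; rewrite subr0.
apply: filterS => t td t0 /=.
have -> : t *: (1 : C) + z = t + z by rewrite [_ *: _]mulr1.
have := hd (t + z); rewrite addrK => /(_ td) ht.
have n0 : 0 < nm t.
  by rewrite lt_neqAle nm_ge0 andbT eq_sym; apply: contra t0 => /eqP/nm_eq0 ->.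
have -> : t^-1 *: (f (t + z) - f z) - L = t^-1 *: (f (t + z) - f z - t *: L).
  by rewrite [RHS]scalerBr scalerA mulVf// scale1r.
rewrite nmZ nmV mulrC ltr_pdivrMr//; apply: le_lt_trans ht _.
by rewrite ltr_pM2r//; lra.
Qed.

Lemma bounded_linear_derivable (V U : normedModType C) (f : C -> V) (z : C)
    (A : {linear V -> U}) (B : R) :
  (forall v, nm (A v) <= B * nm v) -> derivable f z 1 ->
  derivable (fun w => A (f w)) z 1.
Proof.
move=> hB df; have [L hL] := derivable_eps df; apply: (@eps_derivable _ _ _ (A L)) => e e0.
have B1 : 0 < `|B| + 1 by rewrite ltr_wpDl.
have e1 : 0 < e / (`|B| + 1) by rewrite divr_gt0.
have [d d0 hd] := hL _ e1; exists d => // w wz.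
rewrite -linearZ -!linearB; apply: le_trans (hB _) _.
apply: (@le_trans _ _ ((`|B| + 1) * nm (f w - f z - (w - z) *: L))).
  by rewrite ler_wpM2r ?nm_ge0//; have := ler_norm B; lra.
by rewrite -ler_pdivlMl// mulrA (mulrC _ e); exact: hd.
Qed.

Lemma bounded_linear_continuous (V U : normedModType C) (A : {linear V -> U}) (B : R) :
  (forall v, nm (A v) <= B * nm v) -> continuous A.
Proof.
move=> hB v; apply/cont_nmP => e e0.
have B1 : 0 < `|B| + 1 by rewrite ltr_wpDl.
have e1 : 0 < e / (`|B| + 1) by rewrite divr_gt0.
apply: filterS (near_nm v e1) => w wv; rewrite -linearB; apply: le_lt_trans (hB _) _.
apply: (@le_lt_trans _ _ ((`|B| + 1) * nm (w - v))).
  by rewrite ler_wpM2r ?nm_ge0//; have := ler_norm B; lra.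
by rewrite -ltr_pdivlMl// mulrC.
Qed.

End Derivability.

(** * The Hermitian product and the squared Euclidean norm *)

Section Pairing.
Context {R : realType} {n : nat}.
Local Notation C := R[i].
Local Notation Cn := 'rV[C]_n.
Implicit Types y v w : Cn.

(** [nm] on rows is the maximum norm. The maximum argument below needs a norm whose square expands
    as in [sqnB], with a cross term that is the real part of a complex linear function of [v]. *)
Definition dotp y v : C := \sum_i conjc (y 0 i) * v 0 i.

Definition sqn v : R := \sum_i nm (v 0 i) ^+ 2.

Lemma dotp_is_linear y : linear (dotp y : Cn -> C).
Proof.
move=> k v w; rewrite /dotp scaler_sumr -big_split /=; apply: eq_bigr => i _.
by rewrite !mxE mulrDr; congr (_ + _); exact: mulrCA.
Qed.

HB.instance Definition _ y := GRing.isLinear.Build C Cn C *:%R (dotp y) (dotp_is_linear y).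

Lemma dotp_bound y v : nm (dotp y v) <= (\sum_i nm (y 0 i)) * nm v.
Proof.
apply: (le_trans (nm_sum _ _ _)); rewrite mulr_suml; apply: ler_sum => i _.
have -> : nm (conjc (y 0 i) * v 0 i) = nm (y 0 i) * nm (v 0 i).
  by rewrite nmM /nm normcJ.
by rewrite ler_wpM2l ?nm_ge0// nm_entry.
Qed.

Lemma sqnB y v : sqn (y - v) = sqn y - 2 * Re (dotp y v) + sqn v.
Proof.
rewrite /sqn /dotp raddf_sum mulr_sumr -sumrB -big_split /=; apply: eq_bigr => i _.
rewrite !mxE !nm2E; case: (y 0 i) => a b; case: (v 0 i) => c d /=; ring.
Qed.

Lemma sqn_le v : sqn v <= n%:R * nm v ^+ 2.
Proof.
apply: (@le_trans _ _ (\sum_(i < n) nm v ^+ 2)).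
  by apply: ler_sum => i _; rewrite lerXn2r ?nnegrE ?nm_ge0// nm_entry.
by rewrite sumr_const card_ord mulr_natl.
Qed.

Lemma nm_le_sqn v : nm v ^+ 2 <= sqn v.
Proof.
have [v0|/nm_entry_attained[i ->]] := eqVneq (nm v) 0.
  by rewrite v0 expr0n /= sumr_ge0// => i _; rewrite sqr_ge0.
by rewrite /sqn (bigD1 i)//= lerDl sumr_ge0// => j _; rewrite sqr_ge0.
Qed.

Lemma sqn_continuous : continuous (sqn : Cn -> R).
Proof.
move=> v; apply: cont_real => e e0.
pose B := \sum_i nm (v 0 i).
have B0 : 0 <= B by apply: sumr_ge0 => i _; exact: nm_ge0.
have nn : (0 : R) <= n%:R by rewrite ler0n.
pose d := Num.min 1 (e / (2 * B + n%:R + 1)).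
have D0 : 0 < 2 * B + n%:R + 1 by lra.
have d0 : 0 < d by rewrite lt_min ltr01 divr_gt0.
apply: filterS (near_nm v d0) => w wv.
have [w1 w2] : nm (w - v) < 1 /\ nm (w - v) < e / (2 * B + n%:R + 1).
  by move: wv; rewrite lt_min => /andP[].
have n0 := nm_ge0 (w - v).
have -> : sqn w = sqn v - 2 * Re (dotp v (v - w)) + sqn (v - w).
  by rewrite -sqnB opprB addrC subrK.
have h1 := dotp_bound v (v - w); rewrite -/B (nmBC v w) in h1.
have h2 := sqn_le (v - w); rewrite (nmBC v w) in h2.
have h3 := normRe_le_nm (dotp v (v - w)).
have h4 : 0 <= sqn (v - w) by apply: sumr_ge0 => i _; exact: sqr_ge0.
have h5 : n%:R * nm (w - v) ^+ 2 <= n%:R * nm (w - v) by rewrite ler_wpM2l// expr2; nra.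
have h6 : nm (w - v) * (2 * B + n%:R + 1) < e by rewrite -ltr_pdivlMr.
have h7 : `|sqn (v - w) - 2 * Re (dotp v (v - w))| <= sqn (v - w) + 2 * `|Re (dotp v (v - w))|.
  by apply: (le_trans (ler_normB _ _)); rewrite normrM (ger0_norm h4) (@ger0_norm _ 2).
rewrite (_ : sqn v - 2 * Re (dotp v (v - w)) + sqn (v - w) - sqn v = sqn (v - w) - 2 * Re (dotp v (v - w))); last by ring.
lra.
Qed.

End Pairing.

Section Comparison.
Context {R : realType} {n : nat}.
Local Notation C := R[i].
Local Notation Cn := 'rV[C]_n.
Local Notation cdisc := [set z : C | nm z <= 1].

(* The submean inequality is only available along complex lines.  If [u (f z)]
   exceeds [Re p] somewhere, maximise
   [u (f z + y) - Re p z - e (1 - |z|^2) - N |y|^2] and move along the tangent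
   line [f z0 + y0 + t f'(z0)], compensating in [y]: the cross term in [|y|^2]
   is the real part of a holomorphic function vanishing at the centre, so the
   mean value property leaves only [- e r^2 + o (r^2)]. *)
Lemma psh_disc_le (X : set Cn) (u : Cn -> \bar R) (f : C -> Cn) (p : {poly C}) :
  open X -> plurisubharmonic X u -> continuous f ->
  (forall z, nm z < 1 -> derivable f z 1) -> (forall z, nm z <= 1 -> X (f z)) ->
  (forall z, circle z -> u (f z) < (Re p.[z])%:E)%E -> (u (f 0%R) <= (Re p.[0%R])%:E)%E.
Proof.
move=> oX [uu psh] cf df fX up; rewrite leNgt; apply/negP => u0.
have [e e0 he] : exists2 e : R, 0 < e & ((Re p.[0%R] + e)%:E < u (f 0%R))%E.
  move: u0; case: (u (f 0)) => [r| |] //.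
    by rewrite lte_fin => h; exists ((r - Re p.[0]) / 2); rewrite ?lte_fin; lra.
  by move=> _; exists 1 => //; exact: ltry.
have cRp : continuous (fun z => Re p.[z]) by exact: continuous_Re_poly.
have [|eta1 eta10 hT] := @tube R C Cn circle f
  (fun z x => X x /\ (u x < (Re p.[z])%:E)%E) (@compact_circle R) (fun z _ => cf z).
  move=> z Tz; apply: usc_lt_near => //; [by apply: fX; rewrite Tz|exact: cRp|exact: up].
have [|eta2 eta20 hX] := @tube R C Cn cdisc f
  (fun z x => X x) (@compact_nm_le R 1) (fun z _ => cf z).
  move=> z Dz; exists (setT, X) => [/=|[? ?] [] //].
  by split; [exact: filterT|exact: open_nbhs_nbhs (conj oX (fX z Dz))].
pose eta := Num.min eta1 eta2 / 2.
have [eta0 [etalt1 etalt2]] : 0 < eta /\ eta < eta1 /\ eta < eta2.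
  have m0 : 0 < Num.min eta1 eta2 by rewrite lt_min eta10.
  have m1 : Num.min eta1 eta2 <= eta1 by rewrite ge_min lexx.
  have m2 : Num.min eta1 eta2 <= eta2 by rewrite ge_min lexx orbT.
  by rewrite /eta; split; [|split]; lra.
pose K : set (Cn * C) := [set y | nm y <= eta] `*` cdisc.
have cK : compact K by apply: compact_setX; [exact: compact_nm_le_row|exact: compact_nm_le].
pose a (q : Cn * C) := f q.2 + q.1.
have ca q : {for q, continuous a}.
  apply: cont_add; last exact: cvg_fst.
  by apply: (@cont_comp _ _ _ (snd : Cn * C -> C) f); [exact: cvg_snd|exact: cf].
have aX q : K q -> X (a q).
  move=> [/= q1 q2]; apply: (hX q.2) => //; rewrite /a addrC addKr; lra.
have [M M0 hM] : exists2 M : R, 0 <= M & forall q, K q -> (u (a q) < M%:E)%E.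
  apply: usc_bounded => // q Kq; have [h1 h2] := uu _ (aX q Kq); split => // b hb.
  have h3 : \forall x \near a q, X x by apply: open_nbhs_nbhs; split => //; exact: aX.
  have h4 : \forall q' \near q, X (a q') /\ (X (a q') -> (u (a q') < b%:E)%E).
    exact: (ca q _ (filterI h3 (h2 b hb))).
  by apply: filterS h4 => q' [h5 h6] _; exact: h6.
have [Mp Mp0 hMp] : exists2 M : R, 0 <= M & forall z, cdisc z -> (`|Re p.[z]|%:E < M%:E)%E.
  apply: usc_bounded; first exact: compact_nm_le.
  apply: continuous_usc => z _; apply: (@cont_comp _ _ _ (fun z => Re p.[z]) (@Num.norm R R)).
    exact: cRp.
  exact: norm_continuous.
(* On [|y| = eta] the penalty [N |y|^2] is at least [M + Mp + 1], more than [u - Re p] can reach, so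
   the maximum has [|y0| < eta]. *)
pose N := (M + Mp + 1) / eta ^+ 2.
have N0 : 0 < N by rewrite divr_gt0 ?exprn_gt0//; lra.
pose psi (q : Cn * C) : R := Re p.[q.2] + e * (1 - nm q.2 ^+ 2) + N * sqn q.1.
have cpsi q : {for q, continuous psi}.
  apply: cont_add; first apply: cont_add.
  - by apply: (@cont_comp _ _ _ (snd : Cn * C -> C) (fun z => Re p.[z])); [exact: cvg_snd|exact: cRp].
  - apply: cont_mul; first exact: cont_cst.
    apply: cont_sub; first exact: cont_cst.
    have cn : {for q, continuous (fun q : Cn * C => nm q.2)}.
      by apply: (@cont_comp _ _ _ (snd : Cn * C -> C) (@nm R C)); [exact: cvg_snd|exact: nm_continuous].
    exact: cont_mul.
  - apply: cont_mul; first exact: cont_cst.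
    by apply: (@cont_comp _ _ _ (fst : Cn * C -> Cn) sqn); [exact: cvg_fst|exact: sqn_continuous].
pose g q := (u (a q) - (psi q)%:E)%E.
have gE q b : (g q < b%:E)%E = (u (a q) < (psi q + b)%:E)%E.
  by rewrite /g lteBlDr// addrC EFinD.
have ug : usc_on K g.
  move=> q Kq; split.
    by rewrite /g; have [+ _] := uu _ (aX q Kq); case: (u (a q)) => [x _| |] //; exact: ltry.
  move=> b; rewrite gE => h.
  have h1 : \forall q' \near q & x' \near a q, X x' /\ (u x' < (psi q' + b)%:E)%E.
    apply: (usc_lt_near (q := fun q => psi q + b)) => //; first exact: aX.
    by apply: cont_add; [exact: cpsi|exact: cont_cst].
  have := near_diag (ca q) h1; apply: filterS => q' [_ h2] _; by rewrite gE.
have K0 : K (0, 0) by split; rewrite /= nm0 ?ltW// ler01.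
have [[y0 z0] Kq0 hmax] := usc_max cK (ex_intro _ _ K0) ug.
have g0 : (0 < g (y0, z0))%E.
  apply: lt_le_trans (hmax _ K0); rewrite /g sube_gt0 /psi /a /= addr0.
  have -> : sqn (0 : Cn) = 0.
    by apply/eqP; rewrite eq_le sumr_ge0 ?andbT; [have := sqn_le (0 : Cn); rewrite nm0 expr0n/= mulr0|move=> i _; rewrite sqr_ge0].
  by rewrite nm0 expr0n/= subr0 !mulr1 mulr0 addr0.
have ug0 : ((psi (y0, z0))%:E < u (a (y0, z0)))%E.
  by move: g0; rewrite /g sube_gt0.
have [ny0 nz0] := Kq0; rewrite /= in ny0 nz0.
have y0lt : nm y0 < eta.
  rewrite lt_neqAle ny0 andbT; apply/negP => /eqP yeta.
  have := lt_trans ug0 (hM _ Kq0); rewrite lte_fin /psi /= ltNge => /negP; apply.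
  have h1 : M + Mp + 1 <= N * sqn y0.
    rewrite /N mulrAC ler_pdivlMr ?exprn_gt0// ler_pM2l; last by lra.
    by rewrite -yeta; exact: nm_le_sqn.
  have := hMp z0 nz0; rewrite lte_fin ltr_norml => /andP[h2 _].
  have h3 : 0 <= e * (1 - nm z0 ^+ 2).
    by rewrite mulr_ge0 ?(ltW e0)// subr_ge0 exprn_ile1// nm_ge0.
  lra.
(* For [z] on the circle, [u] is below [Re p] throughout the tube around [f z], so a positive
   maximum cannot occur there. *)
have z0lt : nm z0 < 1.
  rewrite lt_neqAle nz0 andbT; apply/negP => /eqP z1.
  have [_ h] : X (a (y0, z0)) /\ (u (a (y0, z0)) < (Re p.[z0])%:E)%E.
    by apply: (hT z0) => //; rewrite /a /= addrC addKr; lra.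
  have := lt_trans ug0 h; rewrite lte_fin /psi /= z1 expr1n subrr mulr0 addr0 ltNge => /negP; apply.
  by rewrite lerDl mulr_ge0 ?(ltW N0)// sumr_ge0// => i _; rewrite sqr_ge0.
have [U hU] : exists U : R, u (a (y0, z0)) = U%:E.
  have [+ _] := uu _ (aX _ Kq0); move: ug0.
  by case: (u (a (y0, z0))) => [U _ _| |] //; exists U.
have [L hL] := derivable_eps (df z0 z0lt).
pose h (t : C) := f (z0 + t) - f z0 - t *: L.
have nn : (0 : R) <= n%:R by rewrite ler0n.
(* With [|h t| <= k |t|], the term [N sqn (h t)] is at most [N n k^2 |t|^2], hence at most half of
   the gain [e |t|^2]. The cap at 1 keeps [y0 - h t] in the ball of radius [eta]. *)
pose k := Num.min 1 (e / (2 * (N * n%:R + 1))).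
have Nn0 : 0 < N * n%:R + 1 by rewrite ltr_wpDl// mulr_ge0// ltW.
have k0 : 0 < k by rewrite lt_min ltr01 divr_gt0// mulr_gt0.
have [k1 k2] : k <= 1 /\ N * n%:R * k <= e / 2.
  split; first by rewrite /k ge_min lexx.
  apply: (@le_trans _ _ ((N * n%:R + 1) * (e / (2 * (N * n%:R + 1))))).
    apply: ler_pM => //; first by rewrite mulr_ge0// ltW.
    - exact: ltW.
    - by rewrite lerDl.
    - by rewrite /k ge_min lexx orbT.
  by rewrite le_eqVlt; apply/orP; left; apply/eqP; field; rewrite gt_eqF.
have [d d0 hd] := hL k k0.
pose r := Num.min (d / 2) (Num.min ((1 - nm z0) / 2) ((eta - nm y0) / 2)).
have [r0 [rd [rz ry]]] : 0 < r /\ r < d /\ r < 1 - nm z0 /\ r < eta - nm y0.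
  split; first by rewrite !lt_min; apply/andP; split; [lra|apply/andP; split; lra].
  by split; [|split]; rewrite /r !gt_min; apply/orP; [left|right; apply/orP; left|right; apply/orP; right]; lra.
clearbody r k.
have ht t : nm t <= r -> nm (h t) <= k * nm t.
  move=> tr; have := hd (z0 + t); rewrite (addrC z0 t) addrK => /(_ (le_lt_trans tr rd)).
  by rewrite /h (addrC z0).
(* Subtracting the remainder [h t] from [y0] makes [a (q t)] affine in [t], so that the submean
   inequality applies along this curve. *)
pose q t : Cn * C := (y0 - h t, z0 + t).
have aq t : a (q t) = a (y0, z0) + t *: L.
  rewrite /a /q /h /=; rewrite !opprB !addrA.
  by apply/rowP => i; rewrite !mxE; ring.
have Kq t : nm t <= r -> K (q t).
  move=> tr; split => /=.
    have := ht t tr; have := nmD y0 (- h t); rewrite nmN.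
    have : k * nm t <= nm t by rewrite ler_piMl// nm_ge0.
    lra.
  by have := nmD z0 t; lra.
(* Gathers the part of [psi (q t)] that is the real part of a holomorphic function: [p], the linear
   term of [- e |z0 + t|^2], and the cross term of [N |y0 - h t|^2]. Its value at [z0] is
   [p.[z0]]. *)
pose Om (w : C) : C := p.[w] - (2 * e)%:C * (conjc z0 * (w - z0))
   - (2 * N)%:C * (dotp y0 (f w) - dotp y0 (f z0) - (w - z0) * dotp y0 L).
have psiE t : psi (q t) - psi (y0, z0) =
    Re (Om (z0 + t)) - Re p.[z0] - e * nm t ^+ 2 + N * sqn (h t).
  rewrite /psi /q /= sqnB.
  have -> : dotp y0 (h t) = dotp y0 (f (z0 + t)) - dotp y0 (f z0) - t * dotp y0 L.
    by rewrite /h !linearB linearZ.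
  have reM (x : R) (w : C) : Re (x%:C * w) = x * Re w by case: w => b c /=; ring.
  rewrite /Om (addrC z0 t) addrK; set A := dotp _ _ - _ - _.
  move: A p.[t + z0] p.[z0] (sqn (h t)) => A P1 P0 S.
  rewrite !raddfB /= !reM !nm2E; case: (z0) (t) => b c [b' c'] /=; ring.
have bound (t : C) : nm t = r -> (u (a (y0, z0) + t *: L)%R <=
    (Re (Om (z0 + t)) + (U - Re p.[z0] - e / 2 * r ^+ 2))%:E)%E.
  move=> tr; have tr' : nm t <= r by rewrite tr.
  have := hmax _ (Kq t tr'); rewrite /g aq hU leeBlDr// -EFinB -EFinD => /le_trans; apply.
  rewrite lee_fin; have := psiE t; rewrite tr.
  have s1 : N * sqn (h t) <= e / 2 * r ^+ 2.
    apply: (@le_trans _ _ (N * (n%:R * (k * nm t) ^+ 2))).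
      rewrite ler_pM2l//; apply: (le_trans (sqn_le _)); rewrite ler_wpM2l//.
      by rewrite lerXn2r ?nnegrE ?nm_ge0 ?mulr_ge0 ?nm_ge0 ?(ltW k0)//; exact: ht.
    rewrite tr exprMn.
    have -> : N * (n%:R * (k ^+ 2 * r ^+ 2)) = (N * n%:R * k) * (k * r ^+ 2) by ring.
    apply: ler_pM => //; first by apply: mulr_ge0; [apply: mulr_ge0 => //; exact: ltW|exact: ltW].
      by rewrite mulr_ge0 ?(ltW k0)// sqr_ge0.
    by rewrite ler_piMl ?sqr_ge0.
  lra.
have bd := dotp_bound y0.
have cOm w : {for w, continuous Om}.
  rewrite /Om; apply: cont_sub; first apply: cont_sub.
  - exact: continuous_poly.
  - apply: cont_mul; first exact: cont_cst.
    apply: cont_mul; first exact: cont_cst.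
    by apply: cont_sub; [exact: cont_id|exact: cont_cst].
  - apply: cont_mul; first exact: cont_cst.
    apply: cont_sub; first apply: cont_sub.
    + apply: (@cont_comp _ _ _ f (dotp y0)); first exact: cf.
      exact: (bounded_linear_continuous bd).
    + exact: cont_cst.
    + apply: cont_mul; last exact: cont_cst.
      by apply: cont_sub; [exact: cont_id|exact: cont_cst].
have dOm w : nm (w - z0) < 1 - nm z0 -> derivable Om w 1.
  move=> wz; have wlt : nm w < 1 by have := nmD (w - z0) z0; rewrite subrK; lra.
  have dlin (b : C) : derivable (fun w : C => b * (w - z0)) w 1.
    apply: (@derivableM C C); first exact: derivable_cst.
    by apply: derivableB; [exact: derivable_id|exact: derivable_cst].
  apply: derivableB; first apply: derivableB.
  - exact: derivable_poly.
  - by apply: (@derivableM C C); [exact: derivable_cst|exact: dlin].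
  - apply: (@derivableM C C); first exact: derivable_cst.
    apply: derivableB; first apply: derivableB.
    + exact: (bounded_linear_derivable bd (df w wlt)).
    + exact: derivable_cst.
    + apply: (@derivableM C C); last exact: derivable_cst.
      by apply: derivableB; [exact: derivable_id|exact: derivable_cst].
have mean := holomorphic_mean r0 rz cOm dOm.
have [_ sub] := psh (a (y0, z0)) L.
have rT (z : C) : nm z <= 1 -> nm (r%:C * z) <= r.
  by move=> z1; rewrite nmM nm_real gtr0_norm// ler_piMr// ltW.
have inX (z : C) : nm z <= 1 -> X (a (y0, z0) + (r%:C * z) *: L).
  by move=> z1; rewrite -aq; exact/aX/Kq/rT.
have := sub 0 r r0; rewrite scale0r addr0 hU.
move=> /(_ _); rewrite leNgt.
have -> : (fun z => u (a (y0, z0) + (0 + r%:C * z) *: L)) =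
    (fun z => u (a (y0, z0) + (r%:C * z) *: L)).
  by apply/funext => z; rewrite add0r.
move=> /(_ _)/negP; apply; first by move=> z; rewrite le_nm1 add0r; exact: inX.
pose F (z : C) : R := Re (Om (z0 + r%:C * z)) + (U - Re p.[z0] - e / 2 * r ^+ 2).
have cR : continuous (fun z : C => Re (Om (z0 + r%:C * z))).
  move=> z; apply: (@cont_comp _ _ _ (fun z : C => Om (z0 + r%:C * z)) (@Re R)); last exact: Re_continuous.
  apply: (@cont_comp _ _ _ (fun z : C => z0 + r%:C * z) Om); last exact: cOm.
  by apply: cont_add; [exact: cont_cst|apply: cont_mul; [exact: cont_cst|exact: cont_id]].
have cF z : {for z, continuous F}.
  by rewrite /F; apply: cont_add; [exact: cR|exact: cont_cst].
apply: (@le_lt_trans _ _ (circle_mean (fun z => (F z)%:E))).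
  apply: circle_mean_le.
  - move=> z Tz; have z1 : nm z <= 1 by rewrite Tz.
    have [h1 h2] := uu _ (inX z z1); split => // b hb.
    have cl : {for z, continuous (fun z : C => a (y0, z0) + (r%:C * z) *: L)}.
      apply: cont_add; first exact: cont_cst.
      apply: cont_scale; last exact: cont_cst.
      by apply: cont_mul; [exact: cont_cst|exact: cont_id].
    have h3 : \forall x \near (a (y0, z0) + (r%:C * z) *: L), X x.
      by apply: open_nbhs_nbhs; split => //; exact: inX.
    have h4 : \forall w \near z, circle w ->
        (u (a (y0, z0) + (r%:C * w) *: L)%R < b%:E)%E.
      have h5 : \forall w \near z, X (a (y0, z0) + (r%:C * w) *: L) /\
          (X (a (y0, z0) + (r%:C * w) *: L) ->
           (u (a (y0, z0) + (r%:C * w) *: L)%R < b%:E)%E).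
        exact: (cl _ (filterI h3 (h2 b hb))).
      by apply: filterS h5 => w [h6 h7] _; exact: h7.
    exact: h4.
  - by apply: continuous_usc => z _; exact: cF.
  - move=> z Tz; apply: bound; by rewrite nmM nm_real gtr0_norm// Tz mulr1.
rewrite circle_mean_real; last first.
  by move=> t; apply: (@cont_comp _ _ _ (@expit R) F); [exact: expit_continuous|exact: cF].
rewrite lte_fin real_meanD_cst// mean.
have -> : Om z0 = p.[z0] by rewrite /Om !subrr mul0r !subr0 !mulr0 !subr0.
have : 0 < e / 2 * r ^+ 2 by rewrite mulr_gt0 ?exprn_gt0//; lra.
lra.
Qed.

End Comparison.

(** * Attaching a family of discs to the boundary of a disc *)

Section DerivableOperations.
Context {R : realType}.
Local Notation C := R[i].

Lemma derivable_cont (V : normedModType C) (f : C -> V) (z : C) : derivable f z 1 -> {for z, continuous f}.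
Proof. by move=> df; apply/differentiable_continuous/derivable1_diffP. Qed.

Lemma derivable_compose (V : normedModType C) (f : C -> V) (a : C -> C) (z : C) :
  derivable a z 1 -> derivable f (a z) 1 -> derivable (fun w => f (a w)) z 1.
Proof.
move=> /derivable1_diffP da /derivable1_diffP df; apply/derivable1_diffP.
exact: (differentiable_comp da df).
Qed.

Lemma cont_sum (V : normedModType C) (T : topologicalType) (I : Type) (r : seq I)
    (f : I -> T -> V) (x : T) : (forall i, {for x, continuous (f i)}) ->
  {for x, continuous (fun t => \sum_(i <- r) f i t)}.
Proof.
move=> cf; elim: r => [|i r IH].
  have -> : (fun t => \sum_(i <- [::]) f i t) = (fun=> 0).
    by apply/funext => t; rewrite big_nil.
  exact: cont_cst.
have -> : (fun t => \sum_(j <- i :: r) f j t) = (fun t => f i t + \sum_(j <- r) f j t).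
  by apply/funext => t; rewrite big_cons.
by apply: cont_add; [exact: cf|exact: IH].
Qed.

Lemma usc_comp (T : topologicalType) (V : normedModType C) (K : set T) (X : set V)
    (u : V -> \bar R) (f : T -> V) :
  open X -> usc_on X u -> (forall z, K z -> {for z, continuous f}) ->
  (forall z, K z -> X (f z)) -> usc_on K (fun z => u (f z)).
Proof.
move=> oX uu cf fX z Kz; have [h1 h2] := uu _ (fX z Kz); split => // b hb.
have h3 : \forall x \near f z, X x by apply: open_nbhs_nbhs; split => //; exact: fX.
have h4 : \forall w \near z, X (f w) /\ (X (f w) -> (u (f w) < b%:E)%E).
  exact: (cf z Kz _ (filterI h3 (h2 b hb))).
have h5 : \forall w \near z, K w -> (u (f w) < b%:E)%E.
  by apply: filterS h4 => w [h6 h7] _; exact: h7.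
exact: h5.
Qed.

Lemma derivable_scale n (k : C -> C) (f : C -> 'rV[C]_n) (z : C) :
  derivable k z 1 -> derivable f z 1 -> derivable (fun w => k w *: f w) z 1.
Proof.
move=> dk df; have [k' hk] := derivable_eps dk; have [f' hf] := derivable_eps df.
apply: (@eps_derivable _ _ _ _ (k' *: f z + k z *: f')) => e e0.
have a0 : 0 < 3 * (nm (f z) + 1) by have := nm_ge0 (f z); lra.
have b0 : 0 < 3 * (nm (k z) + 1) by have := nm_ge0 (k z); lra.
have c0 : 0 < 3 * (nm k' + 1) by have := nm_ge0 k'; lra.
have [d1 d10 h1] := hk _ (divr_gt0 e0 a0).
have [d2 d20 h2] := hf _ (divr_gt0 e0 b0).
have [d3 d30 h3] := hk 1 ltr01.
have /cont_nmP/(_ _ (divr_gt0 e0 c0))/nbhs_nmP[d4 d40 h4] := derivable_cont df.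
exists (Num.min (Num.min d1 d2) (Num.min d3 d4)); first by rewrite !lt_min d10 d20 d30.
move=> w; rewrite !lt_min => /andP[/andP[/h1 {}h1 /h2 {}h2] /andP[/h3 {}h3 /h4 {}h4]].
have -> : k w *: f w - k z *: f z - (w - z) *: (k' *: f z + k z *: f') =
    (k w - k z - (w - z) * k') *: f z + k z *: (f w - f z - (w - z) *: f') +
    (k w - k z) *: (f w - f z).
  by apply/rowP => i; rewrite !mxE; ring.
have r0 := nm_ge0 (w - z).
have E a b : 0 <= a -> a <= b -> 0 < b -> forall x, x <= e / (3 * b) * nm (w - z) ->
    x * a <= e / 3 * nm (w - z).
  move=> a0' ab b0' x xb; apply: (@le_trans _ _ (e / (3 * b) * nm (w - z) * a)).
    by rewrite ler_wpM2r.
  have -> : e / 3 * nm (w - z) = e / (3 * b) * nm (w - z) * b by field; rewrite gt_eqF.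
  by rewrite ler_wpM2l// mulr_ge0// divr_ge0 ?(ltW e0)// mulr_ge0// ltW.
have f0 := nm_ge0 (f z); have kz0 := nm_ge0 (k z); have k'0 := nm_ge0 k'.
apply: (le_trans (nmD _ _)).
have t1 : nm ((k w - k z - (w - z) * k') *: f z) <= e / 3 * nm (w - z).
  by rewrite nmZ; apply: (E _ (nm (f z) + 1)) => //; lra.
have t2 : nm (k z *: (f w - f z - (w - z) *: f')) <= e / 3 * nm (w - z).
  by rewrite nmZ mulrC; apply: (E _ (nm (k z) + 1)) => //; lra.
have t3 : nm ((k w - k z) *: (f w - f z)) <= e / 3 * nm (w - z).
  rewrite nmZ.
  have kk : nm (k w - k z) <= (nm k' + 1) * nm (w - z).
    have := nmD (k w - k z - (w - z) * k') ((w - z) * k'); rewrite subrK nmM.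
    move: h3; rewrite mul1r => h3; lra.
  apply: (@le_trans _ _ ((nm k' + 1) * nm (w - z) * (e / (3 * (nm k' + 1))))).
    by apply: ler_pM => //; [exact: nm_ge0|exact: nm_ge0|exact: ltW].
  by rewrite le_eqVlt; apply/orP; left; apply/eqP; field; rewrite gt_eqF//; lra.
have := nmD ((k w - k z - (w - z) * k') *: f z) (k z *: (f w - f z - (w - z) *: f')).
lra.
Qed.

End DerivableOperations.

Section Discs.
Context {R : realType} {n : nat}.
Local Notation C := R[i].
Local Notation Cn := 'rV[C]_n.
Local Notation cdisc := [set z : C | nm z <= 1].
Implicit Types (X W : set Cn) (f h : C -> Cn) (z : C).

(* Analytic discs as continuous maps on the whole plane; only the values on the
   closed disc matter. *)
Definition holodisc X W f : Prop :=
  [/\ continuous f, forall z, nm z < 1 -> derivable f z 1,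
      forall z, nm z <= 1 -> X (f z) & forall z, nm z = 1 -> W (f z)].

(** A Schwarz-type bound: differentiability gives it for [|z| < d], and for [|z| >= d] the maximum
    [M] of [|f|] is at most [(M / d) |z|]. *)
Lemma disc_linear_bound f : continuous f -> derivable f 0 1 -> f 0 = 0 ->
  exists2 B : R, 0 <= B & forall z, nm z <= 1 -> nm (f z) <= B * nm z.
Proof.
move=> cf df f0; have [L hL] := derivable_eps df.
have [d d0 hd] := hL 1 ltr01.
have cnf : continuous (fun z => nm (f z)).
  by move=> z; apply: (@cont_comp _ _ _ f (@nm R Cn)); [exact: cf|exact: nm_continuous].
have [M M0 hM] := usc_bounded (@compact_nm_le R 1) (continuous_usc (fun z _ => cnf z)).
exists (1 + nm L + M / d); first by rewrite !addr_ge0 ?nm_ge0 ?divr_ge0// ltW.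
move=> z z1; have z0 := nm_ge0 z; have L0 := nm_ge0 L.
have Md : 0 <= M / d by rewrite divr_ge0// ltW.
have [zd|dz] := ltP (nm z) d.
  have := hd z; rewrite !subr0 f0 subr0 => /(_ zd) h.
  have := nmD (f z - z *: L) (z *: L); rewrite subrK nmZ.
  have : 0 <= M / d * nm z by rewrite mulr_ge0.
  lra.
have := hM z z1; rewrite lte_fin => h.
have h2 : M <= M / d * nm z by rewrite mulrAC ler_pdivlMr// ler_wpM2l.
have : 0 <= (1 + nm L) * nm z by rewrite mulr_ge0//; lra.
lra.
Qed.

Lemma nm_expr_le1 z k : nm z <= 1 -> nm (z ^+ k) <= 1.
Proof. by move=> z1; rewrite nmX exprn_ile1// nm_ge0. Qed.

(* [z^-m f (u z^N)] vanishes to second order at [0] when [f 0 = 0]. *)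
Definition corr (m N : nat) (u : C) f z : Cn := z^-1 ^+ m *: f (u * z ^+ N).

Lemma corr0 m N u f : (0 < N)%N -> f 0 = 0 -> corr m N u f 0 = 0.
Proof.
by move=> N0 f0; rewrite /corr expr0n (_ : (N == 0%N) = false) ?mulr0 ?f0 ?scaler0//; lia.
Qed.

Lemma corr_bound m N u f (B : R) z : nm u = 1 -> (m < N)%N -> nm z <= 1 ->
  (forall w, nm w <= 1 -> nm (f w) <= B * nm w) ->
  nm (corr m N u f z) <= B * nm z ^+ (N - m).
Proof.
move=> u1 mN z1 hf; rewrite /corr nmZ.
have [->|z0] := eqVneq z 0.
  rewrite !expr0n; have -> : (N == 0%N) = false by lia.
  have h := hf 0; rewrite nm0 ler01 mulr0 in h; have {}h := h isT.
  have e : nm (f 0) = 0 by apply/eqP; rewrite eq_le h nm_ge0.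
  rewrite mulr0 e mulr0 nm0 expr0n; have -> : ((N - m)%N == 0%N) = false by lia.
  by rewrite mulr0.
have n0 : 0 < nm z.
  by rewrite lt_neqAle nm_ge0 andbT eq_sym; apply: contra z0 => /eqP/nm_eq0 ->.
have h := hf (u * z ^+ N); rewrite nmM u1 mul1r nm_expr_le1// in h.
have {}h := h isT.
have -> : B * nm z ^+ (N - m) = nm (z^-1 ^+ m) * (B * nm (z ^+ N)).
  have -> : nm (z ^+ N) = nm z ^+ (N - m) * nm z ^+ m.
    by rewrite nmX -exprD subnK// ltnW.
  by rewrite nmX nmV exprVn; field; rewrite expf_neq0// gt_eqF.
by rewrite ler_wpM2l ?nm_ge0.
Qed.

(** At 0, where the inverse is 0 by convention, [corr] vanishes and is bounded by a multiple of
    [|z|^(N - m)] with [N - m >= 2], so its derivative is 0. Elsewhere the product rule applies. *)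
Lemma corr_derivable m N u f z : nm u = 1 -> (m.+2 <= N)%N -> continuous f ->
  (forall z, nm z < 1 -> derivable f z 1) -> f 0 = 0 -> nm z < 1 ->
  derivable (corr m N u f) z 1.
Proof.
move=> u1 mN cf df f0 z1.
have [->|z0] := eqVneq z 0.
  have d0 : derivable f 0 1 by apply: df; rewrite nm0.
  have [B B0 hB] := disc_linear_bound cf d0 f0.
  apply: (@eps_derivable _ _ _ _ 0) => e e0.
  have B1 : 0 < B + 1 by lra.
  exists (Num.min 1 (e / (B + 1))); first by rewrite lt_min ltr01 divr_gt0.
  move=> w; rewrite subr0 scaler0 subr0 lt_min => /andP[w1 we].
  rewrite corr0 ?f0//; last by lia.
  rewrite subr0; have mN' : (m < N)%N by lia.
  apply: (le_trans (corr_bound u1 mN' (ltW w1) hB)).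
  have wn := nm_ge0 w.
  have h1 : nm w ^+ (N - m) <= nm w * nm w.
    rewrite (_ : (N - m = (N - m - 2) + 2)%N); last by lia.
    rewrite exprD -expr2 ler_piMl ?sqr_ge0// exprn_ile1// ltW//.
  apply: (@le_trans _ _ (B * (nm w * nm w))); first by rewrite ler_wpM2l.
  rewrite mulrA ler_wpM2r//; move: we; rewrite ltr_pdivlMr// => we; nra.
apply: derivable_scale.
  have -> : (fun w : C => w^-1 ^+ m) = (fun w => ('X^m).[w]^-1).
    by apply/funext => w; rewrite hornerXn exprVn.
  apply: derivableV; last exact: derivable_poly.
  by rewrite hornerXn expf_neq0.
apply: (@derivable_compose _ _ f (fun w : C => u * w ^+ N)).
  have -> : (fun w : C => u * w ^+ N) = (fun w => (u *: 'X^N).[w]).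
    by apply/funext => w; rewrite hornerZ hornerXn.
  exact: derivable_poly.
apply: df; rewrite nmM u1 mul1r nmX exprn_ilt1 ?nm_ge0//; lia.
Qed.

Lemma corr_continuous m N u f : nm u = 1 -> (m.+2 <= N)%N -> continuous f ->
  (forall z, nm z < 1 -> derivable f z 1) -> f 0 = 0 -> continuous (corr m N u f).
Proof.
move=> u1 mN cf df f0 z; have [->|z0] := eqVneq z 0.
  apply: derivable_cont; apply: corr_derivable => //; by rewrite nm0.
suff : {for z, continuous (fun w : C => w^-1 ^+ m *: f (u * w ^+ N))} by [].
apply: cont_scale; last first.
  apply: (@cont_comp _ _ _ (fun w : C => u * w ^+ N) f); last exact: cf.
  apply: derivable_cont; have -> : (fun w : C => u * w ^+ N) = (fun w => (u *: 'X^N).[w]).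
    by apply/funext => w; rewrite hornerZ hornerXn.
  exact: derivable_poly.
apply: derivable_cont.
have -> : (fun w : C => w^-1 ^+ m) = (fun w => ('X^m).[w]^-1).
  by apply/funext => w; rewrite hornerXn exprVn.
apply: derivableV; last exact: derivable_poly.
by rewrite hornerXn expf_neq0.
Qed.

Lemma expit_eq (s t : R) : 0 <= s <= 2 * pi -> 0 <= t <= 2 * pi ->
  expit s = expit t :> C -> s <= t -> s = t \/ (s = 0 /\ t = 2 * pi).
Proof.
move=> /andP[s0 s1] /andP[t0 t1] st sle.
have [h|h] := ltP (t - s) (2 * pi); last by right; split; lra.
left; apply/eqP; rewrite eq_sym -subr_eq0; apply/eqP/expit_eq1.
  by rewrite subr_ge0 sle.
by apply: (mulfI (expit_neq0 s)); rewrite -expitD mulr1 addrC subrK.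
Qed.

Local Notation per := ([set` `[0%R, (2 * pi)%R]] : set R).

(** Uniform continuity measured by the chord [|e^is - e^it|], for a [G] that descends to the circle.
    Near a triple with [e^is <> e^it] the chord stays bounded below and a small [d] makes the claim
    void; otherwise [s = t] or both are endpoints, and [G s w = G t w]. *)
Lemma circle_uniform (G : R -> C -> Cn) (e : R) :
  continuous (fun q : R * C => G q.1 q.2) ->
  (forall w, nm w <= 1 -> G 0 w = G (2 * pi) w) -> 0 < e ->
  exists2 d : R, 0 < d & forall s t w, 0 <= s <= 2 * pi -> 0 <= t <= 2 * pi ->
    nm w <= 1 -> nm (expit s - expit t : C) < d -> nm (G s w - G t w) <= e.
Proof.
move=> cG Gper e0.
pose Y := (R * R * C)%type; pose K : set Y := per `*` per `*` cdisc.
have cK : compact K.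
  apply: compact_setX; last exact: compact_nm_le.
  by apply: compact_setX; exact: segment_compact.
move/compact_near_coveringP/near_covering_withinP : cK => cK.
have e2 : 0 < e / 2 by lra.
have cE (y : Y) : {for y, continuous (fun y : Y => expit y.1.1 - expit y.1.2 : C)}.
  have c1 : {for y, continuous (fun y : Y => y.1.1)}.
    by apply: (@cont_comp _ _ _ (fst : Y -> R * R) (fst : R * R -> R)); exact: cvg_fst.
  have c2 : {for y, continuous (fun y : Y => y.1.2)}.
    by apply: (@cont_comp _ _ _ (fst : Y -> R * R) (snd : R * R -> R)); [exact: cvg_fst|exact: cvg_snd].
  apply: cont_sub.
    by apply: (@cont_comp _ _ _ (fun y : Y => y.1.1) (@expit R)); [exact: c1|exact: expit_continuous].
  by apply: (@cont_comp _ _ _ (fun y : Y => y.1.2) (@expit R)); [exact: c2|exact: expit_continuous].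
have cD (y : Y) : {for y, continuous (fun y : Y => G y.1.1 y.2 - G y.1.2 y.2)}.
  have c1 : {for y, continuous (fun y : Y => y.1.1)}.
    by apply: (@cont_comp _ _ _ (fst : Y -> R * R) (fst : R * R -> R)); exact: cvg_fst.
  have c2 : {for y, continuous (fun y : Y => y.1.2)}.
    by apply: (@cont_comp _ _ _ (fst : Y -> R * R) (snd : R * R -> R)); [exact: cvg_fst|exact: cvg_snd].
  have c3 : {for y, continuous (snd : Y -> C)} by exact: cvg_snd.
  apply: cont_sub.
    apply: (@cont_comp _ _ _ (fun y : Y => (y.1.1, y.2)) (fun q : R * C => G q.1 q.2)); last exact: cG.
    exact: cont_pair c1 c3.
  apply: (@cont_comp _ _ _ (fun y : Y => (y.1.2, y.2)) (fun q : R * C => G q.1 q.2)); last exact: cG.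
  exact: cont_pair c2 c3.
have := cK R (0 : R)^'+ (fun d (y : Y) =>
  nm (expit y.1.1 - expit y.1.2 : C) < d -> nm (G y.1.1 y.2 - G y.1.2 y.2) <= e) _ _.
case.
  move=> y [[/= y1 y2] y3].
  have [E|E] := eqVneq (expit y.1.1 : C) (expit y.1.2).
    have G0 : G y.1.1 y.2 - G y.1.2 y.2 = 0.
      move: y1 y2; rewrite !in_itv /= => y1 y2.
      have [le|/ltW le] := leP y.1.1 y.1.2.
        have [->|[-> ->]] := expit_eq y1 y2 E le; first by rewrite subrr.
        by rewrite Gper// subrr.
      have [->|[-> ->]] := expit_eq y2 y1 (esym E) le; first by rewrite subrr.
      by rewrite Gper// subrr.
    have /cont_nmP/(_ _ e2) h := cD y.
    exists ([set y' : Y | nm (G y'.1.1 y'.2 - G y'.1.2 y'.2) < e / 2], setT) => /=.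
      split; last exact: filterT.
      by apply: filterS h => y'; rewrite G0 subr0.
    by move=> [y' d] [/= h1 _] _ _; rewrite (le_trans (ltW h1))//; lra.
  have n0 : 0 < nm (expit y.1.1 - expit y.1.2 : C).
    rewrite lt_neqAle nm_ge0 andbT eq_sym; apply: contra E => /eqP/nm_eq0/eqP.
    by rewrite subr_eq0.
  have n2 : 0 < nm (expit y.1.1 - expit y.1.2 : C) / 2 by lra.
  have /cont_nmP/(_ _ n2) h := cE y.
  exists ([set y' : Y | nm ((expit y'.1.1 - expit y'.1.2) - (expit y.1.1 - expit y.1.2) : C) < nm (expit y.1.1 - expit y.1.2 : C) / 2],
    [set d : R | d < nm (expit y.1.1 - expit y.1.2 : C) / 2]) => /=.
    split; first exact: h.
    exact: nbhs_right_lt.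
  move=> [y' d] [/= h1 h2] _ h3; exfalso.
  have := nm_triangle (expit y.1.1 - expit y.1.2 : C) (expit y'.1.1 - expit y'.1.2) 0.
  by rewrite !subr0 nmBC; lra.
move=> d /= d0 hd; have d20 : 0 < d / 2 by lra.
exists (d / 2) => // s t w hs ht hw hst.
have db : ball 0 d (d / 2) by rewrite -ball_normE /= sub0r normrN gtr0_norm//; lra.
by apply: (hd (d / 2) db d20 ((s, t), w)) => //; split => //; split => /=; rewrite in_itv.
Qed.

(* The disc [z |-> h z + sum_j k_j z (F (tau j) (u z^N) - F (tau j) 0)], with
   [k_j] the weights of [trig_partition], follows [F t (u z^N)] on the circle
   [z = e^it] and stays near [h] inside. *)
Lemma attach_discs X W phi h (F : R -> C -> Cn) (P : {poly C}) (eta a : R) (dg : nat) :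
  open X -> open W -> W `<=` X -> usc_on W phi -> holodisc X X h ->
  continuous (fun q : R * C => F q.1 q.2) ->
  (forall t, 0 <= t <= 2 * pi -> holodisc X W (F t) /\ F t 0 = h (expit t)) ->
  (forall w, nm w <= 1 -> F 0 w = F (2 * pi) w) -> 0 < eta ->
  (forall t, 0 <= t <= 2 * pi -> exists p : {poly C},
     [/\ (size p <= dg)%N, Re p.[0] <= Re P.[expit t] &
      forall w x, circle w -> nm (x - F t w) < eta ->
        W x /\ (phi x < (Re p.[w])%:E)%E]) ->
  Re P.[0] < a ->
  exists k, [/\ holodisc X W k, k 0 = h 0 & (circle_mean (fun z => phi (k z)) < a%:E)%E].
Proof.
move=> oX oW sWX uphi [ch dh hX _] cF dF Fper eta0 hp Pa.
pose Y := (R * C)%type.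
have cperD : compact (per `*` cdisc : set Y).
  by apply: compact_setX; [exact: segment_compact|exact: compact_nm_le].
pose G t w := F t w - F t 0.
have cG : continuous (fun q : Y => G q.1 q.2).
  move=> q; apply: cont_sub; first exact: cF.
  apply: (@cont_comp _ _ _ (fun q : Y => (q.1, 0 : C)) (fun q : Y => F q.1 q.2)); last exact: cF.
  apply: cont_pair; [exact: cvg_fst|exact: cont_cst].
have perP t : per t <-> 0 <= t <= 2 * pi by rewrite /= in_itv.
have [|eta1 eta10 hX1] := @tube R Y Cn (per `*` cdisc) (fun q : Y => F q.1 q.2)
  (fun _ x => X x) cperD (fun q _ => cF q).
  move=> q [/= /perP q1 q2]; exists (setT, X) => [/=|[? ?] [] //].
  split; [exact: filterT|apply: open_nbhs_nbhs; split => //].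
  by have [[_ _ h1 _] _] := dF _ q1; exact: h1.
have [|eta2 eta20 hX2] := @tube R C Cn cdisc h (fun z x => X x) (@compact_nm_le R 1)
  (fun z _ => ch z).
  move=> z Dz; exists (setT, X) => [/=|[? ?] [] //].
  by split; [exact: filterT|exact: open_nbhs_nbhs (conj oX (hX z Dz))].
(* Near a boundary point the new disc differs from [F t] by three errors of at most [e], which must
   stay below [eta1]. On the circle itself one error [e] has to stay below [eta]. *)
pose e := Num.min eta eta1 / 4.
have m0 : 0 < Num.min eta eta1 by rewrite lt_min eta0.
have e0 : 0 < e by rewrite /e; lra.
have [elt1 elt2] : 4 * e <= eta /\ 4 * e <= eta1.
  have l1 : Num.min eta eta1 <= eta by rewrite ge_min lexx.
  have l2 : Num.min eta eta1 <= eta1 by rewrite ge_min lexx orbT.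
  by rewrite /e; split; lra.
clearbody e.
have e20 : 0 < e / 2 by lra.
have Gper w : nm w <= 1 -> G 0 w = G (2 * pi) w.
  by move=> w1; rewrite /G Fper// Fper// nm0 ler01.
have [d d0 hd] := circle_uniform cG Gper e20.
have cnG : continuous (fun q : Y => nm (G q.1 q.2)).
  by move=> q; apply: (@cont_comp _ _ _ (fun q : Y => G q.1 q.2) (@nm R Cn)); [exact: cG|exact: nm_continuous].
have [B B0 hB] := usc_bounded cperD (continuous_usc (fun q _ => cnG q)).
have hB' t w : 0 <= t <= 2 * pi -> nm w <= 1 -> nm (G t w) <= B.
  move=> ht hw; apply: ltW; rewrite -lte_fin; apply: (hB (t, w)).
  by split => //=; exact/perP.
have D0 : 0 < e / (2 * (2 * B + 1)) by rewrite divr_gt0// mulr_gt0//; lra.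
have [M [m [tau [k [S [Pk [htau hk k1 kfar]]]]]]] := trig_partition d0 D0.
have approx t w : 0 <= t <= 2 * pi -> nm w <= 1 ->
    nm (\sum_j (k j (expit t))%:C *: G (tau j) w - G t w) <= e.
  move=> ht hw; have T := nm_expit t.
  apply: le_trans (_ : e / 2 + 2 * B * (e / (2 * (2 * B + 1))) <= _).
    apply: (@partition_approx R Cn M (k^~ (expit t)) (fun j => d <= nm (expit t - expit (tau j) : C))).
    - by move=> j; have [] := hk j _ T.
    - exact: k1.
    - exact: kfar.
    - exact: ltW.
    - by rewrite mulr_ge0.
    - by move=> j fj; apply: hd => //; rewrite nmBC ltNge.
    - move=> j; apply: (le_trans (nmD _ _)); rewrite nmN.
      by have := hB' _ w (htau j) hw; have := hB' _ w ht hw; lra.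
  have -> : 2 * B * (e / (2 * (2 * B + 1))) = e / 2 * (2 * B / (2 * B + 1)) by field; rewrite gt_eqF//; lra.
  have : e / 2 * (2 * B / (2 * B + 1)) <= e / 2.
    by rewrite ler_piMr ?(ltW e20)// ler_pdivrMr; lra.
  lra.
have cGj j : continuous (G (tau j)).
  move=> w; apply: (@cont_comp _ _ _ (fun w : C => (tau j, w)) (fun q : Y => G q.1 q.2)); last exact: cG.
  by apply: cont_pair; [exact: cont_cst|exact: cont_id].
have dGj j z : nm z < 1 -> derivable (G (tau j)) z 1.
  move=> z1; apply: derivableB; last exact: derivable_cst.
  by have [[_ h1 _ _] _] := dF _ (htau j); exact: h1.
have Gj0 j : G (tau j) 0 = 0 by rewrite /G subrr.
have [Bl Bl0 hBl] : exists2 Bl : R, 0 <= Bl & forall j z, nm z <= 1 -> nm (G (tau j) z) <= Bl * nm z.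
  have /choice[b hb] : forall j, exists b : R, 0 <= b /\ forall z, nm z <= 1 -> nm (G (tau j) z) <= b * nm z.
    move=> j; have [|b b0 hb] := disc_linear_bound (cGj j) _ (Gj0 j); last by exists b.
    by apply: dGj; rewrite nm0.
  exists (\sum_j b j); first by apply: sumr_ge0 => j _; case: (hb j).
  move=> j z z1; apply: (le_trans (proj2 (hb j) z z1)); rewrite ler_wpM2r ?nm_ge0//.
  by rewrite (bigD1 j)//= lerDl sumr_ge0// => i _; case: (hb i).
have [Bs Bs0 hBs] : exists2 Bs : R, 0 <= Bs & forall j z, nm z <= 1 -> nm (S j).[z] <= Bs.
  have /choice[b hb] : forall j, exists b : R, 0 <= b /\ forall z, nm z <= 1 -> nm (S j).[z] <= b.
    move=> j; have cn : continuous (fun z => nm (S j).[z]).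
      by move=> z; apply: (@cont_comp _ _ _ (horner (S j)) (@nm R C)); [exact: continuous_poly|exact: nm_continuous].
    have [b b0 hb] := usc_bounded (@compact_nm_le R 1) (continuous_usc (fun z _ => cn z)).
    by exists b; split => // z /hb; rewrite lte_fin => /ltW.
  exists (\sum_j b j); first by apply: sumr_ge0 => j _; case: (hb j).
  move=> j z z1; apply: (le_trans (proj2 (hb j) z z1)).
  by rewrite (bigD1 j)//= lerDl sumr_ge0// => i _; case: (hb i).
pose kd N u z : Cn := h z + \sum_j (S j).[z] *: corr m N u (G (tau j)) z.
have kdE N u z : kd N u z = h z + \sum_j (z^-1 ^+ m * (S j).[z]) *: G (tau j) (u * z ^+ N).
  by rewrite /kd; congr (_ + _); apply: eq_bigr => j _; rewrite /corr scalerA mulrC.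
have kdk N u t : kd N u (expit t) =
    h (expit t) + \sum_j (k j (expit t))%:C *: G (tau j) (u * expit t ^+ N).
  rewrite kdE; congr (_ + _); apply: eq_bigr => j _.
  by have [_ _ <-] := hk j _ (nm_expit t).
have uz1 (N : nat) (u z : C) : nm u = 1 -> nm z <= 1 -> nm (u * z ^+ N) <= 1.
  by move=> u1 z1; rewrite nmM u1 mul1r nm_expr_le1.
have follow N u t : nm u = 1 -> 0 <= t <= 2 * pi ->
    nm (kd N u (expit t) - F t (u * expit t ^+ N)) <= e.
  move=> u1 ht; rewrite kdk; have [_ Ft] := dF t ht.
  have -> : h (expit t) + \sum_j (k j (expit t))%:C *: G (tau j) (u * expit t ^+ N) - F t (u * expit t ^+ N)
    = \sum_j (k j (expit t))%:C *: G (tau j) (u * expit t ^+ N) - G t (u * expit t ^+ N).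
    set A := \sum_j _; by rewrite /G Ft opprB addrA (addrC A).
  by apply: approx => //; apply: uz1 => //; rewrite nm_expit.
(* A threshold for [N] that serves all [z] and all [u], by near-covering at infinity. Around an
   interior point the correction decays like [rho^(N - m)], so the disc stays near [h]. Around a
   boundary point [e^it] it stays near [F t (u z^N)], which lies in [X] for every [N] and [u]. *)
have inside : \forall N \near \oo, cdisc `<=` (fun z => forall u, nm u = 1 -> X (kd N u z)).
  move: (@compact_nm_le R 1) => /compact_near_coveringP/near_covering_withinP cD.
  apply: cD => z0 /= z01; have [z1|z1] := ltP (nm z0) 1.
    pose rho := (1 + nm z0) / 2.
    have [r0 [r1 rz]] : 0 <= rho /\ rho < 1 /\ nm z0 < rho.
      by have := nm_ge0 z0; rewrite /rho; split; [|split]; lra.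
    pose Q := M%:R * (Bs * Bl) + 1.
    have Q0 : 0 < Q by rewrite ltr_wpDl// mulr_ge0 ?ler0n// mulr_ge0.
    have eQ : 0 < eta2 / Q by rewrite divr_gt0.
    have geo : \forall N \near \oo, rho ^+ N < eta2 / Q.
      have := @cvg_expr R rho; rewrite ger0_norm// => /(_ r1) /cvgrPdist_lt /(_ _ eQ).
      by apply: filterS => N; rewrite sub0r normrN ger0_norm// exprn_ge0.
    have [N0 _ hN0] := geo.
    exists ([set z : C | nm z < rho], [set N | (N0 + m < N)%N]) => /=.
      split; last by exists (N0 + m).+1 => // N /=.
      have h1 : 0 < rho - nm z0 by lra.
      by apply: filterS (near_nm z0 h1) => z hz /=; have := nm_triangle z z0 0; rewrite !subr0; lra.
    move=> [z N] /= [zr Nm] zD u u1; apply: (hX2 z) => //.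
    rewrite /kd addrC addKr; apply: (le_lt_trans (nm_sum _ _ _)).
    have [mN hNm] : (m < N)%N /\ (N0 <= N - m)%N by clear -Nm; split; lia.
    have hj j : nm ((S j).[z] *: corr m N u (G (tau j)) z) <= Bs * (Bl * rho ^+ (N - m)).
      rewrite nmZ; apply: ler_pM; rewrite ?nm_ge0//; first exact: hBs.
      apply: (le_trans (corr_bound u1 mN zD (hBl j))); rewrite ler_wpM2l// lerXn2r ?nnegrE ?nm_ge0//.
      exact: ltW.
    apply: (@le_lt_trans _ _ (\sum_(j < M) Bs * (Bl * rho ^+ (N - m)))); first by apply: ler_sum => j _.
    rewrite sumr_const card_ord -mulr_natl !mulrA.
    have hr : rho ^+ (N - m) < eta2 / Q by exact: hN0.
    apply: (@le_lt_trans _ _ (Q * rho ^+ (N - m))).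
      by rewrite ler_wpM2r ?exprn_ge0// /Q mulrA lerDl.
    by rewrite mulrC -ltr_pdivlMr.
  have z0T : nm z0 = 1 by apply/eqP; rewrite eq_le z01 z1.
  have [t ht zt] := expit_surj z0T.
  have nz0 : z0 != 0 by rewrite zt expit_neq0.
  pose Q := M%:R * B + 1.
  have Q0 : 0 < Q by rewrite ltr_wpDl// mulr_ge0 ?ler0n.
  have eQ : 0 < e / Q by rewrite divr_gt0.
  have cc j : {for z0, continuous (fun z : C => z^-1 ^+ m * (S j).[z])}.
    apply: cont_mul; last exact: continuous_poly.
    apply: derivable_cont.
    have -> : (fun w : C => w^-1 ^+ m) = (fun w => ('X^m).[w]^-1).
      by apply/funext => w; rewrite hornerXn exprVn.
    apply: derivableV; last exact: derivable_poly.
    by rewrite hornerXn expf_neq0.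
  have n1 : \forall z \near z0, forall j, nm (z^-1 ^+ m * (S j).[z] - z0^-1 ^+ m * (S j).[z0]) < e / Q.
    apply: (@filter_forall _ _ (fun j z => nm (z^-1 ^+ m * (S j).[z] - z0^-1 ^+ m * (S j).[z0]) < e / Q) (nbhs z0)) => j.
    by have /cont_nmP/(_ _ eQ) := cc j.
  have n2 : \forall z \near z0, nm (h z - h z0) < e.
    by have /cont_nmP/(_ _ e0) := ch z0.
  exists ([set z | (forall j, nm (z^-1 ^+ m * (S j).[z] - z0^-1 ^+ m * (S j).[z0]) < e / Q) /\ nm (h z - h z0) < e], setT) => /=.
    by split; [exact: filterI n1 n2|exact: filterT].
  move=> [z N] /= [[zn1 zn2] _] zD u u1.
  have w1 := uz1 N u z u1 zD; set w := u * z ^+ N in w1.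
  apply: (hX1 (t, w)); first by split => //=; exact/perP.
  rewrite /= kdE -/w.
  have [_ Ft] := dF t ht.
  have -> : h z + \sum_j (z^-1 ^+ m * (S j).[z]) *: G (tau j) w - F t w =
     (h z - h z0) + (\sum_j (z^-1 ^+ m * (S j).[z] - z0^-1 ^+ m * (S j).[z0]) *: G (tau j) w +
     (\sum_j (k j (expit t))%:C *: G (tau j) w - G t w)).
    under [X in _ = _ + (X + _)]eq_bigr do rewrite scalerBl.
    rewrite sumrB.
    have -> : \sum_j (z0^-1 ^+ m * (S j).[z0]) *: G (tau j) w = \sum_j (k j (expit t))%:C *: G (tau j) w.
      by apply: eq_bigr => j _; rewrite zt; have [_ _ <-] := hk j _ (nm_expit t).
    rewrite addrA (addrA (h z - h z0)) /G Ft zt.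
    set A := \sum_j _; set A' := \sum_j _.
    by apply/rowP => i; rewrite !mxE; ring.
  apply: (le_lt_trans (nmD _ _)).
  have t2 : nm (\sum_j (z^-1 ^+ m * (S j).[z] - z0^-1 ^+ m * (S j).[z0]) *: G (tau j) w) <= e.
    apply: (le_trans (nm_sum _ _ _)).
    apply: (@le_trans _ _ (\sum_(j < M) e / Q * B)).
      apply: ler_sum => j _; rewrite nmZ; apply: ler_pM; rewrite ?nm_ge0//; first exact/ltW/zn1.
      by apply: hB'.
    rewrite sumr_const card_ord -mulr_natl.
    have -> : M%:R * (e / Q * B) = e * (M%:R * B / Q) by field; rewrite gt_eqF.
    by rewrite ler_piMr ?(ltW e0)// ler_pdivrMr// /Q mul1r lerDl.
  have := nmD (\sum_j (z^-1 ^+ m * (S j).[z] - z0^-1 ^+ m * (S j).[z0]) *: G (tau j) w)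
     (\sum_j (k j (expit t))%:C *: G (tau j) w - G t w).
  have := approx t w ht w1; lra.
have [N0 _ hN0] := inside.
(* Above the threshold, and at least [m + 2] as the corrections require at 0. *)
pose N := (N0 + m + 2)%N.
have Nin z : nm z <= 1 -> forall u, nm u = 1 -> X (kd N u z).
  by apply: hN0; rewrite /N /= -addnA leq_addr.
have mN : (m.+2 <= N)%N by rewrite /N -addnA addn2 leq_addl.
have kdh u : nm u = 1 -> holodisc X W (kd N u).
  move=> u1; split.
  - move=> z; suff : {for z, continuous (kd N u)} by [].
    rewrite /kd; apply: cont_add; first exact: ch.
    apply: cont_sum => j; apply: cont_scale; first exact: continuous_poly.
    exact: (corr_continuous u1 mN (cGj j) (dGj j) (Gj0 j)).
  - move=> z z1; apply: derivableD; first exact: dh.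
    have -> : (fun z => \sum_j (S j).[z] *: corr m N u (G (tau j)) z) =
        \sum_j (fun z => (S j).[z] *: corr m N u (G (tau j)) z).
      by apply/funext => w; rewrite fct_sumE.
    apply: derivable_sum => j; apply: derivable_scale; first exact: derivable_poly.
    exact: (corr_derivable u1 mN (cGj j) (dGj j) (Gj0 j)).
  - by move=> z z1; exact: Nin.
  - move=> z z1; have [t ht zt] := expit_surj z1.
    have [p [_ _ hp']] := hp t ht.
    have := follow N u t u1 ht; rewrite -zt => h1.
    have w1 : circle (u * z ^+ N) by rewrite /circle /= nmM u1 nmX z1 expr1n mulr1.
    by have [] := hp' _ (kd N u z) w1; first lra.
have kd0 u : kd N u 0 = h 0.
  rewrite /kd big1 ?addr0// => j _; rewrite corr0 ?scaler0//; exact: leq_trans mN.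
(* As many rotations as the size of the majorants, so that averaging [p.[z ^+ N * u]] over them
   leaves [p.[0]]; at least one, so that a rotation can be chosen. *)
pose Lr := maxn dg 1.
pose g (l : 'I_Lr) z := phi (kd N (unit_root Lr l) z).
have [||||l hl] := @circle_mean_average R Lr g P a.
- by rewrite /Lr leq_max orbT.
- move=> l; have [c1 _ _ c4] := kdh _ (nm_unit_root Lr l).
  by apply: (usc_comp oW uphi) => [z _|]; [exact: c1|exact: c4].
- move=> z Tz; have [t ht zt] := expit_surj Tz.
  have [p [sp p0 hp']] := hp t ht.
  apply: (@le_trans _ _ (\sum_(l < Lr) (Re p.[z ^+ N * unit_root Lr l])%:E)%E).
    apply: lee_sum => l _; have u1 := @nm_unit_root R Lr l.
    have w1 : circle (unit_root Lr l * z ^+ N).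
      by rewrite /circle /= nmM u1 nmX (_ : nm z = 1) ?expr1n ?mulr1.
    have := follow N _ t u1 ht; rewrite -zt => h1.
    have [|_ h2] := hp' _ (kd N (unit_root Lr l) z) w1; first lra.
    by rewrite /g (mulrC (z ^+ N)); exact: ltW.
  rewrite sumEFin lee_fin rotation_sum_Re; last by rewrite /Lr leq_max sp.
  by rewrite ler_wpM2l ?ler0n// zt.
- exact: Pa.
exists (kd N (unit_root Lr l)).
by split; [exact: (kdh _ (nm_unit_root Lr l))|exact: kd0|exact: hl].
Qed.

End Discs.

(** * Envelopes over families of discs *)

Section Spike.
Context {R : realType}.
Local Notation C := R[i].

Lemma ereal_between2 (x y : \bar R) : (x < y)%E ->
  exists2 a : R, (x < a%:E)%E & (a%:E < y)%E.
Proof.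
case: y => [r /ereal_between[a xa ar]|xy|]; first by exists a; rewrite ?lte_fin.
  case: x xy => [r _| |_] //; first by exists (r + 1); rewrite ?lte_fin ?ltry// ltrDl.
  by exists 0; rewrite ?ltNyr ?ltry.
by rewrite ltNge leNye.
Qed.

(** Induction shows that [('C(2m, m) / 4^m)^2 (2m + 1) <= 1], so the quotient decays at least like
    [m^(-1/2)]. *)
Lemma binom_small (e : R) : 0 < e -> exists m : nat, 'C(2 * m, m)%:R / 4 ^+ m <= e.
Proof.
move=> e0.
have h m : ('C(2 * m, m)%:R / 4 ^+ m) ^+ 2 * (2 * m + 1)%:R <= 1 :> R.
  elim: m => [|m IH]; first by rewrite bin0 expr0 divr1 expr1n muln0 mulr1.
  have e' : 'C(2 * m.+1, m.+1)%:R * m.+1%:R = 2 * (2 * m + 1)%:R * 'C(2 * m, m)%:R :> R.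
    exact: binom_step.
  have m1 : (0 : R) < m.+1%:R by rewrite ltr0n.
  have e2 : 'C(2 * m.+1, m.+1)%:R = 2 * (2 * m + 1)%:R * 'C(2 * m, m)%:R / m.+1%:R :> R.
    by rewrite -e' mulfK// gt_eqF.
  have q0 : (0 : R) < 4 ^+ m by rewrite exprn_gt0.
  have -> : ('C(2 * m.+1, m.+1)%:R / 4 ^+ m.+1) ^+ 2 * (2 * m.+1 + 1)%:R =
     (('C(2 * m, m)%:R / 4 ^+ m) ^+ 2 * (2 * m + 1)%:R) *
     ((2 * m + 1)%:R * (2 * m.+1 + 1)%:R / (4 * m.+1%:R ^+ 2)) :> R.
    rewrite e2 (exprS 4); move: m1 q0.
    move: (4 ^+ m) ('C(2 * m, m)%:R : R) (m.+1%:R : R) ((2 * m.+1 + 1)%:R : R) ((2 * m + 1)%:R : R).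
    by move=> x y u v w u0 x0; field; rewrite !gt_eqF.
  apply: mulr_ile1 => //.
  rewrite ler_pdivrMr ?mul1r; last by apply: mulr_gt0 => //; exact: exprn_gt0.
  rewrite -natrX -!natrM ler_nat; clear; nia.
have [m hm] : exists m : nat, (e ^+ 2)^-1 < m%:R.
  by exists (Num.truncn (e ^+ 2)^-1).+1; exact: truncnS_gt.
exists m; set A : R := _ / _.
have A0 : 0 <= A by rewrite divr_ge0 ?exprn_ge0.
have := h m; rewrite -/A => hA.
rewrite leNgt; apply/negP => eA.
have e20 : 0 < e ^+ 2 by rewrite exprn_gt0.
have m0 : (0 : R) <= m%:R by rewrite ler0n.
have h1 : 1 < m%:R * e ^+ 2 by rewrite -ltr_pdivrMr// div1r.
have h2 : m%:R <= (2 * m + 1)%:R :> R by rewrite ler_nat; clear; lia.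
have h3 : e ^+ 2 <= A ^+ 2 by rewrite ler_sqr ?nnegrE//; exact: ltW.
have h4 : m%:R * e ^+ 2 <= (2 * m + 1)%:R * A ^+ 2 by apply: ler_pM => //; exact: sqr_ge0.
lra.
Qed.

(** [kern m] has mean 1 and peak [4^m / 'C(2m, m)], which is unbounded in [m]. Rotated to peak at
    [zeta] and scaled to the height [2 K], it has mean [2 K 'C(2m, m) / 4^m]. Such spikes absorb
    large values of [phi] on short arcs. *)
Lemma trig_spike (zeta : C) (K e : R) : nm zeta = 1 -> 0 < K -> 0 < e ->
  exists P : {poly C}, [/\ forall z, circle z -> 0 <= Re P.[z], Re P.[0] <= e &
    K < Re P.[zeta]].
Proof.
move=> z1 K0 e0.
have K20 : 0 < 2 * K by lra.
have [m hm] := binom_small (divr_gt0 e0 K20).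
pose c : R := 2 * K * ('C(2 * m, m)%:R / 4 ^+ m).
have reM (x : R) (w : C) : Re (x%:C * w) = x * Re w by case: w => a b /=; ring.
have q0 : (0 : R) < 4 ^+ m by rewrite exprn_gt0.
have b0 : 0 < 'C(2 * m, m)%:R :> R by exact: bin_gt0R.
have c0 : 0 <= c by rewrite mulr_ge0 ?(ltW K20)// divr_ge0// ltW.
have zV : nm zeta^-1 = 1 by rewrite nmV z1 invr1.
have E z : nm z = 1 -> Re (c%:C *: (kern_poly m \Po (zeta^-1 *: 'X))).[z] = c * kern m (zeta^-1 * z).
  move=> zz; rewrite hornerZ horner_comp hornerZ hornerX reM kern_polyE//.
  by rewrite nmM zV zz mulr1.
exists (c%:C *: (kern_poly m \Po (zeta^-1 *: 'X))); split.
- by move=> z Tz; rewrite E// mulr_ge0// kern_ge0.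
- rewrite hornerZ horner_comp hornerZ hornerX mulr0 reM kern_poly0 /= mulr1 /c.
  by rewrite mulrC -ler_pdivlMr.
have zn : zeta != 0 by apply/negP => /eqP h; move: z1; rewrite h nm0 => /eqP; rewrite eq_sym oner_eq0.
rewrite E// mulVf// /kern.
have -> : nm (1 + 1 : C) = 2.
  by rewrite (_ : 1 + 1 = (2 : R)%:C) ?nm_real ?ger0_norm// rmorphD rmorph1.
have -> : (2 : R) ^+ (2 * m) = 4 ^+ m by rewrite exprM; congr (_ ^+ _); rewrite expr2 -natrM.
have -> : c * (4 ^+ m / 'C(2 * m, m)%:R) = 2 * K by rewrite /c; field; rewrite !gt_eqF.
lra.
Qed.

End Spike.

(** * Poletsky's inequality for a good family *)

Section GoodDiscs.
Context {R : realType} {n : nat}.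
Local Notation C := R[i].
Local Notation Cn := 'rV[C]_n.
Local Notation cdisc := [set z : C | nm z <= 1].
Implicit Types (X W : set Cn) (f g h : C -> Cn) (phi : Cn -> \bar R).

(* A family of discs with exactly one homotopy class over each point of [X],
   stable under small translations. *)
Record good_discs X W (B : set (C -> Cn)) : Prop := GoodDiscs {
  good_disc : forall f, B f -> holodisc X W f;
  good_fibre : forall x, X x -> exists2 f, B f & f 0 = x;
  good_shift : forall f, B f ->
    \forall y \near f 0, B (fun z => f z + (y - f 0));
  good_homotopy : forall f g, B f -> B g -> f 0 = g 0 ->
    exists H : R -> C -> Cn, [/\ continuous (fun q : R * C => H q.1 q.2),
      forall t, 0 <= t <= 1 -> holodisc X W (H t) /\ H t 0 = f 0,
      forall z, nm z <= 1 -> H 0 z = f z &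
      forall z, nm z <= 1 -> H 1 z = g z] }.

Definition envelope (B : set (C -> Cn)) phi (x : Cn) : \bar R :=
  ereal_inf [set circle_mean (fun z => phi (f z)) | f in [set f | B f /\ f 0 = x]].

Lemma phi_tube (Y : topologicalType) (K : set Y) (a : Y -> Cn) (q : Y -> R) W phi :
  open W -> usc_on W phi -> compact K -> (forall y, K y -> {for y, continuous a}) ->
  (forall y, K y -> {for y, continuous q}) -> (forall y, K y -> W (a y)) ->
  (forall y, K y -> phi (a y) < (q y)%:E)%E ->
  exists2 eta : R, 0 < eta & forall y x, K y -> nm (x - a y) < eta ->
    W x /\ (phi x < (q y)%:E)%E.
Proof.
move=> oW uphi cK ca cq aW aq.
apply: (@tube R Y Cn K a (fun y x => W x /\ (phi x < (q y)%:E)%E)) => // y Ky.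
by apply: usc_lt_near => //; [exact: aW|exact: cq|exact: aq].
Qed.

Lemma set_tube (Y : topologicalType) (K : set Y) (a : Y -> Cn) X :
  open X -> compact K -> (forall y, K y -> {for y, continuous a}) ->
  (forall y, K y -> X (a y)) ->
  exists2 eta : R, 0 < eta & forall y x, K y -> nm (x - a y) < eta -> X x.
Proof.
move=> oX cK ca aX; apply: (@tube R Y Cn K a (fun _ x => X x)) => // y Ky.
exists (setT, X) => [/=|[? ?] [] //].
by split; [exact: filterT|apply: open_nbhs_nbhs; split => //; exact: aX].
Qed.

Lemma holodisc_shift X W f : open X -> open W -> holodisc X W f ->
  exists2 eta : R, 0 < eta & forall v, nm v < eta -> holodisc X W (fun z => f z + v).
Proof.
move=> oX oW [cf df fX fW].
have [e1 e10 h1] := set_tube oX (@compact_nm_le R 1) (fun z _ => cf z) fX.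
have [e2 e20 h2] := set_tube oW (@compact_circle R) (fun z _ => cf z) fW.
exists (Num.min e1 e2); first by rewrite lt_min e10.
move=> v; rewrite lt_min => /andP[v1 v2]; split.
- by move=> z; apply: cont_add; [exact: cf|exact: cont_cst].
- by move=> z z1; apply: derivableD; [exact: df|exact: derivable_cst].
- by move=> z z1; apply: (h1 z) => //; rewrite addrC addKr.
- by move=> z z1; apply: (h2 z) => //; rewrite addrC addKr.
Qed.

Section Fixed.
Variables (X W : set Cn) (B : set (C -> Cn)) (phi : Cn -> \bar R).
Hypotheses (oX : open X) (oW : open W) (sWX : W `<=` X) (gB : good_discs X W B).
Hypothesis uphi : usc_on W phi.

Lemma usc_disc f : holodisc X W f -> usc_on circle (fun z => phi (f z)).
Proof. by move=> [cf _ _ fW]; apply: (usc_comp oW uphi) => [z _|]; [exact: cf|exact: fW]. Qed.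

Lemma near_shift f (p : {poly C}) : B f ->
  (forall z, circle z -> phi (f z) < (Re p.[z])%:E)%E ->
  \forall y \near f 0, B (fun z => f z + (y - f 0)) /\
    forall z, circle z -> (phi (f z + (y - f 0%R))%R < (Re p.[z])%:E)%E.
Proof.
move=> Bf fp; have [cf _ _ fW] := good_disc gB Bf.
have [e e0 he] := phi_tube oW uphi (@compact_circle R) (fun z _ => cf z)
  (fun z _ => @continuous_Re_poly R p z) fW fp.
have h := good_shift gB Bf.
apply: filterS (filterI h (near_nm (f 0) e0)) => y [By ye]; split => // z Tz.
by have [] := he z (f z + (y - f 0)) Tz; first by rewrite addrC addKr.
Qed.

Lemma envelope_lt x (a : R) : (envelope B phi x < a%:E)%E ->
  exists f (p : {poly C}), [/\ B f, f 0 = x,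
    forall z, circle z -> (phi (f z) < (Re p.[z])%:E)%E & Re p.[0] < a].
Proof.
move=> /ereal_inf_lt[_ [f [Bf fx] <-]] fa.
have [p [h1 h2]] := usc_poly_approx (usc_disc (good_disc gB Bf)) fa.
by exists f, p.
Qed.

(** A disc with strict majorant [p] keeps this majorant under small translations, so one bound [Re
    p.[0] < a] serves all nearby centres. Nonempty fibres keep the envelope below [+oo]. *)
Lemma envelope_usc : usc_on X (envelope B phi).
Proof.
have ub x a : X x -> (envelope B phi x < a%:E)%E ->
    \forall y \near x, (envelope B phi y < a%:E)%E.
  move=> Xx /envelope_lt[f [p [Bf fx fp pa]]].
  have := near_shift Bf fp; rewrite fx; apply: filterS => y [By hy].
  apply: (@le_lt_trans _ _ (Re p.[0])%:E); last by rewrite lte_fin.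
  apply: le_trans (_ : circle_mean (fun z => phi (f z + (y - f 0%R))%R) <= _)%E.
    apply: ereal_inf_lbound; exists (fun z => f z + (y - f 0)); rewrite fx //.
    by split => //; rewrite fx addrC subrK.
  rewrite fx; apply: circle_mean_le_poly.
    exact: (usc_disc (good_disc gB By)).
  by move=> z /hy /ltW.
move=> x Xx; split.
  have [f Bf fx] := good_fibre gB Xx.
  have uf := usc_disc (good_disc gB Bf).
  have [M M0 hM] := usc_bounded (@compact_circle R) uf.
  apply: (@le_lt_trans _ _ M%:E); last exact: ltry.
  apply: le_trans (_ : circle_mean (fun z => phi (f z)) <= _)%E.
    by apply: ereal_inf_lbound; exists f.
  have := @circle_mean_le_poly R _ (M%:C)%:P uf; rewrite hornerC /=; apply.
  by move=> z Tz; rewrite hornerC /=; exact/ltW/hM.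
by move=> a ha; apply: filterS (ub x a Xx ha) => y.
Qed.

Variables (h : C -> Cn) (p0 : {poly C}).
Hypothesis hh : holodisc X X h.
Local Notation e := (fun t : R => h (expit t)).

Let ce : continuous e.
Proof.
move=> t; apply: (@cont_comp _ _ _ (@expit R) h); first exact: expit_continuous.
by have [ch _ _ _] := hh; exact: ch.
Qed.

(* A continuous family of discs over the arc [e^{i[a, b]}] of the boundary of
   [h], from [f] to [g] up to translation, with [phi]-means below
   [Re p0 + Re P] where [P] costs at most [c] in the mean. *)
Definition arc_family (a b : R) f g (c : R) : Prop :=
  exists (F : R -> C -> Cn) (P : {poly C}) (dg : nat) (eta : R),
  [/\ continuous (fun q : R * C => F q.1 q.2) /\ 0 < eta,
      forall t, a <= t <= b -> holodisc X W (F t) /\ F t 0 = e t,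
      (forall w, nm w <= 1 -> F a w = f w + e a) /\
      (forall w, nm w <= 1 -> F b w = g w + e b),
      (forall z, circle z -> 0 <= Re P.[z]) /\ Re P.[0] <= c &
      forall t, a <= t <= b -> exists p : {poly C},
        [/\ (size p <= dg)%N, Re p.[0] <= Re p0.[expit t] + Re P.[expit t] &
         forall w x, circle w -> nm (x - F t w) < eta ->
           W x /\ (phi x < (Re p.[w])%:E)%E]].

(** Translates of one disc along the arc, all with the same majorant, at no cost: the extra
    polynomial is 0. *)
Lemma arc_const (a b : R) f (p : {poly C}) : continuous f -> f 0 = 0 -> a <= b ->
  (forall t, a <= t <= b -> holodisc X W (fun z => f z + e t)) ->
  (forall t z, a <= t <= b -> circle z -> (phi (f z + e t)%R < (Re p.[z])%:E)%E) ->
  (forall t, a <= t <= b -> Re p.[0] <= Re p0.[expit t]) ->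
  arc_family a b f f 0.
Proof.
move=> cf f0 ab hd hp hp0.
have cF : continuous (fun q : R * C => f q.2 + e q.1).
  move=> q; apply: cont_add.
    by apply: (@cont_comp _ _ _ (snd : R * C -> C) f); [exact: cvg_snd|exact: cf].
  by apply: (@cont_comp _ _ _ (fst : R * C -> R) e); [exact: cvg_fst|exact: ce].
pose K : set (R * C) := [set` `[a, b]] `*` circle.
have cK : compact K by apply: compact_setX; [exact: segment_compact|exact: compact_circle].
have KP q : K q -> a <= q.1 <= b /\ circle q.2 by move=> [/=]; rewrite in_itv.
have cq (q : R * C) : K q -> {for q, continuous (fun q : R * C => Re p.[q.2])}.
  move=> _; apply: (@cont_comp _ _ _ (snd : R * C -> C) (fun z => Re p.[z])); first exact: cvg_snd.
  exact: continuous_Re_poly.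
have [||eta eta0 he] := phi_tube oW uphi cK (fun q _ => cF q) cq.
- by move=> q /KP[q1 q2]; have [_ _ _ h4] := hd _ q1; exact: h4.
- by move=> q /KP[q1 q2]; exact: hp.
exists (fun t w => f w + e t), 0, (size p), eta; split.
- by split.
- by move=> t ht; split; [exact: hd|rewrite f0 add0r].
- by split.
- by split => [z _|]; rewrite horner0.
move=> t ht; exists p; split => //; first by rewrite horner0 addr0; exact: hp0.
move=> w x Tw; apply: (he (t, w)); split => //=; by rewrite in_itv.
Qed.

Lemma arc_trans (a b d : R) f g k (c1 c2 : R) : a <= b -> b <= d ->
  arc_family a b f g c1 -> arc_family b d g k c2 -> arc_family a d f k (c1 + c2).
Proof.
move=> ab bd [F1 [P1 [d1 [eta1 [[cF1 e10] h1 [s1 t1] [pp1 pc1] q1]]]]]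
  [F2 [P2 [d2 [eta2 [[cF2 e20] h2 [s2 t2] [pp2 pc2] q2]]]]].
(* Gluing without a case distinction keeps [F] continuous on the whole plane. It agrees with [F1] or
   [F2] only on the closed disc, where both equal [g + e b] at [t = b]. *)
pose F t w := F1 (Num.min t b) w + (F2 (Num.max t b) w - F1 b w).
have FE1 t w : t <= b -> nm w <= 1 -> F t w = F1 t w.
  by move=> tb w1; rewrite /F min_l// max_r// s2// t1// subrr addr0.
have FE2 t w : b <= t -> nm w <= 1 -> F t w = F2 t w.
  by move=> tb w1; rewrite /F min_r// max_l// addrC subrK.
have cmin : continuous (fun t : R => Num.min t b).
  by move=> t; apply: continuous_min; [exact: cvg_id|exact: cvg_cst].
have cmax : continuous (fun t : R => Num.max t b).
  by move=> t; apply: continuous_max; [exact: cvg_id|exact: cvg_cst].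
have cF : continuous (fun q : R * C => F q.1 q.2).
  have cc (G : R -> C -> Cn) (m : R -> R) (q : R * C) : continuous (fun q : R * C => G q.1 q.2) ->
      continuous m -> {for q, continuous (fun q : R * C => G (m q.1) q.2)}.
    move=> cG cm; apply: (@cont_comp _ _ _ (fun q : R * C => (m q.1, q.2)) (fun q : R * C => G q.1 q.2)).
      apply: cont_pair; last exact: cvg_snd.
      by apply: (@cont_comp _ _ _ (fst : R * C -> R) m); [exact: cvg_fst|exact: cm].
    exact: cG.
  move=> q; suff : {for q, continuous (fun q : R * C => F q.1 q.2)} by []; rewrite /F.
  apply: cont_add; first exact: (cc F1 _ q cF1 cmin).
  apply: cont_sub; first exact: (cc F2 _ q cF2 cmax).
  by apply: (cc F1 (fun=> b) q cF1); exact: cst_continuous.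
have Fc t : continuous (F t).
  move=> w; apply: (@cont_comp _ _ _ (fun w : C => (t, w)) (fun q : R * C => F q.1 q.2)); last exact: cF.
  by apply: cont_pair; [exact: cont_cst|exact: cont_id].
have hcongr t G : (forall w, nm w <= 1 -> F t w = G w) -> holodisc X W G -> holodisc X W (F t).
  move=> E [_ dG GX GW]; split; first exact: Fc.
  - move=> z z1; apply: (@near_eq_derivable _ _ _ G); last exact: dG.
    have z2 : 0 < 1 - nm z by lra.
    apply: filterS (near_nm z z2) => w wz; apply/esym/E.
    by have := nm_triangle w z 0; rewrite !subr0; lra.
  - by move=> z z1; rewrite E//; exact: GX.
  - by move=> z z1; rewrite E ?z1//; exact: GW.
have n01 : nm (0 : C) <= 1 by rewrite nm0.
exists F, (P1 + P2), (maxn d1 d2), (Num.min eta1 eta2); split.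
- by split => //; rewrite lt_min e10.
- move=> t /andP[at_ td]; have [tb|/ltW bt] := leP t b.
    have ht : a <= t <= b by rewrite at_.
    have [hF F0] := h1 _ ht; split; last by rewrite FE1.
    by apply: (hcongr t (F1 t)) => // w w1; rewrite FE1.
  have ht : b <= t <= d by rewrite bt.
  have [hF F0] := h2 _ ht; split; last by rewrite FE2.
  by apply: (hcongr t (F2 t)) => // w w1; rewrite FE2.
- by split=> w w1; [rewrite FE1// s1|rewrite FE2// t2].
- split; last by rewrite hornerD raddfD lerD.
  by move=> z Tz; rewrite hornerD raddfD addr_ge0 ?pp1 ?pp2.
move=> t /andP[at_ td]; have Tt := circle_expit t.
have [tb|/ltW bt] := leP t b.
  have [|p [sp p0' hp]] := q1 t; first by rewrite at_.
  exists p; split; first by rewrite leq_max sp.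
    by rewrite hornerD raddfD; apply: (le_trans p0'); rewrite lerD2l lerDl pp2.
  move=> w x Tw; rewrite FE1//; last by rewrite (_ : nm w = 1).
  by rewrite lt_min => /andP[xw _]; exact: hp.
have [|p [sp p0' hp]] := q2 t; first by rewrite bt.
exists p; split; first by rewrite leq_max sp orbT.
  by rewrite hornerD raddfD; apply: (le_trans p0'); rewrite lerD2l lerDr pp1.
move=> w x Tw; rewrite FE2//; last by rewrite (_ : nm w = 1).
by rewrite lt_min => /andP[_ xw]; exact: hp.
Qed.

(** The homotopy, on which [phi] is merely bounded by some [M], is run through over an arc so short
    that its translates along [h] stay in the tubes. The constant [M] is the majorant. The spike at
    [e^ib], at least [M + Mp + 1] on the arc, pays for it, [- Mp] being a lower bound of [Re p0]. *)
Lemma arc_homotopy (b : R) f g (c : R) (H : R -> C -> Cn) : 0 < c ->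
  continuous (fun q : R * C => H q.1 q.2) ->
  (forall t, 0 <= t <= 1 -> holodisc X W (H t) /\ H t 0 = e b) ->
  (forall z, nm z <= 1 -> H 0 z = f z + e b) ->
  (forall z, nm z <= 1 -> H 1 z = g z + e b) ->
  exists2 k0 : R, 0 < k0 & forall l r, l < r -> l <= b <= r -> r - l < k0 ->
    arc_family l r f g c.
Proof.
move=> c0 cH hH H0 H1.
pose KX : set (R * C) := [set` `[0%R, 1%R]] `*` cdisc.
pose KW : set (R * C) := [set` `[0%R, 1%R]] `*` circle.
have cKX : compact KX by apply: compact_setX; [exact: segment_compact|exact: compact_nm_le].
have cKW : compact KW by apply: compact_setX; [exact: segment_compact|exact: compact_circle].
have KXP q : KX q -> 0 <= q.1 <= 1 /\ nm q.2 <= 1 by move=> [/=]; rewrite in_itv.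
have KWP q : KW q -> 0 <= q.1 <= 1 /\ circle q.2 by move=> [/=]; rewrite in_itv.
have HX q : KX q -> X (H q.1 q.2) by move=> /KXP[q1 q2]; have [[_ _ h3 _] _] := hH _ q1; exact: h3.
have HW q : KW q -> W (H q.1 q.2) by move=> /KWP[q1 q2]; have [[_ _ _ h4] _] := hH _ q1; exact: h4.
have [e1 e10 he1] := set_tube oX cKX (fun q _ => cH q) HX.
have uH : usc_on KW (fun q => phi (H q.1 q.2)).
  by apply: (usc_comp oW uphi) => [q _|]; [exact: cH|exact: HW].
have [M M0 hM] := usc_bounded cKW uH.
have [e2 e20 he2] := phi_tube oW uphi cKW (fun q _ => cH q) (fun q _ => @cont_cst _ _ M q) HW hM.
pose eta := Num.min e1 e2 / 2.
have [eta0 [l1 l2]] : 0 < eta /\ 2 * eta <= e1 /\ 2 * eta <= e2.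
  have m0 : 0 < Num.min e1 e2 by rewrite lt_min e10.
  have m1 : Num.min e1 e2 <= e1 by rewrite ge_min lexx.
  have m2 : Num.min e1 e2 <= e2 by rewrite ge_min lexx orbT.
  by rewrite /eta; split; [|split]; lra.
clearbody eta.
have [Mp Mp0 hMp] : exists2 M : R, 0 <= M & forall z, circle z -> - M <= Re p0.[z].
  have [Mp Mp0 hMp] := usc_bounded (@compact_circle R) (usc_Re_poly (- p0)).
  exists Mp => // z Tz; have := hMp z Tz; rewrite lte_fin hornerN raddfN /=; lra.
have K0 : 0 < M + Mp + 1 by lra.
have [P [PT Pc PK]] := trig_spike (nm_expit b) K0 c0.
have [k1 k10 hk1] : exists2 k1 : R, 0 < k1 & forall t, `|t - b| < k1 -> M + Mp + 1 <= Re P.[expit t].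
  have cP : {for b, continuous (fun t : R => Re P.[expit t])}.
    by apply: (@cont_comp _ _ _ (@expit R) (fun z => Re P.[z])); [exact: expit_continuous|exact: continuous_Re_poly].
  have d0 : 0 < Re P.[expit b] - (M + Mp + 1) by lra.
  have /cont_realP/(_ _ d0)/nbhs_ballP[k1 /= k10 hk1] := cP.
  exists k1 => // t tb; have := hk1 t; rewrite -ball_normE /= distrC => /(_ tb).
  by rewrite ltr_norml => /andP[? _]; lra.
have [k2 k20 hk2] : exists2 k2 : R, 0 < k2 & forall t, `|t - b| < k2 -> nm (e t - e b) < eta.
  have /cont_nmP/(_ _ eta0)/nbhs_ballP[k2 /= k20 hk2] := @ce b.
  by exists k2 => // t tb; apply: hk2; rewrite -ball_normE /= distrC.
exists (Num.min k1 k2); first by rewrite lt_min k10.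
move=> l r lr /andP[lb br]; rewrite lt_min => /andP[kk1 kk2].
have k0 : 0 < r - l by rewrite subr_gt0.
have tk t : l <= t <= r -> `|t - b| <= r - l.
  by move=> /andP[? ?]; rewrite ler_norml; apply/andP; split; lra.
pose s t := (t - l) / (r - l).
have s01 t : l <= t <= r -> 0 <= s t <= 1.
  move=> /andP[? ?]; apply/andP; split.
    by rewrite divr_ge0 ?(ltW k0)//; lra.
  by rewrite ler_pdivrMr//; lra.
have cs : continuous s.
  move=> t; suff : {for t, continuous (fun t => (t - l) * (r - l)^-1)} by [].
  apply: cont_mul; last exact: cont_cst.
  by apply: cont_sub; [exact: cont_id|exact: cont_cst].
pose F t w := H (s t) w + (e t - e b).
have cF : continuous (fun q : R * C => F q.1 q.2).
  move=> q; suff : {for q, continuous (fun q : R * C => F q.1 q.2)} by []; rewrite /F.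
  apply: cont_add.
    apply: (@cont_comp _ _ _ (fun q : R * C => (s q.1, q.2)) (fun q : R * C => H q.1 q.2)); last exact: cH.
    apply: cont_pair; last exact: cvg_snd.
    by apply: (@cont_comp _ _ _ (fst : R * C -> R) s); [exact: cvg_fst|exact: cs].
  apply: cont_sub; last exact: cont_cst.
  by apply: (@cont_comp _ _ _ (fst : R * C -> R) e); [exact: cvg_fst|exact: ce].
have near_F t w : l <= t <= r -> nm (F t w - H (s t) w) < eta.
  move=> ht; rewrite /F addrC addKr; apply: hk2; exact: le_lt_trans (tk t ht) kk2.
exists F, P, (size (M%:C%:P : {poly C})), eta; split => //.
- move=> t ht; have [[cHs dHs _ _] Hs0] := hH _ (s01 t ht); split; last first.
    by rewrite /F Hs0 addrC subrK.
  split.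
  + move=> w; suff : {for w, continuous (fun w => H (s t) w + (e t - e b))} by [].
    by apply: cont_add; [exact: cHs|exact: cont_cst].
  + by move=> w w1; apply: derivableD; [exact: dHs|exact: derivable_cst].
  + move=> w w1; apply: (he1 (s t, w)).
      by split => //=; rewrite in_itv /=; exact: s01.
    by have := near_F t w ht; lra.
  + move=> w w1; have [] := he2 (s t, w) (F t w) _ _ => //.
      by split => //=; rewrite in_itv /=; exact: s01.
    by have := near_F t w ht; lra.
- have sl : s l = 0 by rewrite /s subrr mul0r.
  have sr : s r = 1 by rewrite /s divff// gt_eqF.
  split=> w w1; rewrite /F ?sl ?sr.
    by rewrite H0// -addrA (addrC (e b)) subrK.
  by rewrite H1// -addrA (addrC (e b)) subrK.
move=> t ht; exists M%:C%:P; split => //.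
  rewrite hornerC /=; have h1 := hMp _ (circle_expit t).
  by have := hk1 t (le_lt_trans (tk t ht) kk1); lra.
move=> w x Tw xw; rewrite hornerC /=; apply: (he2 (s t, w)).
  by split => //=; rewrite in_itv /=; exact: s01.
have := nm_triangle x (F t w) (H (s t) w); have := near_F t w ht; rewrite /=; lra.
Qed.

(** Quantifying over both end discs and over the cost makes links composable: at a junction any disc
    of the fibre serves, and each half gets half of the cost. *)
Definition arc_link (a b : R) : Prop := forall f g (c : R), 0 < c ->
  f 0 = 0 -> g 0 = 0 -> B (fun w => f w + e a) -> B (fun w => g w + e b) ->
  arc_family a b f g c.

Lemma arc_link_trans (a b d : R) : a <= b -> b <= d ->
  arc_link a b -> arc_link b d -> arc_link a d.
Proof.
move=> ab bd l1 l2 f g c c0 f0 g0 Bf Bg.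
have [_ _ hX _] := hh.
have Xb : X (e b) by apply: hX; rewrite nm_expit.
have [k Bk k0] := good_fibre gB Xb.
have Bk' : B (fun w => (k w - e b) + e b).
  by rewrite (_ : (fun w => _) = k)//; apply/funext => w; rewrite subrK.
have kk0 : k 0 - e b = 0 by rewrite k0 subrr.
have c20 : 0 < c / 2 by lra.
have -> : c = c / 2 + c / 2 by lra.
apply: (@arc_trans a b d f (fun w => k w - e b) g) => //.
  by apply: l1.
by apply: l2.
Qed.

(** An almost optimal disc [k] over [e t] is translated along the middle of the arc. Two short
    homotopies near the ends connect it with the prescribed discs, at cost [c / 2] each. *)
Lemma arc_link_near (t : R) :
  (envelope B phi (e t) < (Re p0.[expit t])%:E)%E ->
  exists2 d : R, 0 < d & forall a b, a < b -> `|a - t| < d -> `|b - t| < d -> arc_link a b.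
Proof.
move=> /envelope_lt[k [p [Bk kt kp pt]]].
have := near_shift Bk kp; rewrite kt => h1.
have h2 : \forall s \near t, B (fun z => k z + (e s - e t)) /\
    forall z, circle z -> (phi (k z + (e s - e t))%R < (Re p.[z])%:E)%E.
  exact: (@ce t _ h1).
have d0 : 0 < Re p0.[expit t] - Re p.[0] by lra.
have h3 : \forall s \near t, Re p.[0] <= Re p0.[expit s].
  have cP : {for t, continuous (fun t : R => Re p0.[expit t])}.
    by apply: (@cont_comp _ _ _ (@expit R) (fun z => Re p0.[z])); [exact: expit_continuous|exact: continuous_Re_poly].
  have /cont_realP/(_ _ d0) := cP; apply: filterS => s.
  by rewrite ltr_norml => /andP[? _]; lra.
have : nbhs t [set s | (B (fun z => k z + (e s - e t)) /\
    forall z, circle z -> (phi (k z + (e s - e t))%R < (Re p.[z])%:E)%E) /\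
    Re p.[0] <= Re p0.[expit s]] by exact: filterI h2 h3.
move=> /nbhs_ballP[d /= d0' hd].
exists d => // a b ab; rewrite (distrC a) (distrC b) => ad bd f g c c0 f0 g0 Bf Bg.
have nd s : a <= s <= b -> ball t d s.
  move=> /andP[as_ sb]; rewrite -ball_normE /=; move: ad bd; rewrite !ltr_norml.
  by move=> /andP[? ?] /andP[? ?]; apply/andP; split; lra.
pose q w := k w - e t.
have Eq s : (fun z => q z + e s) = (fun z => k z + (e s - e t)).
  by apply/funext => z; rewrite /q addrAC -addrA.
have Bq s : a <= s <= b -> B (fun z => q z + e s).
  by move=> /nd/hd[[hB _] _]; rewrite Eq.
have q0 : q 0 = 0 by rewrite /q kt subrr.
have c20 : 0 < c / 2 by lra.
have hom s f1 f2 : f1 0 = 0 -> f2 0 = 0 -> B (fun w => f1 w + e s) -> B (fun w => f2 w + e s) ->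
    exists2 k0 : R, 0 < k0 & forall l r, l < r -> l <= s <= r -> r - l < k0 ->
      arc_family l r f1 f2 (c / 2).
  move=> f10 f20 B1 B2.
  have [|H [cH hH H0 H1]] := good_homotopy gB B1 B2; first by rewrite f10 f20.
  apply: (@arc_homotopy s f1 f2 (c / 2) H) => // t' /hH[hd' ->]; split => //.
  by rewrite f10 add0r.
have aab : a <= a <= b by rewrite lexx ltW.
have bab : a <= b <= b by rewrite lexx ltW.
have [k1 k10 hk1] := hom a f q f0 q0 Bf (Bq a aab).
have [k2 k20 hk2] := hom b q g q0 g0 (Bq b bab) Bg.
pose m := Num.min (Num.min k1 k2) (b - a) / 3.
have [m0 [m1 [m2 m3]]] : 0 < m /\ m < k1 /\ m < k2 /\ 3 * m <= b - a.
  have ba : 0 < b - a by lra.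
  have n0 : 0 < Num.min (Num.min k1 k2) (b - a) by rewrite !lt_min k10 k20.
  have n1 : Num.min (Num.min k1 k2) (b - a) <= k1 by rewrite !ge_min lexx.
  have n2 : Num.min (Num.min k1 k2) (b - a) <= k2 by rewrite !ge_min lexx !orbT.
  have n3 : Num.min (Num.min k1 k2) (b - a) <= b - a by rewrite ge_min lexx orbT.
  by rewrite /m; split; [|split; [|split]]; lra.
clearbody m.
have -> : c = c / 2 + (0 + c / 2) by lra.
have L1 : a <= a + m by lra.
have L2 : a + m <= b - m by lra.
have L3 : b - m <= b by lra.
apply: (@arc_trans a (a + m) b f q g) => //; first by lra.
  by apply: hk1; lra.
apply: (@arc_trans (a + m) (b - m) b q q g) => //; last by apply: hk2; lra.
have sub s : a + m <= s <= b - m -> a <= s <= b.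
  by move=> /andP[? ?]; apply/andP; split; lra.
apply: (@arc_const (a + m) (b - m) q p) => //.
- move=> w; suff : {for w, continuous (fun w => k w - e t)} by [].
  by apply: cont_sub; [have [ck _ _ _] := good_disc gB Bk; exact: ck|exact: cont_cst].
- by move=> s /sub/Bq/(good_disc gB).
- move=> s z /sub/nd/hd[[_ hq] _] Tz; rewrite /q addrAC -addrA; exact: hq.
- by move=> s /sub/nd/hd[_].
Qed.

Lemma arc_link_circle :
  (forall z, circle z -> (envelope B phi (h z) < (Re p0.[z])%:E)%E) ->
  arc_link 0 (2 * pi).
Proof.
move=> hp0.
have [d d0 hd] : exists2 d : R, 0 < d & forall t a b, 0 <= t <= 2 * pi -> a < b ->
    `|a - t| < d -> `|b - t| < d -> arc_link a b.
  move: (@segment_compact R 0 (2 * pi)) => /compact_near_coveringP/near_covering_withinP cK.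
  have := cK R (0 : R)^'+ (fun d t => forall a b, a < b -> `|a - t| < d -> `|b - t| < d ->
    arc_link a b) _ _.
  case.
    move=> t _; have [d d0 hd] := arc_link_near (hp0 _ (circle_expit t)).
    have d20 : 0 < d / 2 by lra.
    exists (ball t (d / 2), [set r : R | r < d / 2]) => /=.
      by split; [exact: nbhsx_ballx|exact: nbhs_right_lt].
    move=> [t' r] [/= ]; rewrite -ball_normE /= => tt rd _ a b ab a1 b1.
    move: tt a1 b1; rewrite !ltr_norml => /andP[? ?] /andP[? ?] /andP[? ?].
    by apply: hd => //; rewrite ltr_norml; apply/andP; split; lra.
  move=> d /= d0 hd; have d20 : 0 < d / 2 by lra.
  have db : ball 0 d (d / 2) by rewrite -ball_normE /= sub0r normrN gtr0_norm//; lra.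
  exists (d / 2) => // t a b ht; apply: (hd (d / 2) db d20 t).
  by rewrite /= in_itv.
have pi0 : 0 < 2 * pi :> R by have := @pi_gt0 R; lra.
have [M hM] : exists M : nat, 2 * pi / d < M.+1%:R.
  by exists (Num.truncn (2 * pi / d)); exact: truncnS_gt.
pose k : R := 2 * pi / M.+1%:R.
have M0 : (0 : R) < M.+1%:R by rewrite ltr0n.
have k0 : 0 < k by rewrite divr_gt0.
have kd : k < d by rewrite /k ltr_pdivrMr//; move: hM; rewrite ltr_pdivrMr// [d * _]mulrC.
have kM : M.+1%:R * k = 2 * pi by rewrite /k mulrC divfK// gt_eqF.
rewrite -kM.
have : forall i, (i <= M)%N -> arc_link 0 (i.+1%:R * k).
  elim=> [_|i IH iM].
    apply: (hd 0); rewrite ?mul1r ?subr0 ?normr0 ?(gtr0_norm k0)//.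
    by rewrite lexx ltW.
  have i0 : (0 : R) < i.+1%:R by rewrite ltr0n.
  have ik : 0 <= i.+1%:R * k by rewrite mulr_ge0// ltW.
  have E : i.+2%:R * k = i.+1%:R * k + k by rewrite -(natr1 i.+1) mulrDl mul1r.
  apply: (@arc_link_trans _ (i.+1%:R * k)) => //.
  - by rewrite E; lra.
  - by apply: IH; exact: ltnW.
  have ht : 0 <= i.+1%:R * k <= 2 * pi.
    by rewrite ik /= -kM ler_wpM2r ?(ltW k0)// ler_nat ltnS ltnW.
  apply: (hd _ _ _ ht); rewrite ?E ?subrr ?normr0//; first by lra.
  by rewrite addrAC subrr add0r gtr0_norm.
by apply.
Qed.

End Fixed.

(** Otherwise some real [a] lies strictly between. A majorant [p0] of the envelope along [h] with
    [Re p0.[0] < a] is chosen, and the circle is linked with the same disc at [t = 0] and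
    [t = 2 pi], which closes up the family. Half of the room [a - Re p0.[0]] is left for the joins,
    and [attach_discs] yields a disc of mean below [a]. *)
Lemma envelope_le_circle_mean X W B phi h : open X -> open W -> W `<=` X ->
  good_discs X W B -> usc_on W phi -> holodisc X X h ->
  (envelope (holodisc X W) phi (h 0%R) <= circle_mean (fun z => envelope B phi (h z)))%E.
Proof.
move=> oX oW sWX gB uphi hh; rewrite leNgt; apply/negP => /ereal_between2[a h1 h2].
have [ch _ _ hX] := hh.
have uv : usc_on circle (fun z => envelope B phi (h z)).
  by apply: (usc_comp oX (envelope_usc oW gB uphi)) => [z _|]; [exact: ch|exact: hX].
have [p0 [hp0 p0a]] := usc_poly_approx uv h1.
have link := arc_link_circle oX oW gB uphi hh hp0.
have X0 : X (h (expit 0)) by apply: hX; exact: nm_expit.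
have [f Bf f0] := good_fibre gB X0.
have E2 : expit (2 * pi) = expit 0 :> C by rewrite expit2pi expit0.
have Bf' t : expit t = expit 0 :> C -> B (fun w => (f w - h (expit 0)) + h (expit t)).
  by move=> ->; rewrite (_ : (fun w => _) = f)//; apply/funext => w; rewrite subrK.
have c0 : 0 < (a - Re p0.[0]) / 2 by lra.
have f00 : f 0 - h (expit 0) = 0 by rewrite f0 subrr.
have [F [P [dg [eta [[cF eta0] hF [F0 F1] [_ P0] hp]]]]] :=
  link (fun w => f w - h (expit 0)) _ _ c0 f00 f00 (Bf' 0 erefl) (Bf' (2 * pi) E2).
have [|||k [hk k0 kl]] := @attach_discs R n X W phi h F (p0 + P) eta a dg oX oW sWX uphi hh cF hF _ eta0.
- by move=> w w1; rewrite F0// F1// E2.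
- move=> t /hp[p [sp p1 p2]]; exists p; split => //.
  by rewrite hornerD raddfD.
- by rewrite hornerD raddfD /=; lra.
have := lt_trans kl h2; apply/negP; rewrite -leNgt; apply: ereal_inf_lbound.
by exists k.
Qed.

End GoodDiscs.

(** * Plurisubharmonicity of the envelope over all discs *)

Section PshEnvelope.
Context {R : realType} {n : nat}.
Local Notation C := R[i].
Local Notation Cn := 'rV[C]_n.
Implicit Types (X W : set Cn) (f g h : C -> Cn) (phi u v : Cn -> \bar R).

Lemma holodisc_cst X W w : W `<=` X -> W w -> holodisc X W (fun=> w).
Proof.
move=> sWX Ww; split.
- exact: cst_continuous.
- by move=> z _; exact: derivable_cst.
- by move=> _ _; exact: sWX.
- by [].
Qed.

Lemma holodisc_dilate X f (r : R) : 0 <= r <= 1 -> holodisc X X f ->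
  holodisc X X (fun z => f (r%:C * z)).
Proof.
move=> /andP[r0 r1] [cf df fX _].
have rz z : nm (r%:C * z) <= nm z.
  by rewrite nmM nm_real ger0_norm// ler_piMl// nm_ge0.
split.
- move=> z; apply: (@cont_comp _ _ _ (fun z : C => r%:C * z) f); last exact: cf.
  by apply: cont_mul; [exact: cont_cst|exact: cont_id].
- move=> z z1; apply: (@derivable_compose _ _ f (fun w : C => r%:C * w)).
    have -> : (fun w : C => r%:C * w) = (fun w => (r%:C *: 'X).[w]).
      by apply/funext => w; rewrite hornerZ hornerX.
    exact: derivable_poly.
  by apply: df; exact: le_lt_trans (rz z) z1.
- by move=> z z1; apply: fX; exact: le_trans (rz z) z1.
- by move=> z z1; apply: fX; rewrite (le_trans (rz z))// z1.
Qed.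

(** Without a boundary constraint all discs over a point are homotopic: [f] is shrunk to its centre
    and then [g] is expanded from it. In [H] one of the two dilation factors is always 0, which
    avoids gluing. *)
Lemma good_discs_all X : open X -> good_discs X X (holodisc X X).
Proof.
move=> oX; split => //.
- by move=> x Xx; exists (fun=> x) => //; exact: holodisc_cst.
- move=> f hf; have [e e0 he] := holodisc_shift oX oX hf.
  by apply: filterS (near_nm (f 0) e0) => y; exact: he.
move=> f g hf hg fg0.
pose H (t : R) z := f ((Num.max (1 - 2 * t) 0)%:C * z) + (g ((Num.max (2 * t - 1) 0)%:C * z) - g 0).
have HE t : 0 <= t <= 1 -> exists r k, [/\ 0 <= r <= 1, holodisc X X k, k 0 = f 0 &
    H t = fun z => k (r%:C * z)].
  move=> /andP[t0 t1]; have [th|/ltW th] := leP t 2^-1.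
    exists (1 - 2 * t), f; split => //; first by apply/andP; split; lra.
    rewrite /H max_l; last by lra.
    rewrite max_r; last by lra.
    by apply/funext => z; rewrite mul0r subrr addr0.
  exists (2 * t - 1), g; split => //; first by apply/andP; split; lra.
  rewrite /H max_r; last by lra.
  rewrite max_l; last by lra.
  by apply/funext => z; rewrite mul0r fg0 addrC subrK.
exists H; split.
- have cm (a b : R) : continuous (fun t : R => Num.max (a * t + b) 0).
    have c1 : continuous (fun s : R => Num.max s 0).
      by move=> s; apply: continuous_max; [exact: cvg_id|exact: cvg_cst].
    have c2 t : {for t, continuous (fun t : R => a * t + b)}.
      apply: cont_add; last exact: cont_cst.
      by apply: cont_mul; [exact: cont_cst|exact: cont_id].
    move=> t; exact: (@cont_comp _ _ _ (fun t : R => a * t + b) _ t (c2 t) (c1 _)).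
  have cc (m : R -> R) (k : C -> Cn) (q : R * C) : continuous m -> continuous k ->
      {for q, continuous (fun q : R * C => k ((m q.1)%:C * q.2))}.
    move=> cm' ck; apply: (@cont_comp _ _ _ (fun q : R * C => (m q.1)%:C * q.2) k); last exact: ck.
    apply: cont_mul; last exact: cvg_snd.
    apply: (@cont_comp _ _ _ (fst : R * C -> R) (fun t => (m t)%:C)); first exact: cvg_fst.
    by apply: (@cont_comp _ _ _ m (real_complex R)); [exact: cm'|exact: complexC_continuous].
  have [cf _ _ _] := hf; have [cg _ _ _] := hg.
  move=> q; suff : {for q, continuous (fun q : R * C => H q.1 q.2)} by []; rewrite /H.
  apply: cont_add.
    apply: (cc (fun t => Num.max (1 - 2 * t) 0) f q) => //.
    have -> : (fun t : R => Num.max (1 - 2 * t) 0) = (fun t => Num.max (- 2 * t + 1) 0).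
      by apply/funext => t; congr Num.max; ring.
    exact: cm.
  apply: cont_sub; last exact: cont_cst.
  by apply: (cc (fun t => Num.max (2 * t - 1) 0) g q) => //; exact: cm.
- move=> t /HE[r [k [r01 hk k0 ->]]]; split; last by rewrite mulr0.
  exact: holodisc_dilate.
- move=> z _; rewrite /H mulr0 subr0 max_l ?ler01// sub0r max_r; last by rewrite oppr_le0.
  by rewrite mul1r mul0r subrr addr0.
move=> z _; rewrite /H mulr1 max_r; last by lra.
rewrite max_l; last by lra.
by rewrite mul0r (_ : 2 - 1 = 1 :> R) ?mul1r ?fg0 1?addrC ?subrK//; ring.
Qed.

Lemma usc_cst (T : topologicalType) (K : set T) (c : \bar R) : (c < +oo)%E ->
  usc_on K (fun=> c).
Proof. by move=> cy x _; split => // a ca; exact: filterE. Qed.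

Lemma envelope_cst (B : set (C -> Cn)) v x : B (fun=> x) -> (v x < +oo)%E ->
  (envelope B v x <= v x)%E.
Proof.
move=> Bx vx; rewrite leNgt; apply/negP => /ereal_between2[a h1].
apply/negP; rewrite -leNgt.
apply: (@le_trans _ _ (circle_mean (fun=> v x))).
  by apply: ereal_inf_lbound; exists (fun=> x).
have := @circle_mean_le_poly R (fun=> v x) (a%:C)%:P (@usc_cst _ _ _ vx).
by rewrite hornerC; apply => z _; rewrite hornerC ltW.
Qed.

(** A parametrised closed disc in a complex line is itself an analytic disc in [X], so the
    inequality for the family of all discs is the submean inequality. *)
Lemma envelope_psh X v : open X -> usc_on X v ->
  plurisubharmonic X (envelope (holodisc X X) v).
Proof.
move=> oX uv; have gX := good_discs_all oX.
have uu := envelope_usc oX gX uv.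
have cl (V : normedModType C) (a b : V) z : {for z, continuous (fun z : C => a + z *: b)}.
  apply: cont_add; first exact: cont_cst.
  by apply: cont_scale; [exact: cont_id|exact: cont_cst].
split => // a b; split.
  by apply: (usc_comp oX uu) => [z _|z //]; exact: cl.
move=> c r r0 cX; pose h z := a + (c + r%:C * z) *: b.
have hE z : h z = (a + c *: b) + z *: (r%:C *: b).
  by rewrite /h scalerDl scalerA addrA (mulrC z).
have hh : holodisc X X h.
  split.
  - move=> z; suff : {for z, continuous (fun z : C => (a + c *: b) + z *: (r%:C *: b))}.
      by rewrite (_ : h = (fun z : C => (a + c *: b) + z *: (r%:C *: b)))//; apply/funext.
    exact: cl.
  - move=> z z1; rewrite (_ : h = (fun z : C => (a + c *: b) + z *: (r%:C *: b))); last exact/funext.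
    apply: derivableD; first exact: derivable_cst.
    by apply: derivable_scale; [exact: derivable_id|exact: derivable_cst].
  - by move=> z z1; apply: cX; rewrite le_nm1.
  - by move=> z z1; apply: cX; rewrite le_nm1 z1.
have := envelope_le_circle_mean oX oX (@subset_refl _ X) gX uv hh.
by rewrite /h mulr0 addr0.
Qed.

Lemma psh_envelopeE X W (B : set (C -> Cn)) phi x : open X -> open W -> W `<=` X ->
  good_discs X W B -> usc_on W phi ->
  (forall w, W w -> (envelope B phi w <= phi w)%E) -> X x ->
  psh_envelope X W phi x = envelope (holodisc X W) phi x.
Proof.
move=> oX oW sWX gB uphi Bphi Xx; apply/eqP; rewrite eq_le; apply/andP; split.
  apply: ge_ereal_sup => _ [u [pu up] <-]; apply: le_ereal_inf_tmp => _ [f [hf fx] <-].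
  rewrite leNgt; apply/negP => /ereal_between2[a h1 h2].
  have [cf df fX fW] := hf.
  have [p [hp pa]] := usc_poly_approx (usc_disc oW uphi hf) h1.
  have := psh_disc_le oX pu cf df fX.
  move=> /(_ p) h; have {}h : (u (f 0%R) <= (Re p.[0%R])%:E)%E.
    by apply: h => z Tz; apply: le_lt_trans (up _ (fW _ Tz)) (hp z Tz).
  move: h2; rewrite -fx => /lt_le_trans/(_ h); rewrite lte_fin => /(lt_trans pa).
  by rewrite ltxx.
have uv := envelope_usc oW gB uphi.
have pu := envelope_psh oX uv.
apply: (@le_trans _ _ (envelope (holodisc X X) (envelope B phi) x)).
  apply: le_ereal_inf_tmp => _ [h [hh hx] <-]; rewrite -hx.
  exact: envelope_le_circle_mean.
apply: ereal_sup_ubound; exists (envelope (holodisc X X) (envelope B phi)) => //.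
split => // w Ww; apply: le_trans (Bphi w Ww); apply: envelope_cst.
  by apply: holodisc_cst => //; exact: sWX.
by have [] := uv w (sWX w Ww).
Qed.

End PshEnvelope.

(** * Homotopy classes of discs *)

Section Interface.
Context {R : realType} {n : nat}.
Local Notation C := R[i].
Local Notation Cn := 'rV[C]_n.
Local Notation cD := (@closed_disc R).
Implicit Types (X W : set Cn) (f g h : C -> Cn) (phi : Cn -> \bar R).

(** Radial retraction of the plane onto the closed disc. Precomposing with it extends a disc
    continuously to the plane without changing it where it matters. *)
Definition clip (z : C) : C := ((Num.max 1 (nm z))^-1)%:C * z.

Lemma clip_le1 z : nm (clip z) <= 1.
Proof.
have m0 : 0 < Num.max 1 (nm z) by rewrite lt_max ltr01.
rewrite nmM nm_real ger0_norm ?invr_ge0 ?(ltW m0)// mulrC ler_pdivrMr// mul1r.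
by rewrite le_max lexx orbT.
Qed.

Lemma clip_id z : nm z <= 1 -> clip z = z.
Proof. by move=> z1; rewrite /clip max_l// invr1 mul1r. Qed.

Lemma clip_continuous : continuous clip.
Proof.
move=> z; suff : {for z, continuous (fun z : C => ((Num.max 1 (nm z))^-1)%:C * z)} by [].
apply: cont_mul; last exact: cont_id.
apply: (@cont_comp _ _ _ (fun z : C => (Num.max 1 (nm z))^-1) (real_complex R)); last exact: complexC_continuous.
apply: (@cont_comp _ _ _ (@nm R C) (fun x : R => (Num.max 1 x)^-1)); first exact: nm_continuous.
have m0 : Num.max 1 (nm z) != 0 by rewrite gt_eqF// lt_max ltr01.
apply: (@cont_comp _ _ _ (fun x : R => Num.max 1 x) GRing.inv); last exact: inv_continuous.
by apply: continuous_max; [exact: cvg_cst|exact: cvg_id].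
Qed.

Lemma closed_disc_nm (z : C) : cD z <-> nm z <= 1.
Proof. by rewrite /closed_disc /= le_nm1. Qed.

Lemma val_nm (z : cD) : nm (val z) <= 1.
Proof. by apply/closed_disc_nm; exact: set_mem (valP z). Qed.

Lemma retract_subproof z : cD (clip z).
Proof. by apply/closed_disc_nm; exact: clip_le1. Qed.

Definition retract (z : C) : cD := SigSub (mem_set (retract_subproof z)).

Lemma retractK (z : cD) : retract (val z) = z.
Proof. by apply: val_inj; rewrite /= clip_id// val_nm. Qed.

Lemma retract0 : retract 0 = disc0.
Proof. by rewrite -[RHS]retractK. Qed.

Lemma val_retract z : nm z <= 1 -> val (retract z) = z.
Proof. exact: clip_id. Qed.

Lemma retract_continuous : continuous (retract : C -> cD).
Proof. by apply: continuous_comp_initial; exact: clip_continuous. Qed.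

Lemma disc_val_continuous : continuous (val : cD -> C).
Proof. exact: initial_continuous. Qed.

Lemma disc_ext_retract (d : cD -> Cn) z : nm z <= 1 -> disc_ext d z = d (retract z).
Proof. by move=> z1; rewrite -[in LHS](val_retract z1) disc_extE. Qed.

Lemma analytic_holodisc X W (d : cD -> Cn) : analytic_discs_in X W d ->
  holodisc X W (fun z => d (retract z)).
Proof.
move=> [[cd dd dX] dW]; split.
- move=> z; apply: (@cont_comp _ _ _ retract d); [exact: retract_continuous|exact: cd].
- move=> z z1; apply: (@near_eq_derivable _ _ _ (disc_ext d)); last by apply: dd; rewrite lt_nm1.
  have z2 : 0 < 1 - nm z by lra.
  apply: filterS (near_nm z z2) => w wz; rewrite disc_ext_retract//.
  by have := nm_triangle w z 0; rewrite !subr0; lra.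
- by move=> z _; exact: dX.
- move=> z z1; apply: dW; rewrite val_retract ?z1//.
  by rewrite eq_nm1.
Qed.

Lemma holodisc_analytic X W f : holodisc X W f ->
  analytic_discs_in X W (fun z : cD => f (val z)).
Proof.
move=> [cf df fX fW]; split; last first.
  by move=> z; rewrite eq_nm1; exact: fW.
split.
- move=> z; apply: (@cont_comp _ _ _ (val : cD -> C) f); [exact: disc_val_continuous|exact: cf].
- move=> z; rewrite lt_nm1 => z1; apply: (@near_eq_derivable _ _ _ f); last exact: df.
  have z2 : 0 < 1 - nm z by lra.
  apply: filterS (near_nm z z2) => w wz.
  have w1 : nm w <= 1 by have := nm_triangle w z 0; rewrite !subr0; lra.
  by rewrite disc_ext_retract// val_retract.
- by move=> z; apply: fX; exact: val_nm.
Qed.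

Definition to_disc X W f (hf : holodisc X W f) : disc_space X W :=
  SigSub (mem_set (holodisc_analytic hf)).

Lemma disc_analytic X W (d : disc_space X W) : analytic_discs_in X W (val d).
Proof. exact: set_mem (valP d). Qed.

Lemma disc_space_eq X W (d d' : disc_space X W) : (forall z, val d z = val d' z) -> d = d'.
Proof. by move=> h; apply: val_inj; apply/funext. Qed.

Lemma circle_mean_eq (g1 g2 : C -> \bar R) : (forall z, circle z -> g1 z = g2 z) ->
  circle_mean g1 = circle_mean g2.
Proof.
move=> g12; rewrite /circle_mean; congr (_ * _)%E; congr integral.
by apply/funext => t; apply: g12; exact: nm_expit.
Qed.

Lemma disc_envelopeE X W phi x : disc_envelope X W phi x = envelope (holodisc X W) phi x.
Proof.
rewrite /disc_envelope /envelope; congr ereal_inf; apply/seteqP; split => [_ [d /= dx <-]|_ [f [hf fx] <-]].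
  exists (fun z => val d (retract z)).
    by split; [exact: analytic_holodisc (disc_analytic d)|rewrite retract0].
  by apply: circle_mean_eq => z Tz; rewrite disc_ext_retract// Tz.
exists (to_disc hf) => //; apply: circle_mean_eq => z Tz.
by rewrite disc_ext_retract ?Tz//= clip_id// Tz.
Qed.

Lemma disc_class_homotopic X W (d0 d1 : disc_space X W) :
  disc_class d0 = disc_class d1 -> centre_homotopic d0 d1.
Proof. by move=> /eqquotP/asboolP[]. Qed.

Lemma homotopic_disc_class X W (d0 d1 : disc_space X W) :
  centre (val d0) = centre (val d1) -> centre_homotopic d0 d1 ->
  disc_class d0 = disc_class d1.
Proof. by move=> e h; apply/eqquotP/asboolP. Qed.

Definition clamp (t : R) : R := Num.max 0 (Num.min t 1).

Lemma clamp01 t : 0 <= clamp t <= 1.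
Proof. by rewrite /clamp le_max lexx ge_max ler01 ge_min lexx orbT. Qed.

Lemma clamp_id t : 0 <= t <= 1 -> clamp t = t.
Proof. by move=> /andP[t0 t1]; rewrite /clamp min_l// max_r. Qed.

Lemma clamp_continuous : continuous clamp.
Proof.
move=> t; suff : {for t, continuous (fun t : R => Num.max 0 (Num.min t 1))} by [].
apply: (@cont_comp _ _ _ (fun t : R => Num.min t 1) (fun t => Num.max 0 t)).
  by apply: continuous_min; [exact: cvg_id|exact: cvg_cst].
by apply: continuous_max; [exact: cvg_cst|exact: cvg_id].
Qed.

Lemma homotopic_holodisc X W (d0 d1 : disc_space X W) : centre_homotopic d0 d1 ->
  exists H : R -> C -> Cn, [/\ continuous (fun q : R * C => H q.1 q.2),
    forall t, 0 <= t <= 1 -> holodisc X W (H t) /\ H t 0 = centre (val d0),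
    forall z, nm z <= 1 -> H 0 z = val d0 (retract z) &
    forall z, nm z <= 1 -> H 1 z = val d1 (retract z)].
Proof.
move=> [F [/subspace_continuousP cF hF F0 F1]].
exists (fun t z => F (retract z, clamp t)); split.
- move=> q; pose r (q : R * C) : cD * R := (retract q.2, clamp q.1).
  have cr : continuous r.
    move=> q'; suff : {for q', continuous (fun q : R * C => (retract q.2, clamp q.1))} by [].
    apply: cont_pair.
      by apply: (@cont_comp _ _ _ (snd : R * C -> C) retract); [exact: cvg_snd|exact: retract_continuous].
    by apply: (@cont_comp _ _ _ (fst : R * C -> R) clamp); [exact: cvg_fst|exact: clamp_continuous].
  have Ar q' : ([set: cD] `*` `[0, 1]) (r q') by split => //=; rewrite in_itv /=; exact: clamp01.
  move=> U /= /(cF _ (Ar q)) hU.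
  have := cr q _ hU; apply: (@filterS _ (nbhs q)) => q' /=; apply; exact: Ar.
- move=> t t01; have [h1 h2] := hF _ (clamp01 t); split; last by rewrite retract0.
  exact: (analytic_holodisc h1).
- by move=> z _; rewrite clamp_id ?F0// lexx ler01.
- by move=> z _; rewrite clamp_id ?F1// lexx ler01.
Qed.

Lemma holodisc_homotopic X W (d0 d1 : disc_space X W) (H : R -> C -> Cn) :
  continuous (fun q : R * C => H q.1 q.2) ->
  (forall t, 0 <= t <= 1 -> holodisc X W (H t) /\ H t 0 = centre (val d0)) ->
  (forall z, val d0 z = H 0 (val z)) -> (forall z, val d1 z = H 1 (val z)) ->
  disc_class d0 = disc_class d1.
Proof.
move=> cH hH H0 H1; apply: homotopic_disc_class.
  have [|_ <-] := hH 1; first by rewrite ler01 lexx.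
  by rewrite /centre H1.
exists (fun q => H q.2 (val q.1)); split => //.
  apply: continuous_subspaceT => q.
  apply: (@cont_comp _ _ _ (fun q : cD * R => (q.2, val q.1)) (fun q : R * C => H q.1 q.2)); last exact: cH.
  apply: cont_pair; first exact: cvg_snd.
  by apply: (@cont_comp _ _ _ (fst : cD * R -> cD) val); [exact: cvg_fst|exact: disc_val_continuous].
by move=> t /hH[/holodisc_analytic].
Qed.

Lemma entourage_nm (E : set (Cn * Cn)) : entourage E ->
  exists2 e : R, 0 < e & forall x y, nm (x - y) < e -> E (x, y).
Proof.
rewrite -entourage_ballE => -[e /= e0 h].
have [r re] : exists r, e = r%:C by exists (Re e); rewrite RRe_real// gtr0_real.
exists r; first by move: e0; rewrite re ltcR.
move=> x y xy; apply: h; rewrite /= -ball_normE /=.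
by rewrite nmE re ltcR.
Qed.

Lemma nm_entourage (e : R) : 0 < e -> entourage [set xy : Cn * Cn | nm (xy.1 - xy.2) < e].
Proof.
move=> e0; rewrite -entourage_ballE; exists e%:C; first by rewrite /= ltcR.
by move=> [x y] /=; rewrite -ball_normE /= nmE ltcR.
Qed.

Lemma disc_nbhs X W (d : disc_space X W) (e : R) : 0 < e ->
  \forall d' \near d, forall z, nm (val d z - val d' z) < e.
Proof.
move=> e0; have cv : continuous (val : disc_space X W -> {uniform cD -> Cn}) by exact: initial_continuous.
have h : nbhs (val d : {uniform cD -> Cn}) [set k | forall z : cD, nm (val d z - k z) < e].
  apply/uniform_nbhs; exists [set xy : Cn * Cn | nm (xy.1 - xy.2) < e].
  by split; [exact: nm_entourage|move=> k hk z; exact: hk].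
exact: (cv d _ h).
Qed.

Lemma path_component X W (d0 d1 : disc_space X W) (H : R -> C -> Cn) :
  continuous (fun q : R * C => H q.1 q.2) ->
  (forall t, 0 <= t <= 1 -> holodisc X W (H t)) ->
  (forall z, val d0 z = H 0 (val z)) -> (forall z, val d1 z = H 1 (val z)) ->
  connected_component setT (disc_class d0) (disc_class d1).
Proof.
move=> cH hH H0 H1; pose gam t : disc_space X W := to_disc (hH _ (clamp01 t)).
have cg : continuous (fun t => val (gam t) : {uniform cD -> Cn}).
  move=> t U /uniform_nbhs[E [/entourage_nm[e e0 hE] EU]].
  have e20 : 0 < e / 2 by lra.
  move: (@compact_nm_le R 1) => /compact_near_coveringP/near_covering_withinP cK.
  have h : \forall s \near t, forall z : C, nm z <= 1 -> nm (H (clamp t) z - H (clamp s) z) < e.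
    apply: (cK R (nbhs t) (fun s z => nm (H (clamp t) z - H (clamp s) z) < e)) => z _.
    have cHc : {for (t, z), continuous (fun q : R * C => H (clamp q.1) q.2)}.
      apply: (@cont_comp _ _ _ (fun q : R * C => (clamp q.1, q.2)) (fun q : R * C => H q.1 q.2)); last exact: cH.
      apply: cont_pair; last exact: cvg_snd.
      by apply: (@cont_comp _ _ _ (fst : R * C -> R) clamp); [exact: cvg_fst|exact: clamp_continuous].
    have /cont_nmP/(_ _ e20)[[A1 A2] [/= nA1 nA2] hA] := cHc.
    exists (A2, A1) => // -[z' s] [/= zA sA] _.
    have h1 := hA (s, z') (conj sA zA).
    have h2 := hA (t, z') (conj (nbhs_singleton nA1) zA).
    by move: h1 h2 => /= h1 h2; have := nm_triangle (H (clamp t) z') (H (clamp t) z) (H (clamp s) z'); rewrite (nmBC (H (clamp t) z) (H (clamp s) z')); lra.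
  by apply: filterS h => s hs; apply: EU => z _; apply: hE; apply: hs; exact: val_nm.
have cd : continuous gam by apply: continuous_comp_initial.
have cc : continuous (fun t => disc_class (gam t)).
  move=> t; apply: (@continuous_comp _ _ _ gam); [exact: cd|exact: pi_continuous].
have g0 : gam 0 = d0 by apply: disc_space_eq => z; rewrite H0 /= clamp_id// lexx ler01.
have g1 : gam 1 = d1 by apply: disc_space_eq => z; rewrite H1 /= clamp_id// lexx ler01.
exists ((fun t => disc_class (gam t)) @` `[0, 1]).
  split => //; first by exists 0; rewrite ?g0//= in_itv /= lexx ler01.
  apply: connected_continuous_connected; first exact: segment_connected.
  exact: continuous_subspaceT.
by exists 1; rewrite ?g1//= in_itv /= lexx ler01.
Qed.

Definition class_family X W (Q : set (disc_classes X W)) : set (C -> Cn) :=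
  [set f | holodisc X W f /\ exists2 d : disc_space X W,
    (forall z, val d z = f (val z)) & Q (disc_class d)].

Lemma good_class_family X W (Q : set (disc_classes X W)) :
  set_bij Q X (@class_centre R n X W) ->
  (forall f, class_family Q f -> \forall y \near f 0, class_family Q (fun z => f z + (y - f 0))) ->
  good_discs X W (class_family Q).
Proof.
move=> [Qf Qi Qs] shift; split => //.
- by move=> f [].
- move=> x /Qs[q Qq qx]; have qE : disc_class (repr q) = q by rewrite /disc_class reprK.
  exists (fun z => val (repr q) (retract z)).
    split; first exact: analytic_holodisc (disc_analytic _).
    by exists (repr q); [move=> z; rewrite retractK|rewrite qE].
  by rewrite retract0.
move=> f g [hf [d df Qd]] [hg [d' dg Qd']] fg.
have cE k (dk : disc_space X W) : (forall z, val dk z = k (val z)) -> centre (val dk) = k 0.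
  by move=> dkE; rewrite /centre dkE.
have e : disc_class d = disc_class d'.
  by apply: Qi; rewrite ?inE// !class_centreE (cE f) // (cE g).
have [H [cH hH H0 H1]] := homotopic_holodisc (disc_class_homotopic e).
exists H; split => //.
- by move=> t /hH[? ->]; split => //; exact: cE.
- by move=> z z1; rewrite H0// df /= clip_id.
- by move=> z z1; rewrite H1// dg /= clip_id.
Qed.

End Interface.

(** * Stability under translations *)

Section Shift.
Context {R : realType} {n : nat}.
Local Notation C := R[i].
Local Notation Cn := 'rV[C]_n.
Variables (X W : set Cn).
Hypotheses (oX : open X) (oW : open W).
Implicit Types (f g h : C -> Cn).

Lemma class_family_path (p : disc_classes X W) f (H : R -> C -> Cn) :
  class_family (connected_component setT p) f ->
  continuous (fun q : R * C => H q.1 q.2) ->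
  (forall t, 0 <= t <= 1 -> holodisc X W (H t)) ->
  (forall z, nm z <= 1 -> H 0 z = f z) ->
  class_family (connected_component setT p) (H 1).
Proof.
move=> [hf [d df pd]] cH hH H0.
have h1 : holodisc X W (H 1) by apply: hH; rewrite ler01 lexx.
split => //; exists (to_disc h1) => //.
rewrite (same_connected_component pd); apply: path_component cH hH _ _ => //.
by move=> z; rewrite df H0// val_nm.
Qed.

Lemma component_shift (p : disc_classes X W) f :
  class_family (connected_component setT p) f ->
  \forall y \near f 0, class_family (connected_component setT p) (fun z => f z + (y - f 0)).
Proof.
move=> Bf; have [e e0 he] := holodisc_shift oX oW (proj1 Bf).
apply: filterS (near_nm (f 0) e0) => y ye.
have -> : (fun z => f z + (y - f 0)) = (fun z => f z + (1%:C : C) *: (y - f 0)).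
  by apply/funext => z; rewrite scale1r.
apply: (@class_family_path p f (fun t z => f z + t%:C *: (y - f 0)) Bf).
- have [[cf _ _ _] _] := Bf.
  move=> q; apply: (@cont_add _ _ _ (fun q : R * C => f q.2)).
    by apply: (@cont_comp _ _ _ (snd : R * C -> C) f); [exact: cvg_snd|exact: cf].
  apply: (@cont_scale _ _ _ (fun q : R * C => (q.1)%:C)); last exact: cont_cst.
  by apply: (@cont_comp _ _ _ (fst : R * C -> R) (real_complex R)); [exact: cvg_fst|exact: complexC_continuous].
- move=> t /andP[t0 t1]; apply: he; rewrite nmZ nm_real ger0_norm//.
  by apply: le_lt_trans ye; rewrite ler_piMl// nm_ge0.
- by move=> z _; rewrite scale0r addr0.
Qed.

(* A disc near [g] is joined to a translate of [g] by linear interpolation, and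
   a homotopy from [g] can be translated along. *)
Lemma translates_open f (e : R) :
  (forall v, nm v < e -> holodisc X W (fun z => f z + v)) ->
  open [set q : disc_classes X W | exists2 v, nm v < e &
    exists2 d : disc_space X W, (forall z, val d z = f (val z) + v) & q = disc_class d].
Proof.
move=> he; rewrite /open /= /quotient_open openE => g /= [v ve [d dE gd]].
have [H [cH hH H0 H1]] := homotopic_holodisc (disc_class_homotopic (esym gd)).
pose KX : set (R * C) := [set` `[0%R, 1%R]] `*` [set z : C | nm z <= 1].
pose KW : set (R * C) := [set` `[0%R, 1%R]] `*` circle.
have cKX : compact KX by apply: compact_setX; [exact: segment_compact|exact: compact_nm_le].
have cKW : compact KW by apply: compact_setX; [exact: segment_compact|exact: compact_circle].
have HX q : KX q -> X (H q.1 q.2).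
  by move=> [/=]; rewrite in_itv => q1 q2; have [[_ _ h3 _] _] := hH _ q1; exact: h3.
have HW q : KW q -> W (H q.1 q.2).
  by move=> [/=]; rewrite in_itv => q1 q2; have [[_ _ _ h4] _] := hH _ q1; exact: h4.
have [e1 e10 he1] := set_tube oX cKX (fun q _ => cH q) HX.
have [e2 e20 he2] := set_tube oW cKW (fun q _ => cH q) HW.
have m0 : 0 < Num.min (Num.min e1 e2) (e - nm v) by rewrite !lt_min e10 e20 subr_gt0.
apply: filterS (disc_nbhs g m0) => g2 hg2 /=.
pose k z := val g2 (retract z) - val g (retract z).
pose v2 := k 0.
have kb z : nm (k z) < Num.min (Num.min e1 e2) (e - nm v) by rewrite /k nmBC; exact: hg2.
have v2e : nm (v + v2) < e.
  have := kb 0; rewrite -/v2 !lt_min => /andP[_ h].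
  by have := nmD v v2; lra.
have [cg dg _ _] := analytic_holodisc (disc_analytic g).
have [cg2 dg2 _ _] := analytic_holodisc (disc_analytic g2).
have ck : continuous k by move=> z; apply: (cont_sub (cg2 z) (cg z)).
have dk z : nm z < 1 -> derivable k z 1 by move=> z1; apply: (derivableB (dg2 z z1) (dg z z1)).
exists (v + v2) => //; exists (to_disc (he _ v2e)); first by move=> z.
rewrite -[LHS]/(disc_class g2); apply/esym.
(* Joins the translate by [v + v2] at [t = 0] to [g2] at [t = 1]. The added term has the value [v2]
   at [z = 0] for every [t], so the centre stays fixed. *)
pose M t z := H t z + ((1 - t)%:C *: v2 + t%:C *: k z).
have Mb t z : 0 <= t <= 1 -> nm z <= 1 -> nm (M t z - H t z) < Num.min (Num.min e1 e2) (e - nm v).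
  move=> /andP[t0 t1] z1; rewrite /M addrC addKr.
  apply: le_lt_trans (nmD _ _) _; rewrite !nmZ !nm_real !ger0_norm ?subr_ge0//.
  have := kb 0; have := kb z; rewrite -/v2; set B := Num.min _ _ => h1 h2.
  have [t00|t0'] := eqVneq t 0; first by rewrite t00 subr0 mul1r mul0r addr0.
  have tp : 0 < t by rewrite lt_neqAle eq_sym t0'.
  have : t * nm (k z) < t * B by rewrite ltr_pM2l.
  have : (1 - t) * nm v2 <= (1 - t) * B by rewrite ler_wpM2l ?subr_ge0// ltW.
  lra.
apply: (@holodisc_homotopic _ _ _ _ _ _ M).
- move=> q; suff : {for q, continuous (fun q : R * C => H q.1 q.2 + ((1 - q.1)%:C *: v2 + (q.1)%:C *: k q.2))} by [].
  apply: cont_add; first exact: cH.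
  have c1 (m : R -> R) : continuous m -> {for q, continuous (fun q : R * C => (m q.1)%:C)}.
    move=> cm; apply: (@cont_comp _ _ _ (fst : R * C -> R) (fun t => (m t)%:C)); first exact: cvg_fst.
    by apply: (@cont_comp _ _ _ m (real_complex R)); [exact: cm|exact: complexC_continuous].
  apply: cont_add; apply: cont_scale.
  + apply: (c1 (fun t => 1 - t)) => t.
    by apply: cont_sub; [exact: cont_cst|exact: cont_id].
  + exact: cont_cst.
  + by apply: (c1 id) => t; exact: cont_id.
  + by apply: (@cont_comp _ _ _ (snd : R * C -> C) k); [exact: cvg_snd|exact: ck].
- move=> t t01; have [[cHt dHt _ _] Ht0] := hH t t01; split; last first.
    rewrite /M Ht0 -/v2 -scalerDl -rmorphD subrK scale1r /centre /= (dE disc0).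
    by rewrite -addrA.
  split.
  + move=> z; suff : {for z, continuous (fun z : C => H t z + ((1 - t)%:C *: v2 + t%:C *: k z))} by [].
    apply: cont_add; first exact: cHt.
    apply: cont_add; first exact: cont_cst.
    by apply: cont_scale; [exact: cont_cst|exact: ck].
  + move=> z z1; apply: derivableD; first exact: dHt.
    apply: derivableD; first exact: derivable_cst.
    by apply: derivable_scale; [exact: derivable_cst|exact: dk].
  + move=> z z1; apply: (he1 (t, z)); first by split => //=; rewrite in_itv.
    by have := Mb t z t01 z1; rewrite !lt_min => /andP[/andP[]].
  + move=> z z1; apply: (he2 (t, z)); first by split => //=; rewrite in_itv.
    by have := Mb t z t01; rewrite z1 lexx !lt_min => /(_ isT)/andP[/andP[]].
- move=> z; have E0 : H 0 (val z) = f (val z) + v.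
    by rewrite H0 ?val_nm// retractK; exact: dE.
  rewrite /M /= E0 subr0 scale1r scale0r addr0.
  by rewrite -addrA.
- move=> z; rewrite /M /= H1 ?val_nm// /k retractK subrr scale0r add0r scale1r.
  by rewrite addrC subrK.
Qed.

(** The classes of small translates of [f] form an open set, whose preimage under [s] is a
    neighbourhood of the centre. For [y] in it, [s y] is the class of some [f + v], and comparing
    centres forces [v = y - f 0]. *)
Lemma section_shift (s : X -> disc_classes X W) f : continuous s ->
  (forall x, class_centre (s x) = val x) -> class_family (range s) f ->
  \forall y \near f 0, class_family (range s) (fun z => f z + (y - f 0)).
Proof.
move=> cs sX [hf [d df [x _ sx]]].
have x0 : val x = f 0 by rewrite -sX sx class_centreE /centre df.
have [e e0 he] := holodisc_shift oX oW hf.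
have /continuousP cs' := cs; have [B oB BE] := cs' _ (translates_open he).
have Bx : (val @^-1` B) x.
  rewrite BE; exists 0; first by rewrite nm0.
  by exists d => //; move=> z; rewrite addr0.
have nX : \forall y \near f 0, X y.
  by apply: open_nbhs_nbhs; split => //; rewrite -x0; exact: set_mem (valP x).
have nB : \forall y \near f 0, B y by apply: open_nbhs_nbhs; split => //; rewrite -x0.
apply: filterS (filterI nX nB) => y [Xy By].
have : (val @^-1` B) (SigSub (mem_set Xy) : X) by [].
rewrite BE => -[v ve [d' d'E sd]].
have vE : v = y - f 0.
  have := sX (SigSub (mem_set Xy) : X).
  by rewrite sd class_centreE /centre d'E /= => <-; rewrite addrC addKr.
rewrite -vE; split; first exact: he.
by exists d' => //; rewrite -sd; exists (SigSub (mem_set Xy) : X).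
Qed.

End Shift.

(** * Boundary values *)

Section Boundary.
Context {R : realType} {n : nat}.
Local Notation C := R[i].
Local Notation Cn := 'rV[C]_n.
Implicit Types (f g h : C -> Cn).

(* The disc automorphism taking [0] to [a], precomposed with [clip] to be
   continuous on the whole plane. *)
Definition moebius (a : R) (z : C) : C := (clip z + a%:C) / (1 + a%:C * clip z).

Lemma moebius_den (a : R) (z : C) : 0 <= a < 1 -> nm z <= 1 -> 1 + a%:C * z != 0.
Proof.
move=> /andP[a0 a1] z1; apply/negP => /eqP h.
have : nm (a%:C * z) = 1.
  by rewrite (_ : a%:C * z = -1) ?nmN ?nm1//; apply/eqP; rewrite -addr_eq0 addrC h.
rewrite nmM nm_real ger0_norm// => e.
have : a * nm z <= a by rewrite ler_piMr.
lra.
Qed.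

Lemma moebius_nm2 (a : R) (z : C) :
  nm (1 + a%:C * z) ^+ 2 - nm (z + a%:C) ^+ 2 = (1 - a ^+ 2) * (1 - nm z ^+ 2).
Proof. by rewrite !nm2E; case: z => x y /=; ring. Qed.

Lemma moebius_le1 (a : R) z : 0 <= a < 1 -> nm (moebius a z) <= 1.
Proof.
move=> a01; have h := moebius_den a01 (clip_le1 z).
have d0 : 0 < nm (1 + a%:C * clip z).
  by rewrite lt_neqAle nm_ge0 andbT eq_sym; apply: contra h => /eqP/nm_eq0 ->.
rewrite /moebius nmM nmV ler_pdivrMr// mul1r -ler_sqr ?nnegrE ?nm_ge0//.
rewrite -subr_ge0 moebius_nm2; have := clip_le1 z; have := nm_ge0 (clip z).
move: (nm (clip z)) a01 => t /andP[? ?] ? ?; apply: mulr_ge0; nra.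
Qed.

Lemma moebius_circle (a : R) z : 0 <= a < 1 -> nm z = 1 -> nm (moebius a z) = 1.
Proof.
move=> a01 z1; have cz : clip z = z by rewrite clip_id ?z1.
have h := moebius_den a01 (clip_le1 z).
have d0 : 0 < nm (1 + a%:C * clip z).
  by rewrite lt_neqAle nm_ge0 andbT eq_sym; apply: contra h => /eqP/nm_eq0 ->.
have := moebius_nm2 a (clip z); rewrite {3}cz z1 expr1n subrr mulr0.
move=> /eqP; rewrite subr_eq0 eqrXn2 ?nm_ge0// => /eqP e.
by rewrite /moebius nmM nmV -e divff// gt_eqF.
Qed.

Lemma moebius_lt1 (a : R) z : 0 <= a < 1 -> nm z < 1 -> nm (moebius a z) < 1.
Proof.
move=> a01 z1; have cz : clip z = z by rewrite clip_id// ltW.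
have h := moebius_den a01 (clip_le1 z).
have d0 : 0 < nm (1 + a%:C * clip z).
  by rewrite lt_neqAle nm_ge0 andbT eq_sym; apply: contra h => /eqP/nm_eq0 ->.
rewrite /moebius nmM nmV ltr_pdivrMr// mul1r -ltr_sqr ?nnegrE ?nm_ge0//.
rewrite -subr_gt0 moebius_nm2 {1}cz; move: z1; have := nm_ge0 z.
move: (nm z) a01 => t /andP[? ?] ? ?; apply: mulr_gt0; nra.
Qed.

Lemma moebius0 (a : R) : moebius a 0 = a%:C.
Proof. by rewrite /moebius clip_id ?nm0// mulr0 add0r addr0 divr1. Qed.

Lemma moebius_id z : nm z <= 1 -> moebius 0 z = z.
Proof. by move=> z1; rewrite /moebius clip_id// mul0r !addr0 divr1. Qed.

Lemma moebius_derivable (a : R) z : 0 <= a < 1 -> nm z < 1 -> derivable (moebius a) z 1.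
Proof.
move=> a01 z1; apply: (@near_eq_derivable _ _ _ (fun w => (w + a%:C) / (1 + a%:C * w))).
  have z2 : 0 < 1 - nm z by lra.
  apply: filterS (near_nm z z2) => w wz; rewrite /moebius clip_id//.
  by have := nm_triangle w z 0; rewrite !subr0; lra.
have -> : (fun w : C => (w + a%:C) / (1 + a%:C * w)) =
    (fun w => ('X + a%:C%:P).[w] * ((1 + a%:C *: 'X).[w])^-1).
  by apply/funext => w; rewrite !hornerE.
apply: derivableM; first exact: derivable_poly.
apply: derivableV; last exact: derivable_poly.
by rewrite !hornerE moebius_den// ltW.
Qed.

(** The difference to 1 is [(1 - a) (z - 1) / (1 + a z)], and the denominator is at least
    [|1 + z| - (1 - a)], hence at least [d / 2]. *)
Lemma moebius_near1 (a d : R) (z : C) : 0 <= a < 1 -> nm z = 1 -> 0 < d -> d <= nm (z + 1) ->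
  1 - a <= d / 2 -> nm (moebius a z - 1) <= 4 * (1 - a) / d.
Proof.
move=> a01 z1 d0 dz ad; have /andP[a0 a1] := a01.
have cz : clip z = z by rewrite clip_id ?z1.
have h := moebius_den a01 (clip_le1 z).
have aR : nm (1 - a%:C : C) = 1 - a.
  by rewrite -(rmorph1 (real_complex R)) -rmorphB nm_real ger0_norm//; lra.
have dn : d / 2 <= nm (1 + a%:C * z).
  have := nmD (1 + a%:C * z) ((1 - a%:C) * z); rewrite nmM aR z1.
  rewrite (_ : 1 + a%:C * z + (1 - a%:C) * z = z + 1); last by ring.
  lra.
have -> : moebius a z - 1 = (1 - a%:C) * (z - 1) / (1 + a%:C * z).
  by move: h; rewrite /moebius cz => h; field.
have d20 : 0 < nm (1 + a%:C * z) by lra.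
rewrite !nmM nmV aR ler_pdivrMr//.
have z2 : nm (z - 1) <= 2 by have := nmD z (-1); rewrite nmN nm1 z1; lra.
apply: (@le_trans _ _ ((1 - a) * 2)); first by rewrite ler_wpM2l//; lra.
have -> : (1 - a) * 2 = 4 * (1 - a) / d * (d / 2) by field; rewrite gt_eqF.
by rewrite ler_wpM2l// divr_ge0 ?(ltW d0)//; lra.
Qed.

Lemma moebius_continuous (a : R) : 0 <= a < 1 ->
  continuous (fun q : R * C => moebius (clamp q.1 * a) q.2).
Proof.
move=> /andP[a0 a1] q.
have ca01 t : 0 <= clamp t * a < 1.
  have /andP[c0 c1] := clamp01 t; apply/andP; split; first exact: mulr_ge0.
  by apply: le_lt_trans a1; rewrite ler_piMl.
have c1 : {for q, continuous (fun q : R * C => clip q.2)}.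
  by apply: (@cont_comp _ _ _ (snd : R * C -> C) clip); [exact: cvg_snd|exact: clip_continuous].
have c2 : {for q, continuous (fun q : R * C => (clamp q.1 * a)%:C)}.
  apply: (@cont_comp _ _ _ (fun q : R * C => clamp q.1 * a) (real_complex R)); last exact: complexC_continuous.
  apply: cont_mul; last exact: cont_cst.
  by apply: (@cont_comp _ _ _ (fst : R * C -> R) clamp); [exact: cvg_fst|exact: clamp_continuous].
suff : {for q, continuous (fun q : R * C => (clip q.2 + (clamp q.1 * a)%:C) * (1 + (clamp q.1 * a)%:C * clip q.2)^-1)} by [].
apply: cont_mul; first by apply: cont_add; [exact: c1|exact: c2].
have c3 : {for q, continuous (fun q : R * C => 1 + (clamp q.1 * a)%:C * clip q.2)}.
  by apply: cont_add; [exact: cont_cst|apply: cont_mul; [exact: c2|exact: c1]].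
apply: (@cont_comp _ _ _ (fun q : R * C => 1 + (clamp q.1 * a)%:C * clip q.2) GRing.inv); first exact: c3.
apply: inv_continuous.
exact: moebius_den (ca01 _) (clip_le1 _).
Qed.

Variables (X W : set Cn) (p : disc_classes X W).
Hypotheses (oX : open X) (oW : open W) (sWX : W `<=` X).
Local Notation B := (class_family (connected_component setT p)).

(* The perturbation [z |-> ((1 + z) / 2) ^ 2N v] moves the boundary value at
   [1] by [v] and is small away from [1]. *)
Lemma boundary_value_move f w (r : R) : B f -> 0 < r ->
  (forall x, nm (x - w) < r -> W x) -> nm (f 1 - w) < r / 3 ->
  exists2 g, B g & g 1 = w.
Proof.
move=> Bf r0 rW fw; have [[cf df fX fW] _] := Bf.
have [e1 e10 h1] := set_tube oX (@compact_nm_le R 1) (fun z _ => cf z) fX.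
have [e2 e20 h2] := set_tube oW (@compact_circle R) (fun z _ => cf z) fW.
have r30 : 0 < r / 3 by lra.
have /cont_nmP/(_ _ r30)/nbhs_nmP[d' d'0 hd'] := cf 1.
pose d := Num.min d' 1.
have [d0 [d1 dd']] : 0 < d /\ d <= 1 /\ d <= d'.
  split; first by rewrite lt_min d'0 ltr01.
  by split; rewrite /d ge_min lexx ?orbT.
have hd (z : C) : nm (z - 1) < d -> nm (f z - f 1) < r / 3 by move=> zd; apply: hd'; lra.
clearbody d.
(* By the parallelogram law [|(1 + z) / 2|^2 <= q] for [|z| <= 1] with [|z - 1| >= d], so the
   perturbation is at most [q^N |v|] there. *)
have q01 : 0 <= 1 - d ^+ 2 / 4 < 1 by apply/andP; split; nra.
set q := 1 - d ^+ 2 / 4 in q01.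
pose e := Num.min e1 e2.
have e0 : 0 < e by rewrite lt_min e10.
have er0 : 0 < e / (2 * r) by rewrite divr_gt0//; lra.
have [N hN] := exists_lin_geom q01 er0.
have qN : q ^+ N * r < e.
  have qN0 : 0 <= q ^+ N by rewrite exprn_ge0//; case/andP: q01.
  have : q ^+ N <= e / (2 * r).
    by apply: le_trans hN; rewrite ler_peMl// ler1n; clear; lia.
  rewrite ler_pdivlMr; last by lra.
  lra.
pose v := w - f 1; pose ka := (2^-1 *: (1 + 'X) : {poly C}) ^+ (2 * N).
have kaE (z : C) : nm ka.[z] = (nm (1 + z) / 2) ^+ (2 * N).
  rewrite /ka horner_exp nmX hornerZ !hornerE nmM nmV mulrC.
  by rewrite (_ : 2 = (2 : R)%:C) ?nm_real ?ger0_norm// rmorphD rmorph1.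
have n1z (z : C) : nm z <= 1 -> nm (1 + z) <= 2 by move=> z1; have := nmD (1 : C) z; rewrite nm1; lra.
have ka1 (z : C) : nm z <= 1 -> nm ka.[z] <= 1.
  move=> /n1z h; rewrite kaE exprn_ile1//; last by lra.
  by rewrite divr_ge0 ?nm_ge0.
have kafar (z : C) : nm z <= 1 -> d <= nm (z - 1) -> nm ka.[z] <= q ^+ N.
  move=> z1 dz; rewrite kaE exprM lerXn2r ?nnegrE ?sqr_ge0//; first by case/andP: q01.
  have : nm (1 + z) ^+ 2 + nm (z - 1) ^+ 2 = 2 + 2 * nm z ^+ 2.
    by rewrite !nm2E; case: (z) => x y /=; ring.
  have dd : d ^+ 2 <= nm (z - 1) ^+ 2 by rewrite ler_sqr ?nnegrE ?nm_ge0// ltW.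
  have : nm z ^+ 2 <= 1 by rewrite expr_le1// nm_ge0.
  by rewrite expr_div_n /q; lra.
have vb : nm v < r / 3 by rewrite /v nmBC.
pose H (t : R) z := f z + (t%:C * ka.[z]) *: v.
(* Away from 1 the perturbation is below [e], so the tubes around [f] apply. Near 1 the value
   differs from [w] by three terms below [r / 3], hence lies in the ball around [w] contained in
   [W]. *)
have key t z : 0 <= t <= 1 -> nm z <= 1 -> nm (H t z - f z) < e \/ W (H t z).
  move=> /andP[t0 t1] z1.
  have tk : nm ((t%:C * ka.[z]) *: v) <= nm ka.[z] * nm v.
    rewrite nmZ nmM nm_real ger0_norm// -mulrA ler_piMl// mulr_ge0 ?nm_ge0//.
  have [zd|dz] := ltP (nm (z - 1)) d.
    right; apply: rW; rewrite /H.
    have -> : f z + (t%:C * ka.[z]) *: v - w = (f z - f 1) + ((t%:C * ka.[z]) *: v + (f 1 - w)).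
      by apply/rowP => i; rewrite !mxE; ring.
    have := nmD (f z - f 1) ((t%:C * ka.[z]) *: v + (f 1 - w)).
    have := nmD ((t%:C * ka.[z]) *: v) (f 1 - w).
    have := hd z zd; have : nm ka.[z] * nm v <= nm v by rewrite ler_piMl ?nm_ge0// ka1.
    lra.
  left; rewrite /H addrC addKr; apply: le_lt_trans tk _.
  apply: le_lt_trans qN; apply: ler_pM; rewrite ?nm_ge0 ?kafar//; lra.
exists (H 1); last first.
  rewrite /H (_ : ka.[1] = 1) ?mulr1 ?scale1r; first by rewrite /v addrC subrK.
  rewrite /ka horner_exp hornerZ !hornerE (_ : 1 + 1 = 2 :> C) ?mulVf ?expr1n//.
apply: (@class_family_path _ _ _ _ p f H Bf).
- move=> s; apply: (@cont_add _ _ _ (fun q : R * C => f q.2)).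
    by apply: (@cont_comp _ _ _ (snd : R * C -> C) f); [exact: cvg_snd|exact: cf].
  apply: (@cont_scale _ _ _ (fun q : R * C => (q.1)%:C * ka.[q.2])); last exact: cont_cst.
  apply: cont_mul.
    by apply: (@cont_comp _ _ _ (fst : R * C -> R) (real_complex R)); [exact: cvg_fst|exact: complexC_continuous].
  by apply: (@cont_comp _ _ _ (snd : R * C -> C) (horner ka)); [exact: cvg_snd|exact: continuous_poly].
- move=> t t01; split.
  + move=> z; suff : {for z, continuous (fun z : C => f z + (t%:C * ka.[z]) *: v)} by [].
    apply: cont_add; first exact: cf.
    apply: cont_scale; last exact: cont_cst.
    by apply: cont_mul; [exact: cont_cst|exact: continuous_poly].
  + move=> z z1; apply: derivableD; first exact: df.
    apply: derivable_scale; last exact: derivable_cst.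
    have -> : (fun w : C => t%:C * ka.[w]) = (fun w => (t%:C *: ka).[w]).
      by apply/funext => x; rewrite hornerZ.
    exact: derivable_poly.
  + move=> z z1; have [he|hW] := key t z t01 z1; last exact: sWX.
    by apply: (h1 z) => //; move: he; rewrite lt_min => /andP[].
  + move=> z z1; have z1' : nm z <= 1 by rewrite z1.
    have [he|//] := key t z t01 z1'.
    by apply: (h2 z) => //; move: he; rewrite lt_min => /andP[].
- by move=> z _; rewrite /H mul0r scale0r addr0.
Qed.

Lemma boundary_values : connected W -> B !=set0 ->
  forall w, W w -> exists2 f, B f & f 1 = w.
Proof.
move=> cW [f0 Bf0]; have BW f : B f -> W (f 1).
  by move=> [[_ _ _ h] _]; apply: h; exact: nm1.
pose E : set Cn := [set f 1 | f in B].
have EW : E `<=` W by move=> _ [f Bf <-]; exact: BW.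
have Wr w : W w -> exists2 r : R, 0 < r & forall x, nm (x - w) < r -> W x.
  by move=> Ww; apply: nbhs_nmP; exact: open_nbhs_nbhs (conj oW Ww).
suff EE : E = W.
  move=> w Ww; have : E w by rewrite EE.
  by move=> [f Bf fw]; exists f.
apply: cW.
- by exists (f0 1); exists f0.
- exists E; last by apply/seteqP; split => [x Ex|x []//]; split => //; exact: EW.
  rewrite openE => _ [f Bf <-] /=; have [r r0 hr] := Wr _ (BW f Bf).
  (* A third of [r / 2], the radius of a ball around the new value [y] that still lies in [W]. *)
  have r40 : 0 < r / 6 by lra.
  apply: filterS (near_nm (f 1) r40) => y yf.
  have r20 : 0 < r / 2 by lra.
  have [|| g Bg gy] := @boundary_value_move f y (r / 2) Bf r20; last by exists g.
    by move=> x xy; apply: hr; have := nm_triangle x y (f 1); lra.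
  by rewrite nmBC; lra.
exists (closure E); first exact: closed_closure.
apply/seteqP; split=> [x Ex|x [Wx cx]].
  by split; [exact: EW|exact: subset_closure].
have [r r0 hr] := Wr _ Wx; have r30 : 0 < r / 3 by lra.
have [_ [[f Bf <-] fx]] := cx _ (near_nm x r30).
by have [g Bg gx] := boundary_value_move Bf r0 hr fx; exists g.
Qed.

(* Precomposing with Moebius maps concentrates the boundary values of a disc
   at its value at [1]. *)
Lemma envelope_boundary phi f : usc_on W phi -> B f -> (envelope B phi (f 1%R) <= phi (f 1%R))%E.
Proof.
move=> uphi Bf; have [[cf df fX fW] _] := Bf; set w := f 1.
have Ww : W w by apply: fW; exact: nm1.
rewrite leNgt; apply/negP => /ereal_between2[q0 h1 h2].
have [q qw qq0] := ereal_between h1.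
have [r r0 hr] : exists2 r : R, 0 < r & forall x, nm (x - w) < r -> (phi x < q%:E)%E.
  have [_ /(_ _ qw) h] := uphi w Ww.
  have h' : \forall x \near w, W x -> (phi x < q%:E)%E by exact: h.
  have hW : \forall x \near w, W x by apply: open_nbhs_nbhs.
  apply: nbhs_nmP; apply: filterS (filterI h' hW) => x [hx Wx]; exact: hx.
have [M M0 hM] := usc_bounded (@compact_circle R) (usc_comp oW uphi (fun z _ => cf z) fW).
have [e1 e10 he1] := set_tube oX (@compact_nm_le R 1) (fun z _ => cf z) fX.
have [e2 e20 he2] := phi_tube oW uphi (@compact_circle R) (fun z _ => cf z)
  (fun z _ => @cont_cst _ _ M z) fW hM.
have r20 : 0 < r / 2 by lra.
have /cont_nmP/(_ _ r20)/nbhs_nmP[d1 d10 hd1] := cf 1.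
have qq : 0 < q0 - q by lra.
have K0 : 0 < M + `|q| + 1 by have := normr_ge0 q; lra.
(* Near [-1] the Moebius map does not push towards 1, and only the bound [M] on [phi] is known. A
   spike there absorbs it and adds at most [q0 - q] to the mean. *)
have [|P [P0 Pq PK]] := trig_spike (_ : nm (-1 : C) = 1) K0 qq; first by rewrite nmN nm1.
have [d d0 hd] : exists2 d : R, 0 < d & forall z : C, nm (z + 1) < d -> M + `|q| + 1 < Re P.[z].
  have hP : 0 < Re P.[-1] - (M + `|q| + 1) by lra.
  have /cont_realP/(_ _ hP)/nbhs_nmP[d d0 hd] := @continuous_Re_poly R P (-1).
  exists d => // z zd; have := hd z; rewrite opprK => /(_ zd).
  by rewrite ltr_norml => /andP[? _]; lra.
have m0 : 0 < Num.min (r / 2) (Num.min e1 e2) by rewrite !lt_min r20 e10.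
have /cont_nmP/(_ _ m0)/nbhs_nmP[d2 d20 hd2] := cf 1.
(* With [a = 1 - b]: [b <= d / 2] is needed for [moebius_near1], [b <= d1 d / 8] makes its bound
   [4 b / d] less than [d1], and [b <= d2 / 2] brings [f a] close to [w]. *)
pose b := Num.min (Num.min 1 (d / 2)) (Num.min (d1 * d / 8) (d2 / 2)).
have [b0 [b1 [b2 [b3 b4]]]] : 0 < b /\ b <= 1 /\ b <= d / 2 /\ b <= d1 * d / 8 /\ b <= d2 / 2.
  have d1d : 0 < d1 * d by rewrite mulr_gt0.
  split; first by rewrite !lt_min ltr01 !divr_gt0.
  by rewrite /b !ge_min !lexx ?orbT.
clearbody b; pose a := 1 - b.
have a01 : 0 <= a < 1 by rewrite /a; apply/andP; split; lra.
have faw : nm (f a%:C - w) < Num.min (r / 2) (Num.min e1 e2).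
  apply: hd2; rewrite -(rmorph1 (real_complex R)) -rmorphB nm_real /a addrC addKr normrN.
  by rewrite gtr0_norm//; lra.
move: (faw); rewrite !lt_min => /andP[fr /andP[fe1 fe2]].
(* While the Moebius parameter grows from 0 to [a], the disc is translated so that at [t = 1] its
   centre [f a] has been moved to [w]. *)
pose H t z := f (moebius (clamp t * a) z) + (clamp t)%:C *: (w - f a%:C).
have ta01 t : 0 <= clamp t * a < 1.
  have /andP[a0 a1] := a01; have /andP[c0 c1] := clamp01 t.
  apply/andP; split; first exact: mulr_ge0.
  by apply: le_lt_trans a1; rewrite ler_piMl.
have Hf t z : nm (H t z - f (moebius (clamp t * a) z)) <= nm (f a%:C - w).
  have /andP[c0 c1] := clamp01 t.
  rewrite /H addrC addKr nmZ nm_real ger0_norm// (nmBC w).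
  by rewrite ler_piMl ?nm_ge0.
have cl1 : clamp 1 = 1 :> R by rewrite clamp_id// ler01 lexx.
have BH : B (H 1).
  apply: (@class_family_path _ _ _ _ p f H Bf).
  - move=> s; apply: (@cont_add _ _ _ (fun q : R * C => f (moebius (clamp q.1 * a) q.2))).
      apply: (@cont_comp _ _ _ (fun q : R * C => moebius (clamp q.1 * a) q.2) f); last exact: cf.
      exact: moebius_continuous.
    apply: (@cont_scale _ _ _ (fun q : R * C => (clamp q.1)%:C)); last exact: cont_cst.
    apply: (@cont_comp _ _ _ (fst : R * C -> R) (fun t => (clamp t)%:C)); first exact: cvg_fst.
    by apply: (@cont_comp _ _ _ clamp (real_complex R)); [exact: clamp_continuous|exact: complexC_continuous].
  - move=> t t01; split.
    + move=> z; suff : {for z, continuous (fun z : C => f (moebius (clamp t * a) z) + (clamp t)%:C *: (w - f a%:C))} by [].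
      apply: cont_add; last exact: cont_cst.
      apply: (@cont_comp _ _ _ (moebius (clamp t * a)) f); last exact: cf.
      have cc := @moebius_continuous a a01 (t, z).
      by apply: (@cont_comp _ _ _ (fun z : C => (t, z)) (fun q : R * C => moebius (clamp q.1 * a) q.2));
        [apply: cont_pair; [exact: cont_cst|exact: cont_id]|exact: cc].
    + move=> z z1; apply: derivableD; last exact: derivable_cst.
      apply: (@derivable_compose _ _ f (moebius (clamp t * a))).
        exact: moebius_derivable.
      by apply: df; exact: moebius_lt1.
    + move=> z z1; apply: (he1 (moebius (clamp t * a) z)); first exact: moebius_le1.
      exact: le_lt_trans (Hf t z) fe1.
    + move=> z z1; have [] := he2 (moebius (clamp t * a) z) (H t z) => //.
        exact: moebius_circle.
      exact: le_lt_trans (Hf t z) fe2.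
  - have cl0 : clamp 0 = 0 :> R by rewrite clamp_id// ler01 lexx.
    by move=> z z1; rewrite /H cl0 mul0r moebius_id// scale0r addr0.
have H10 : H 1 0 = w by rewrite /H cl1 mul1r moebius0 scale1r addrC subrK.
move: h2; apply/negP; rewrite -leNgt.
apply: (@le_trans _ _ (circle_mean (fun z => phi (H 1 z)))).
  by apply: ereal_inf_lbound; exists (H 1).
apply: (@le_trans _ _ (Re ((q%:C)%:P + P).[0])%:E); last first.
  by rewrite lee_fin hornerD hornerC raddfD /=; lra.
have uH := usc_disc oW uphi (proj1 BH).
apply: circle_mean_le_poly; first exact: uH.
move=> z Tz; rewrite hornerD hornerC raddfD /=.
have := Hf 1 z; rewrite cl1 mul1r => Hfz.
have [zd|dz] := ltP (nm (z + 1)) d.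
  have [|_ hz] := he2 (moebius a z) (H 1 z) (moebius_circle a01 Tz); first exact: le_lt_trans Hfz fe2.
  apply: (le_trans (ltW hz)); rewrite lee_fin.
  by have := hd z zd; have := ler_norm (- q); rewrite normrN; lra.
apply: (@le_trans _ _ q%:E); last by rewrite lee_fin lerDl P0.
apply/ltW/hr.
have md : nm (moebius a z - 1) < d1.
  apply: (@le_lt_trans _ _ (4 * (1 - a) / d)).
    by apply: moebius_near1 => //; rewrite /a; lra.
  rewrite ltr_pdivrMr// /a; have : 0 < d1 * d by rewrite mulr_gt0.
  lra.
have := hd1 _ md; have := nm_triangle (H 1 z) (f (moebius a z)) w; rewrite -/w; lra.
Qed.

End Boundary.

Theorem theorem7 (R : realType) (n : nat) (X W : set 'rV[R[i]]_n)
    (dX : domain X) (dW : domain W) (sWX : W `<=` X) :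
  (exists s : X -> disc_classes X W,
     [/\ continuous s,
         forall x : X, main_component sWX (s x),
         forall x : X, class_centre (s x) = val x
       & forall (w : W) (x : X), val x = val w ->
           s x = tautological_section sWX w])
  \/
  (exists p : disc_classes X W,
     set_bij (connected_component setT p) X (@class_centre R n X W)) ->
  forall phi : 'rV[R[i]]_n -> \bar R, usc_on W phi ->
  forall x, X x -> psh_envelope X W phi x = disc_envelope X W phi x.
Proof.
have [oX _ [x0 Xx0]] := dX; have [oW cW _] := dW.
move=> hyp phi uphi x Xx; rewrite disc_envelopeE.
case: hyp => [[s [cs _ sX sW]]|[p pbij]].
  have gB : good_discs X W (class_family (range s)).
    apply: good_class_family; last by move=> f; exact: section_shift.
    split.
    - by move=> _ [y _ <-]; rewrite sX; exact: set_mem (valP y).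
    - by move=> _ _ /set_mem[y _ <-] /set_mem[z _ <-]; rewrite !sX => /val_inj ->.
    - move=> y Xy; exists (s (SigSub (mem_set Xy))); first by exists (SigSub (mem_set Xy)).
      by rewrite sX.
  apply: (psh_envelopeE oX oW sWX gB uphi) => // w Ww.
  apply: envelope_cst; last by have [] := uphi w Ww.
  split; first exact: holodisc_cst.
  exists (cst_disc sWX (SigSub (mem_set Ww))) => //.
  exists (SigSub (mem_set (sWX _ Ww))) => //; exact: sW.
have gB : good_discs X W (class_family (connected_component setT p)).
  by apply: good_class_family => // f; exact: component_shift.
have [f0 Bf0 _] := good_fibre gB Xx0.
apply: (psh_envelopeE oX oW sWX gB uphi) => // w Ww.
have BN : class_family (connected_component setT p) !=set0 by exists f0.
have [f Bf <-] := boundary_values oX oW sWX cW BN Ww.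
exact: envelope_boundary.
Qed.
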